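(* Let $\phi=\tilde p/p$ satisfy (A1), and let $z_1=\psi^0_1(z_2),\dots,z_1=\psi^0_{L_0}(z_2)$ be the branches of $\mathcal{Z}_{\tilde p}$ near $(1,1)$. Then for almost every pair $\lambda,\mu\in\mathbb{T}$ we have $L_\lambda,L_\mu\ge L_0$. Furthermore, after a reordering of the components of $\mathcal{L}_\lambda(\phi)$ and $\mathcal{L}_\mu(\phi)$ near $(1,1)$, the $z_1$-contact order of $z_1=\psi^0_\ell(z_2)$ at $(1,1)$ is at most the order of contact between $z_1=\psi^\mu_\ell(z_2)$ and $z_1=\psi^\lambda_\ell(z_2)$ at $(1,1)$, for $1\le\ell\le L_0$.
   Context: $\mathbb{D}$ is the open unit disk, $\mathbb{T}$ the unit circle, $\Pi$ the open upper half-plane, $\beta(w)=\frac{1+iw}{1-iw}$ (a conformal map $\Pi\to\mathbb{D}$), $\beta^{-1}(z)=i\frac{1-z}{1+z}$. For a polynomial $p\in\mathbb{C}[z_1,z_2]$ of bidegree $(m,n)$, its reflection is $\tilde p(z_1,z_2)=z_1^mz_2^n\overline{p(1/\bar z_1,1/\bar z_2)}$. A rational inner function (RIF) on $\mathbb{D}^2$ is a rational function that is holomorphic and bounded on $\mathbb{D}^2$ with $|\phi|=1$ a.e. on $\mathbb{T}^2$. We write $f\approx g$ if each of $f,g$ is bounded by a positive constant multiple of the other. (A1): $\phi=\tilde p/p$ is an RIF on $\mathbb{D}^2$, where $p$ has no zeros in $\mathbb{D}^2$ and $p,\tilde p$ have no common factor; $\phi$ has a singularity at $(1,1)$ (i.e.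 $p(1,1)=0$, hence also $\tilde p(1,1)=0$); and the non-tangential value of $\phi$ at $(1,1)$ is $1$. Branches of the zero set. Let $q(w_1,w_2)=(1-iw_1)^m(1-iw_2)^n\tilde p(\beta(w_1),\beta(w_2))$. Near $(0,0)$ factor $q=\alpha q_1\cdots q_L$ with $\alpha$ a unit and $q_k$ irreducible Weierstrass polynomials in $w_1$ of degree $N_k$; the zero set of $q_k$ is given by a Puiseux series $w_1=\Psi^0_k(w_2^{1/N_k})$ with $\Psi_k^0$ a convergent power series, $\Psi^0_k(0)=0$. Choosing the $N_k$ branches of the root with discontinuity only on $(-\infty,0]$, one gets $L_0=N_1+\dots+N_L$ functions $\psi^0_\ell(z_2)=\beta\big(\Psi^0_k(\beta^{-1}(z_2)^{1/N_k})\big)$; the curves $z_1=\psi^0_\ell(z_2)$ are the branches of $\mathcal{Z}_{\tilde p}=\{\tilde p=0\}$ near $(1,1)$. The $z_1$-contact order of a branch is the even number $\mathcal{K}^1_\ell$ with $1-|\psi^0_\ell(\zeta_2)|\approx|1-\zeta_2|^{\mathcal{K}^1_\ell}$ for $\zeta_2\in\mathbb{T}$ close to $1$ (it exists). Level sets. For $\mu\in\mathbb{T}$, $\mathcal{L}_\mu(\phi)=\{z\in\mathbb{C}^2:\tilde p(z)=\mu p(z)\}$. Near $(1,1)$, $\mathcal{L}_\mu(\phi)$ is a union of $L_\mu$ graphs $z_1=\psi_j^\mu(z_2)$, $j=1,\dots,L_\mu$, with $\psi^\mu_j$ analytic near $1$ and $\psi^\mu_j(1)=1$, together with, for at most one $\mu\in\mathbb{T}$,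 possibly the line $\{z_2=1\}$. If $\psi_1,\psi_2$ are analytic near $1$ with $\psi_1(1)=\psi_2(1)=1$, the order of contact of $z_1=\psi_1(z_2)$ and $z_1=\psi_2(z_2)$ at $(1,1)$ is the smallest positive integer $K$ with $\psi_1^{(K)}(1)\ne\psi_2^{(K)}(1)$; equivalently $|\psi_1(z_2)-\psi_2(z_2)|\approx|1-z_2|^K$ near $1$. ''Almost every pair'' refers to Lebesgue measure on $\mathbb{T}\times\mathbb{T}$. *)

(* Defs.v *)
From HB Require Import structures.
From mathcomp Require Import all_boot all_order all_algebra.
From mathcomp Require Import complex polyXY.
From mathcomp Require Import all_classical all_reals all_analysis.

Set Implicit Arguments.
Unset Strict Implicit.
Unset Printing Implicit Defensive.

Import Order.TTheory GRing.Theory Num.Theory numFieldNormedType.Exports.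
Local Open Scope classical_set_scope.
Local Open Scope ring_scope.

(* R[i] packed as a numClosedFieldType, so that the topology and the norm that
   MathComp-Analysis attaches to every such type are inferred on it. *)
Definition cplx (R : realType) : numClosedFieldType := R[i]%C.

Section Definitions.
Variable R : realType.
Local Notation C := (cplx R).

Definition cis (t : R) : C := (cos t +i* sin t)%C.

Definition bidisk : set (C * C) := [set z | `|z.1| < 1 /\ `|z.2| < 1].

(* A subset of the torus T x T is null iff its preimage under
   (s, t) |-> (e^{is}, e^{it}) is null for Lebesgue measure on the plane. *)
Definition ae_torus (P : C -> C -> Prop) : Prop :=
  {ae (@lebesgue_measure R \x @lebesgue_measure R)%E,
    forall st : R * R, P (cis st.1) (cis st.2)}.

(* Bivariate polynomials are {poly {poly C}}; the outer variable is z_1 and the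
   inner one is z_2, so that p`_i`_j is the coefficient of z_1^i z_2^j. *)
Definition eval2 (p : {poly {poly C}}) (z : C * C) : C := p.[z.1, z.2].

Definition has_bidegree (m n : nat) (p : {poly {poly C}}) : Prop :=
  size p = m.+1 /\ sizeY p = n.+1.

(* See reflectionE below for the usual formula. *)
Definition reflection (m n : nat) (p : {poly {poly C}}) : {poly {poly C}} :=
  \poly_(i < m.+1) \poly_(j < n.+1) (p`_(m - i)`_(n - j))^*.

Definition no_common_factor (p q : {poly {poly C}}) : Prop :=
  forall d u v : {poly {poly C}},
    p = d * u -> q = d * v -> d \is a GRing.unit.

Definition ratio (q p : {poly {poly C}}) (z : C * C) : C :=
  eval2 q z / eval2 p z.

Definition rational_inner (f : C * C -> C) : Prop :=
  [/\ exists a b : {poly {poly C}},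
        b != 0 /\ (forall z, eval2 b z != 0 -> f z = ratio a b z),
      forall z, bidisk z -> differentiable f z,
      exists M : C, forall z, bidisk z -> `|f z| <= M &
      ae_torus (fun z1 z2 => `|f (z1, z2)| = 1)].

(* The norm on C * C is the maximum norm. *)
Definition nontangential_value (f : C * C -> C) (tau : C * C) (l : C) : Prop :=
  forall c : C, 0 < c ->
    f z @[z --> within [set z | bidisk z /\ `|z - tau| <= c * (1 - `|z|)]
                       (nbhs tau)] --> l.

Definition A1 (m n : nat) (p : {poly {poly C}}) : Prop :=
  let pt := reflection m n p in
  [/\ has_bidegree m n p,
      forall z, bidisk z -> eval2 p z != 0,
      no_common_factor p pt,
      rational_inner (ratio pt p) &
      eval2 p (1, 1) = 0 /\ nontangential_value (ratio pt p) (1, 1) 1].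

Definition beta (w : C) : C := (1 + 'i * w) / (1 - 'i * w).
Definition beta_inv (z : C) : C := 'i * ((1 - z) / (1 + z)).

Definition analytic_near (f : C -> C) (a : C) : Prop :=
  exists c : nat -> C, \forall z \near a,
    [series c k * (z - a) ^+ k]_k @ \oo --> f z.

Definition holomorphic2_near (f : C * C -> C) (a : C * C) : Prop :=
  \forall z \near a, differentiable f z.

Definition weierstrass (N : nat) (f : C * C -> C) : Prop :=
  exists a : 'I_N -> C -> C,
    (forall j, analytic_near (a j) 0 /\ a j 0 = 0) /\
    \forall w \near ((0, 0) : C * C),
      f w = w.1 ^+ N + \sum_(j < N) a j w.2 * w.1 ^+ j.

(* Irreducibility in the local ring of germs at (0,0) of holomorphic functions;
   the units of this ring are the germs not vanishing at (0,0). *)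
Definition irreducible_germ (f : C * C -> C) : Prop :=
  f (0, 0) = 0 /\
  forall g h : C * C -> C,
    holomorphic2_near g (0, 0) -> holomorphic2_near h (0, 0) ->
    (\forall w \near ((0, 0) : C * C), f w = g w * h w) ->
    g (0, 0) != 0 \/ h (0, 0) != 0.

(* In the order of C, w <= 0 means that w is real and nonpositive, so the
   branches are continuous off the slit (-oo, 0]; on the slit, the N values are
   the N roots in an arbitrary order. *)
Definition root_branches (N : nat) (r : 'I_N -> C -> C) : Prop :=
  [/\ forall j w, r j w ^+ N = w,
      forall j w, ~~ (w <= 0) -> {for w, continuous (r j)} &
      forall w, w != 0 -> injective (fun j => r j w)].

Definition upper_half_plane_form (m n : nat) (pt : {poly {poly C}})
    (w : C * C) : C :=
  (1 - 'i * w.1) ^+ m * (1 - 'i * w.2) ^+ n * eval2 pt (beta w.1, beta w.2).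

Definition zero_set_branches (m n : nat) (pt : {poly {poly C}}) (L0 : nat)
    (psi : 'I_L0 -> C -> C) : Prop :=
  exists (L : nat) (N : 'I_L -> nat)
    (alpha : C * C -> C) (q : 'I_L -> C * C -> C) (Psi : 'I_L -> C -> C)
    (r : forall k, 'I_(N k) -> C -> C) (e : 'I_L0 -> {k : 'I_L & 'I_(N k)}),
  [/\ holomorphic2_near alpha (0, 0) /\ alpha (0, 0) != 0,
      \forall w \near ((0, 0) : C * C),
        upper_half_plane_form m n pt w = alpha w * \prod_(k < L) q k w,
      forall k, [/\ (0 < N k)%N, weierstrass (N k) (q k) &
                    irreducible_germ (q k)],
      forall k, [/\ analytic_near (Psi k) 0, Psi k 0 = 0,
                    root_branches (r k) &
                    \forall w \near ((0, 0) : C * C),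
                      q k w = 0 <->
                      exists t, t ^+ N k = w.2 /\ w.1 = Psi k t] &
      bijective e /\
      forall l, \forall z \near (1 : C),
        psi l z = beta (Psi (tag (e l)) (r _ (tagged (e l)) (beta_inv z)))].

Definition is_contact_order (psi : C -> C) (K : nat) : Prop :=
  ~~ odd K /\
  exists c c' : C, [/\ 0 < c, 0 < c' &
    \forall z \near (1 : C), `|z| = 1 ->
      c * `|1 - z| ^+ K <= 1 - `|psi z| <= c' * `|1 - z| ^+ K].

Definition level_set (q p : {poly {poly C}}) (mu : C) : set (C * C) :=
  [set z | eval2 q z = mu * eval2 p z].

(* The boolean tells whether the line z_2 = 1 is a component. *)
Definition level_set_branches (q p : {poly {poly C}}) (mu : C) (L : nat)
    (psi : 'I_L -> C -> C) : Prop :=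
  [/\ forall j, analytic_near (psi j) 1 /\ psi j 1 = 1,
      forall i j, i != j -> ~ (\forall z \near (1 : C), psi i z = psi j z) &
      exists line : bool, \forall z \near ((1, 1) : C * C),
        level_set q p mu z <->
        (exists j, z.1 = psi j z.2) \/ (line /\ z.2 = 1)].

Definition is_order_of_contact (psi1 psi2 : C -> C) (K : nat) : Prop :=
  [/\ (0 < K)%N, derive1n K psi1 1 != derive1n K psi2 1 &
      forall k, (0 < k < K)%N -> derive1n k psi1 1 = derive1n k psi2 1].

Lemma reflectionE (m n : nat) (p : {poly {poly C}}) (z1 z2 : C) :
  has_bidegree m n p -> z1 != 0 -> z2 != 0 ->
  eval2 (reflection m n p) (z1, z2) =
  z1 ^+ m * z2 ^+ n * (eval2 p (1 / z1^*, 1 / z2^*))^*.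
Proof.
move=> [sp spY] z1n0 z2n0; rewrite /eval2 /reflection /=.
have row (s : {poly C}) (z : C) k : (size s <= k.+1)%N -> z != 0 ->
    (\poly_(j < k.+1) (s`_(k - j))^*).[z] = z ^+ k * (s.[1 / z^*])^*.
  move=> ss zn0; rewrite horner_poly (horner_coef_wide _ ss) rmorph_sum mulr_sumr.
  rewrite (reindex_inj rev_ord_inj) /=; apply: eq_bigr => j _.
  have jk : (j <= k)%N by rewrite -ltnS.
  rewrite subSS subKn // rmorphM rmorphXn /= fmorph_div rmorph1 /= conjCK.
  by rewrite mulrCA div1r exprVn -expfB_cond // (negPf zn0).
have hor (u : {poly {poly C}}) k x y : (size u <= k)%N ->
    u.[x, y] = \sum_(i < k) (u`_i).[y] * x ^+ i.
  move=> uk; rewrite (horner_coef_wide _ uk) -horner_evalE rmorph_sum /=.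
  by apply: eq_bigr => i _; rewrite /horner_eval hornerM -rmorphXn hornerC.
have sizep i : (size (p`_i)%R <= n.+1)%N.
  by rewrite -spY max_size_coefXY.
rewrite (hor _ m.+1) ?size_poly // (hor p m.+1) ?sp // rmorph_sum mulr_sumr.
rewrite (reindex_inj rev_ord_inj) /=; apply: eq_bigr => i _.
have im : (i <= m)%N by rewrite -ltnS.
rewrite coef_poly subSS ltnS leq_subr subKn // row // rmorphM rmorphXn /=.
rewrite fmorph_div rmorph1 /= conjCK.
have -> : z1 ^+ (m - i) = z1 ^+ m * (1 / z1) ^+ i.
  by rewrite expfB_cond ?(negPf z1n0) // expr_div_n expr1n div1r.
by rewrite mulrCA -!mulrA; congr (_ * _); rewrite mulrCA.
Qed.

End Definitions.

(* Main.v *)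
(* In the half-plane coordinates [w = beta^-1 z], with [w_2 = x] real and small,
   [q (w, x)] is a polynomial [P_x] in [w] whose roots lie in the open upper
   half-plane, and for real [w] the equation of the level set of [lam] reads
   [P_x w = lam * (P_x w)^*].  A branch of the zero set is [c x + O (x ^ K)] with
   [c] a real polynomial, and its imaginary part is comparable to [x ^ K]; here
   [K] is the contact order.  On [c x - M x ^ K, c x + M x ^ K] the phase of
   [P_x / P_x^*] grows by almost [2 pi] for each zero at distance [O (x ^ K)] of
   [c x].  Hence, of two different values [lam], at least one is taken in this
   interval as many times as there are such zeros, so all values but at most one
   are.  Off this finite set of values, every branch of the zero set thus has
   enough level branches agreeing with it up to [O (x ^ K)], and treating the
   branches by decreasing [K] matches them injectively.  Two level branches
   matched to the same zero branch then agree up to [O (x ^ K)]. *)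
Require Import Defs.
From HB Require Import structures.
From mathcomp Require Import all_boot all_order all_algebra all_fingroup.
From mathcomp Require Import complex polyXY.
From mathcomp Require Import all_classical all_reals all_analysis.
From mathcomp Require Import measurable_realfun ring lra zify.

Set Implicit Arguments.
Unset Strict Implicit.
Unset Printing Implicit Defensive.

Import Order.TTheory GRing.Theory Num.Theory numFieldNormedType.Exports.
Local Open Scope classical_set_scope.
Local Open Scope ring_scope.

(** Two things could spoil the count. Which of two values is taken often enough may depend on [x],
    and the level branches are given, not constructed. Both are settled by a dichotomy: an analytic
    branch compared with a polynomial curve is either [O (x ^ K)] close for all small [x], or
    farther than [M x ^ K] for all small [x], because up to [O (x ^ K)] their difference is, after
    clearing denominators, a polynomial in [x]. Hence enough solutions at one small [x] already
    yield enough branches, and two bad values exclude each other. That the roots of [P_x] lie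
    strictly above the real line for small [x != 0] rests on two facts: [p] has no zero on disk
    times circle, by a Hurwitz argument and coprimality, and the common zeros of [p] and its
    reflection have finitely many second coordinates, by a resultant. The zeros must be counted with
    the multiplicities of the Weierstrass polynomials; these pass to [P_x] because the quotient is
    locally bounded. *)

(** * Real-valued modulus and real radii *)

Section Modulus.
Variable R : realType.
Local Notation C := (cplx R).
Implicit Types (z w : C) (x y : R).

(** The norm of [C] takes values in [C] itself; these copies bring every estimate into the ordered
    field [R], where [lra] and [nra] apply. *)
Definition rc (x : R) : C := real_complex R x.
Definition nm (z : C) : R := ComplexField.Normc.normc z.
Definition re (z : C) : R := complex.Re z.
Definition im (z : C) : R := complex.Im z.

HB.instance Definition _ := GRing.isAdditive.Build R C rc (rmorphB (real_complex R)).
HB.instance Definition _ := GRing.isMultiplicative.Build R C rc (rmorphismMP (real_complex R)).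

Arguments nm : simpl never.
Arguments re : simpl never.
Arguments im : simpl never.

Lemma normE z : `|z| = rc (nm z). Proof. by []. Qed.

Lemma rc_inj : injective rc. Proof. by move=> x y []. Qed.
Lemma le_rc x y : (rc x <= rc y) = (x <= y). Proof. exact: lecR. Qed.
Lemma lt_rc x y : (rc x < rc y) = (x < y). Proof. exact: ltcR. Qed.

Lemma nm0 : nm 0 = 0. Proof. exact: ComplexField.Normc.normc0. Qed.
Lemma nm1 : nm 1 = 1. Proof. exact: ComplexField.Normc.normc1. Qed.
Lemma nmM z w : nm (z * w) = nm z * nm w.
Proof. exact: ComplexField.Normc.normcM. Qed.
Lemma nmV z : nm z^-1 = (nm z)^-1. Proof. exact: ComplexField.Normc.normcV. Qed.
Lemma nmN z : nm (- z) = nm z. Proof. exact: (@normcN R). Qed.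
Lemma nmD z w : nm (z + w) <= nm z + nm w. Proof. exact: (@le_normcD R). Qed.
Lemma nmX z k : nm (z ^+ k) = nm z ^+ k.
Proof. by elim: k => [|k IH]; rewrite ?expr0 ?nm1 // !exprS nmM IH. Qed.
Lemma nm_ge0 z : 0 <= nm z. Proof. by case: z => a b; exact: sqrtr_ge0. Qed.
Lemma nm_eq0 z : (nm z == 0) = (z == 0).
Proof.
by apply/eqP/eqP => [/(@ComplexField.Normc.eq0_normc R)//|->]; exact: nm0.
Qed.
Lemma nm_gt0 z : (0 < nm z) = (z != 0).
Proof. by rewrite lt_neqAle nm_ge0 andbT eq_sym nm_eq0. Qed.
Lemma nm_sum (I : Type) (r : seq I) (P : pred I) (F : I -> C) :
  nm (\sum_(i <- r | P i) F i) <= \sum_(i <- r | P i) nm (F i).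
Proof.
elim/big_ind2: _ => [|z x w y hz hw|i _ //]; first by rewrite nm0.
exact: le_trans (nmD _ _) (lerD hz hw).
Qed.
Lemma nm_prod (I : Type) (r : seq I) (P : pred I) (F : I -> C) :
  nm (\prod_(i <- r | P i) F i) = \prod_(i <- r | P i) nm (F i).
Proof. by elim/big_ind2: _ => [|z x w y <- <-|//]; rewrite ?nm1 ?nmM. Qed.
Lemma nmB z w : nm (z - w) = nm (w - z). Proof. by rewrite -nmN opprB. Qed.
Lemma nmBD z w : nm z - nm w <= nm (z - w).
Proof. by rewrite lerBlDr; apply: le_trans (nmD _ _); rewrite subrK. Qed.
Lemma nm_rc x : nm (rc x) = `|x|.
Proof. by rewrite /nm /= expr0n /= addr0 sqrtr_sqr. Qed.
Lemma nm_nat n : nm n%:R = n%:R.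
Proof. by rewrite -[in LHS](rmorph_nat (@rc)) nm_rc ger0_norm. Qed.
Lemma nmi : nm 'i = 1.
Proof. by rewrite -complexiE /nm /= expr0n /= add0r expr1n sqrtr1. Qed.
Lemma nm_sqr z : nm z ^+ 2 = re z ^+ 2 + im z ^+ 2.
Proof. by case: z => a b; rewrite /nm /= sqr_sqrtr // addr_ge0 ?sqr_ge0. Qed.
Lemma re_le z : `|re z| <= nm z.
Proof.
rewrite -(@ler_pXn2r _ 2%N) ?nnegrE ?nm_ge0 // nm_sqr real_normK ?num_real //.
by rewrite lerDl sqr_ge0.
Qed.
Lemma im_le z : `|im z| <= nm z.
Proof.
rewrite -(@ler_pXn2r _ 2%N) ?nnegrE ?nm_ge0 // nm_sqr real_normK ?num_real //.
by rewrite lerDr sqr_ge0.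
Qed.
Lemma cE z : z = rc (re z) + 'i * rc (im z).
Proof. by rewrite -complexiE; exact: complexE. Qed.
Lemma nm_le z : nm z <= `|re z| + `|im z|.
Proof.
by rewrite {1}(cE z); apply: le_trans (nmD _ _) _; rewrite nmM nmi mul1r !nm_rc.
Qed.
Lemma conjE z : z^* = rc (re z) - 'i * rc (im z).
Proof.
rewrite [in LHS](cE z) rmorphD rmorphM /= conjCi mulNr.
by congr (_ - _ * _); [|]; apply: conj_Creal; apply/complex_realP; eexists.
Qed.
Lemma nmJ z : nm z^* = nm z. Proof. by apply: rc_inj; rewrite -!normE norm_conjC. Qed.
Lemma conj_rc x : (rc x)^* = rc x.
Proof. by apply: conj_Creal; apply/complex_realP; exists x. Qed.
Lemma reD z w : re (z + w) = re z + re w. Proof. by case: z w => a b []. Qed.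
Lemma imD z w : im (z + w) = im z + im w. Proof. by case: z w => a b []. Qed.
Lemma reN z : re (- z) = - re z. Proof. by case: z. Qed.
Lemma imN z : im (- z) = - im z. Proof. by case: z. Qed.
Lemma reM z w : re (z * w) = re z * re w - im z * im w.
Proof. by case: z w => a b []. Qed.
Lemma imM z w : im (z * w) = re z * im w + im z * re w.
Proof. by case: z w => a b []. Qed.
Lemma re_rc x : re (rc x) = x. Proof. by []. Qed.
Lemma im_rc x : im (rc x) = 0. Proof. by []. Qed.
Lemma re1 : re 1 = 1. Proof. by []. Qed.
Lemma im1 : im 1 = 0. Proof. by []. Qed.
Lemma re_i : re 'i = 0. Proof. by rewrite -complexiE. Qed.
Lemma im_i : im 'i = 1. Proof. by rewrite -complexiE. Qed.
Lemma ceq z w : re z = re w -> im z = im w -> z = w.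
Proof. by case: z w => a b [c d] /= ; rewrite /re /im /= => -> ->. Qed.
Lemma im0_rc z : im z = 0 -> z = rc (re z).
Proof. by move=> h; apply: ceq. Qed.
Lemma im_sum (I : Type) (r : seq I) (P : pred I) (F : I -> C) :
  im (\sum_(i <- r | P i) F i) = \sum_(i <- r | P i) im (F i).
Proof. by elim/big_ind2: _ => [//|z x w y <- <-|//]; rewrite imD. Qed.
Lemma nm_eq1J z : nm z = 1 -> z^* = z^-1.
Proof.
move=> h; have z0 : z != 0 by rewrite -nm_gt0 h.
apply: (mulfI z0); rewrite -normCK normE h expr1n divff //.
Qed.

Lemma near_nm (a : C) (P : C -> Prop) :
  (\forall z \near a, P z) <->
  exists2 d : R, 0 < d & forall z, nm (z - a) < d -> P z.
Proof.
split.
  move/nbhs_ballP => [e /= e0 he].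
  have ee : e = rc (re e) by apply: im0_rc; rewrite /im; exact: ger0_Im (ltW e0).
  exists (re e); first by rewrite -lt_rc -ee.
  by move=> z hz; apply: he; rewrite -ball_normE /= distrC normE ee lt_rc.
move=> [d d0 hd]; apply/nbhs_ballP; exists (rc d); first by rewrite /= lt_rc.
by move=> z; rewrite -ball_normE /= distrC normE lt_rc => /hd.
Qed.

Lemma near2_nm (a b : C) (P : C * C -> Prop) :
  (\forall z \near (a, b), P z) <->
  exists2 d : R, 0 < d & forall z w, nm (z - a) < d -> nm (w - b) < d -> P (z, w).
Proof.
split.
  move/nbhs_ballP => [e /= e0 he].
  have ee : e = rc (re e) by apply: im0_rc; rewrite /im; exact: ger0_Im (ltW e0).
  exists (re e); first by rewrite -lt_rc -ee.
  move=> z w hz hw; apply: he; split.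
    by rewrite -ball_normE /= distrC normE ee lt_rc.
  by rewrite -ball_normE /= distrC normE ee lt_rc.
move=> [d d0 hd]; apply/nbhs_ballP; exists (rc d); first by rewrite /= lt_rc.
move=> [z w] []; rewrite -!ball_normE /= distrC normE lt_rc => hz.
by rewrite distrC normE lt_rc => /(hd _ _ hz).
Qed.

Lemma cvg_nm (u : nat -> C) (l : C) :
  (u @ \oo --> l) <->
  forall e : R, 0 < e -> exists N, forall k, (N <= k)%N -> nm (u k - l) < e.
Proof.
split.
  move=> h e e0.
  have /near_nm : \forall z \near l, nm (z - l) < e.
    by apply/near_nm; exists e.
  move=> [d d0 hd].
  have : nbhs l [set z | nm (z - l) < e] by apply/near_nm; exists e.
  by move/h => [N _ hN]; exists N => k hk; apply: hN.
move=> h A /near_nm [d d0 hd]; have [N hN] := h d d0.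
by exists N => // k /= hk; apply: hd; apply: hN.
Qed.

End Modulus.

Arguments nm : simpl never.
Arguments re : simpl never.
Arguments im : simpl never.

(** * Power series: Taylor remainders and termwise differentiation *)

Section PowerSeries.
Variable R : realType.
Local Notation C := (cplx R).
Implicit Types (f : C -> C) (a z : C) (c u : nat -> C).

Definition has_pseries f a c := exists2 r : R, 0 < r &
  forall z, nm (z - a) < r -> [series c k * (z - a) ^+ k]_k @ \oo --> f z.

Lemma analytic_nearE f a : analytic_near f a <-> exists c, has_pseries f a c.
Proof.
by split => -[c hc]; exists c; move: hc; rewrite /has_pseries => /near_nm.
Qed.

Lemma nm_limit_le u (l w : C) (b : R) K : u @ \oo --> l ->
  (forall n, (K <= n)%N -> nm (u n - w) <= b) -> nm (l - w) <= b.
Proof.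
move=> /cvg_nm ul ub; apply/ler_addgt0Pr => e e0.
have [N hN] := ul e e0; pose n := maxn K N.
have -> : l - w = (l - u n) + (u n - w) by ring.
apply: le_trans (nmD _ _) _; rewrite addrC lerD ?ub ?leq_maxl //.
by rewrite nmB ltW // hN // leq_maxr.
Qed.

Lemma geometric_tail (q : R) K n : 0 <= q <= 2^-1 -> (K <= n)%N ->
  \sum_(K <= k < n) q ^+ k <= 2 * q ^+ K.
Proof.
move=> /andP[q0 q2] Kn.
suff : \sum_(K <= k < n) q ^+ k + 2 * q ^+ n <= 2 * q ^+ K.
  by apply: le_trans; rewrite lerDl mulr_ge0 ?exprn_ge0.
elim: n Kn => [|n IH]; first by rewrite leqn0 => /eqP ->; rewrite big_geq ?add0r.
rewrite leq_eqVlt => /predU1P[->|]; first by rewrite big_geq ?add0r.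
rewrite ltnS => Kn; rewrite big_nat_recr //=; apply: le_trans (IH Kn).
rewrite -addrA lerD2l exprS mulrA.
have := exprn_ge0 n q0; nra.
Qed.

(** At the real point [a + r] the late partial sums are within 1 of the limit, so the late terms, as
    differences of two of them, are at most 2; the finitely many early terms are added to the
    bound. *)
Lemma pseries_coef_bound f a c : has_pseries f a c ->
  exists B r : R, [/\ 0 < r, 0 <= B, forall k, nm (c k) * r ^+ k <= B &
    forall z, nm (z - a) < r -> [series c k * (z - a) ^+ k]_k @ \oo --> f z].
Proof.
move=> [r0 r00 h]; pose r := r0 / 2.
have r_gt0 : 0 < r by rewrite divr_gt0.
have rr0 : r < r0 by rewrite /r; lra.
have nz : nm (a + rc r - a) = r by rewrite addrC addKr nm_rc gtr0_norm.
have /cvg_nm/(_ 1 ltr01)[N hN] := h (a + rc r) ltac:(by rewrite nz).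
pose v k : R := nm (c k) * r ^+ k.
have v_ge0 k : 0 <= v k by rewrite mulr_ge0 ?nm_ge0 ?exprn_ge0 // ltW.
exists (2 + \sum_(k < N) v k), r; split => //.
- by rewrite addr_ge0 ?sumr_ge0.
- move=> k; have [kN|Nk] := ltnP k N.
    rewrite (bigD1 (Ordinal kN)) //= addrCA lerDl addr_ge0 ?sumr_ge0 //.
  apply: (@le_trans _ _ 2); last by rewrite lerDl sumr_ge0.
  have h1 := hN k Nk; have h2 := hN k.+1 (leqW Nk).
  have -> : nm (c k) * r ^+ k = nm (c k * (a + rc r - a) ^+ k).
    by rewrite nmM nmX nz.
  move: h1 h2; rewrite /series /= big_nat_recr //=.
  set S := \sum_(_ <= _ < _) _; set t := c k * _ => h1 h2.
  have -> : t = (S + t - f (a + rc r)) - (S - f (a + rc r)) by ring.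
  by apply: le_trans (nmD _ _) _; rewrite nmN; move: h1 h2; lra.
- by move=> z hz; apply: h; apply: lt_trans rr0.
Qed.

(** Halving the radius makes the tail geometric with ratio at most [1 / 2]. *)
Lemma taylor_expansion f a c K : has_pseries f a c ->
  exists A r : R, [/\ 0 < r, 0 <= A & forall z, nm (z - a) < r ->
    nm (f z - \sum_(k < K) c k * (z - a) ^+ k) <= A * nm (z - a) ^+ K].
Proof.
move=> /pseries_coef_bound[B [r [r0 B0 hB hf]]].
exists (B * 2 / r ^+ K), (r / 2); split; first by rewrite divr_gt0.
  by rewrite divr_ge0 ?mulr_ge0 // exprn_ge0 // ltW.
move=> z hz; have zr : nm (z - a) < r by move: hz; rewrite ltr_pdivlMr //; lra.
apply: (@nm_limit_le _ _ _ _ K (hf z zr)) => n Kn.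
rewrite /series /= -(big_mkord xpredT (fun k => c k * (z - a) ^+ k)).
rewrite (big_cat_nat (n := K)) //= addrAC subrr add0r.
apply: le_trans (nm_sum _ _ _) _.
set q := nm (z - a) / r.
have q2 : 0 <= q <= 2^-1.
  apply/andP; split; first by rewrite /q divr_ge0 ?nm_ge0 // ltW.
  by rewrite /q ler_pdivrMr //; move: hz; lra.
have zq : nm (z - a) = q * r by rewrite /q divfK // gt_eqF.
apply: (@le_trans _ _ (\sum_(K <= k < n) B * q ^+ k)).
  apply: ler_sum => k _; rewrite nmM nmX zq exprMn mulrA mulrAC.
  by rewrite ler_wpM2r ?hB // exprn_ge0 //; case/andP: q2.
have rK : r ^+ K != 0 by rewrite expf_neq0 ?gt_eqF.
have -> : B * 2 / r ^+ K * nm (z - a) ^+ K = B * (2 * q ^+ K).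
  by rewrite zq exprMn; field.
by rewrite -big_distrr ler_wpM2l //; exact: geometric_tail.
Qed.

Lemma pseries_at_center f a c : has_pseries f a c -> f a = c 0%N.
Proof.
move=> /(taylor_expansion 1)[A [r [r0 A0 /(_ a)]]].
rewrite subrr nm0 => /(_ r0).
rewrite expr1 mulr0 big_ord1 expr0 mulr1 => h; apply/eqP.
by rewrite -subr_eq0 -nm_eq0 eq_le h nm_ge0.
Qed.

Lemma has_pseriesB f g a c d : has_pseries f a c -> has_pseries g a d ->
  has_pseries (fun z => f z - g z) a (fun k => c k - d k).
Proof.
move=> [r r0 hr] [s s0 hs]; exists (Num.min r s); first by rewrite lt_min r0.
move=> z; rewrite lt_min => /andP[zr zs].
have -> : [series (c k - d k) * (z - a) ^+ k]_k =
   [series c k * (z - a) ^+ k]_k - [series d k * (z - a) ^+ k]_k.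
  apply/funext => n; rewrite /series /= !fctE /= -sumrB.
  by apply: eq_bigr => k _; rewrite mulrBl.
by apply: cvgB; [exact: hr|exact: hs].
Qed.

Lemma pseries0_near f a c : has_pseries f a c -> (forall k, c k = 0) ->
  \forall z \near a, f z = 0.
Proof.
move=> [r r0 hr] c0; apply/near_nm; exists r => // z /hr hz.
apply/eqP; rewrite -nm_eq0 eq_le nm_ge0 andbT -[f z]subr0.
apply: (nm_limit_le (K := 0) hz) => n _.
by rewrite /series /= big1 ?subrr ?nm0 // => k _; rewrite c0 mul0r.
Qed.

Lemma cvg_re_im u (x y : R) : (fun n => re (u n)) @ \oo --> x ->
  (fun n => im (u n)) @ \oo --> y -> u @ \oo --> (rc x + 'i * rc y : C).
Proof.
move=> hx hy; apply/cvg_nm => e e0.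
have e2 : 0 < e / 2 by rewrite divr_gt0.
have /cvgrPdist_lt/(_ _ e2)[N1 _ h1] := hx.
have /cvgrPdist_lt/(_ _ e2)[N2 _ h2] := hy.
exists (maxn N1 N2) => n; rewrite geq_max => /andP[/h1 /= {}h1 /h2 /= {}h2].
apply: le_lt_trans (nm_le _) _; move: h1 h2.
rewrite !(reD, imD, reN, imN, reM, imM, re_i, im_i, re_rc, im_rc).
rewrite distrC [`|y - _|]distrC => h1 h2.
by rewrite !(mul0r, mul1r, mulr0, subrr, addr0, add0r); move: h1 h2; lra.
Qed.

Lemma cvg_series_dominated u (A : R) : (forall k, nm (u k) <= A * 2^-1 ^+ k) ->
  exists l : C, series u @ \oo --> l.
Proof.
move=> hu.
have dom (v : nat -> R) : (forall k, `|v k| <= nm (u k)) -> cvgn (series v).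
  move=> hv; apply: normed_cvg; apply: (@series_le_cvg _ _ (geometric A 2^-1)).
  - by move=> n /=; exact: normr_ge0.
  - move=> n /=; rewrite (le_trans (normr_ge0 (v n))) //.
    exact: le_trans (hv n) (hu n).
  - by move=> n /=; exact: le_trans (hv n) (hu n).
  - by apply: is_cvg_geometric_series; rewrite gtr0_norm ?invr_gt0 // invf_lt1 // ltr1n.
have reS n : re (series u n) = series (fun k => re (u k)) n.
  by rewrite /series /=; elim/big_ind2: _ => [//|z x w y <- <-|//]; rewrite reD.
have imS n : im (series u n) = series (fun k => im (u k)) n.
  by rewrite /series /= im_sum.
have /cvg_ex[x hx] := dom (fun k => re (u k)) (fun k => re_le _).
have /cvg_ex[y hy] := dom (fun k => im (u k)) (fun k => im_le _).
exists (rc x + 'i * rc y); apply: cvg_re_im.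
  by rewrite (_ : (fun _ => _) = series (fun k => re (u k))) //; apply/funext.
by rewrite (_ : (fun _ => _) = series (fun k => im (u k))) //; apply/funext.
Qed.

Lemma sqrn_le_exp k : (k ^ 2 <= 2 * 2 ^ k)%N.
Proof.
case: k => [//|[//|[//|k]]]; elim: k => [//|k IH].
rewrite [(2 ^ _)%N]expnS; apply: leq_trans (_ : 2 * (k.+3 ^ 2) <= _)%N; last first.
  by rewrite leq_mul2l IH orbT.
by rewrite -!mulnn; nia.
Qed.

(* Second order remainder of [z ^+ k]; scaled by [r ^+ 2] to avoid [k - 2]. *)
Lemma expr_remainder (r : R) (z h : C) k : nm z <= r -> nm (z + h) <= r ->
  nm ((z + h) ^+ k - z ^+ k - h * (z ^+ k.-1 *+ k)) * r ^+ 2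
    <= (k ^ 2)%:R * r ^+ k * nm h ^+ 2.
Proof.
move=> zr zhr; have r0 : 0 <= r := le_trans (nm_ge0 _) zr.
elim: k => [|k IH]; first by rewrite !expr0 mulr0n mulr0 subrr subr0 nm0 !mul0r.
set D := _ - _ - _ in IH *.
have -> : (z + h) ^+ k.+1 - z ^+ k.+1 - h * (z ^+ k.+1.-1 *+ k.+1)
   = (z + h) * D + (z ^+ k.-1 *+ k) * h ^+ 2.
  rewrite /D; case: k {IH D} => [|k] /=; first by rewrite !expr1 expr0; ring.
  rewrite -[z ^+ k *+ _]mulr_natr -[_ *+ k.+2]mulr_natr -[k.+2%:R]natr1.
  by rewrite !(exprS _ k) !(exprS _ k.+1) !(exprS _ k); ring.
apply: le_trans (ler_wpM2r _ (nmD _ _)) _; first exact: exprn_ge0.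
rewrite mulrDl (nmM (z + h)) (nmM _ (h ^+ 2)) nmX.
have h1 : nm (z + h) * nm D * r ^+ 2 <= r * ((k ^ 2)%:R * r ^+ k * nm h ^+ 2).
  rewrite -mulrA; apply: ler_pM => //; rewrite ?nm_ge0 ?mulr_ge0 ?nm_ge0 ?exprn_ge0 //.
have h2 : nm (z ^+ k.-1 *+ k) * r <= k%:R * r ^+ k.
  case: k {IH D h1} => [|k]; first by rewrite mulr0n nm0 !mul0r.
  rewrite succnK.
  rewrite -[_ *+ _]mulr_natl nmM nm_nat nmX exprSr mulrA ler_wpM2r //.
  by rewrite ler_wpM2l // lerXn2r ?nnegrE ?nm_ge0.
apply: (@le_trans _ _ (r * ((k ^ 2)%:R * r ^+ k * nm h ^+ 2) +
   k%:R * r ^+ k * r * nm h ^+ 2)).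
  apply: lerD => //.
  have -> : nm (z ^+ k.-1 *+ k) * nm h ^+ 2 * r ^+ 2 =
    (nm (z ^+ k.-1 *+ k) * r) * r * nm h ^+ 2 by ring.
  by rewrite ler_wpM2r ?exprn_ge0 ?nm_ge0 // ler_wpM2r.
have -> : r * ((k ^ 2)%:R * r ^+ k * nm h ^+ 2) + k%:R * r ^+ k * r * nm h ^+ 2 =
  (k ^ 2 + k)%:R * r ^+ k.+1 * nm h ^+ 2 by rewrite natrD (exprS r k); ring.
rewrite ler_wpM2r ?exprn_ge0 ?nm_ge0 // ler_wpM2r ?exprn_ge0 //.
by rewrite ler_nat -!mulnn; nia.
Qed.

(** Summing the second order remainders of the powers gives [|f (z + h) - f z - h l| <= A |h| ^ 2],
    with [l] the differentiated series; this yields the limit of the difference quotient. *)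
Lemma has_pseries_derive1 f a c : has_pseries f a c ->
  has_pseries (derive1 f) a (fun k => c k.+1 *+ k.+1).
Proof.
move=> /pseries_coef_bound[B [r [r0 B0 hB hf]]].
(* The radius [r / 4] leaves a factor [4^-1 ^+ k], which absorbs the [k ^ 2] of the remainders and
   still decays like [2^-1 ^+ k]. *)
have [s sE] : exists s : R, s = r / 4 by exists (r / 4).
have s0 : 0 < s by rewrite sE divr_gt0.
have s_neq0 : s != 0 by rewrite gt_eqF.
have cs k : nm (c k) * s ^+ k <= B * 4^-1 ^+ k.
  by rewrite sE exprMn mulrA ler_wpM2r ?exprn_ge0 ?invr_ge0.
have cks k : nm (c k) * ((k ^ 2)%:R * s ^+ k) <= 2 * B * 2^-1 ^+ k.
  apply: (@le_trans _ _ ((k ^ 2)%:R * (B * 4^-1 ^+ k))).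
    by rewrite mulrCA ler_wpM2l.
  apply: (@le_trans _ _ ((2 * 2 ^ k)%:R * (B * 4^-1 ^+ k))).
    by rewrite ler_wpM2r ?ler_nat ?sqrn_le_exp // mulr_ge0 ?exprn_ge0 ?invr_ge0.
  rewrite natrM natrX -!mulrA ler_wpM2l // mulrCA ler_wpM2l // -exprMn.
  by rewrite (_ : 2 / 4 = 2^-1 :> R) //; field.
exists s => // z zs; set v := z - a in zs *.
have [k|l hl] := @cvg_series_dominated (fun k => c k.+1 *+ k.+1 * v ^+ k) (2 * B / s).
  rewrite nmM nmX -[c _ *+ _]mulr_natr nmM.
  rewrite nm_nat -(ler_pM2r s0) (_ : 2 * B / s * _ * s = 2 * B * 2^-1 ^+ k); last first.
    by field.
  apply: (@le_trans _ _ (nm (c k.+1) * ((k.+1 ^ 2)%:R * s ^+ k.+1))).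
    rewrite -!mulrA ler_wpM2l ?nm_ge0 // exprSr !mulrA.
    have kk : k.+1%:R <= (k.+1 ^ 2)%:R :> R by rewrite ler_nat -mulnn; nia.
    rewrite (ler_wpM2r (ltW s0)) //.
    apply: ler_pM; rewrite ?exprn_ge0 ?nm_ge0 //.
    by rewrite lerXn2r ?nnegrE ?nm_ge0 ?(ltW s0) ?(ltW zs).
  apply: le_trans (cks _) _; rewrite exprS.
  by rewrite ler_wpM2l ?mulr_ge0 // ler_piMl ?exprn_ge0 ?invr_ge0 // invf_le1 // ler1n.
suff -> : (derive1 f) z = l by exact: hl.
have sr : s < r by rewrite sE; lra.
have zr : nm v < r by exact: lt_trans zs sr.
pose A := 2 * B * 2 / s ^+ 2.
have A0 : 0 <= A by rewrite !mulr_ge0 ?invr_ge0 ?exprn_ge0 // ltW.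
have rem (h : C) : nm (v + h) < s -> nm (f (h + z) - f z - h * l) <= A * nm h ^+ 2.
  move=> vhs.
  have zha : h + z - a = v + h by rewrite /v; ring.
  have := hf (h + z); rewrite zha => /(_ (lt_trans vhs sr)) h1'.
  have h1 : [sequence [series c k * (v + h) ^+ k]_k n.+1]_n @ \oo --> f (h + z).
    by rewrite cvg_shiftS.
  have h2 : [sequence [series c k * v ^+ k]_k n.+1]_n @ \oo --> f z.
    by rewrite cvg_shiftS; exact: hf.
  have hW := cvgB (cvgB h1 h2) (cvgM (cvg_cst h) hl).
  rewrite -[X in nm X]subr0; apply: (nm_limit_le (K := 0) (hW _ _ _ _)) => n _.
  rewrite !fctE subr0 /series /=.
  rewrite !big_mkord !(big_ord_recl n) /= !expr0 !mulr1 mulr_sumr.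
  rewrite opprD addrACA subrr add0r -!sumrB.
  apply: le_trans (nm_sum _ _ _) _.
  apply: (@le_trans _ _ (\sum_(k < n) 2 * B * nm h ^+ 2 / s ^+ 2 * 2^-1 ^+ k)).
    apply: ler_sum => k _; rewrite /bump /= add1n.
    have -> : c k.+1 * (v + h) ^+ k.+1 - c k.+1 * v ^+ k.+1 -
      h * (c k.+1 *+ k.+1 * v ^+ k) =
      c k.+1 * ((v + h) ^+ k.+1 - v ^+ k.+1 - h * (v ^+ k.+1.-1 *+ k.+1)).
      by rewrite /= -[c _ *+ _]mulr_natr -[v ^+ k *+ _]mulr_natr; ring.
    rewrite nmM -(ler_pM2r (exprn_gt0 2 s0)) -(mulrA (nm (c k.+1))).
    apply: (@le_trans _ _ (nm (c k.+1) * ((k.+1 ^ 2)%:R * s ^+ k.+1 * nm h ^+ 2))).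
      by rewrite ler_wpM2l ?nm_ge0 // expr_remainder // ltW.
    rewrite mulrA; apply: le_trans (ler_wpM2r _ (cks _)) _.
      by rewrite exprn_ge0 ?nm_ge0.
    rewrite (_ : _ / _ * _ * _ = 2 * B * 2^-1 ^+ k * nm h ^+ 2); last by field.
    rewrite ler_wpM2r ?exprn_ge0 ?nm_ge0 // ler_wpM2l ?mulr_ge0 // exprS.
    by rewrite ler_piMl ?exprn_ge0 ?invr_ge0 // invf_le1 // ler1n.
  rewrite -big_distrr /= (_ : A * _ = 2 * B * nm h ^+ 2 / s ^+ 2 * 2); last first.
    by rewrite /A; field.
  rewrite ler_wpM2l ?mulr_ge0 ?invr_ge0 ?exprn_ge0 ?nm_ge0 ?(ltW s0) //.
  have := @geometric_tail 2^-1 0 n; rewrite invr_ge0 ler0n lexx expr0 mulr1 big_mkord.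
  by apply.
rewrite /derive1; apply: cvg_lim => //.
move=> P /near_nm [e e0 hP].
rewrite /nbhs /= /within /=; apply/near_nm.
pose d := Num.min (s - nm v) (e / (A + 1)).
have A1 : 0 < A + 1 by rewrite ltr_wpDl.
exists d; first by rewrite lt_min subr_gt0 zs divr_gt0.
move=> h; rewrite subr0 lt_min => /andP[hs he] h0; apply: hP.
rewrite -[_ *: _]/(_ * _).
have -> : h^-1 * (f (h + z) - f z) - l = h^-1 * (f (h + z) - f z - h * l).
  by field.
rewrite nmM nmV mulrC ltr_pdivrMr ?nm_gt0 //.
have vhs : nm (v + h) < s.
  by apply: le_lt_trans (nmD _ _) _; rewrite -ltrBrDl.
apply: le_lt_trans (rem h vhs) _.
rewrite expr2 mulrA ltr_pM2r ?nm_gt0 //.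
move: he; rewrite ltr_pdivlMr // mulrC mulrDl mul1r.
by have := nm_ge0 h; lra.
Qed.

Lemma has_pseries_derive1n f a c n : has_pseries f a c ->
  has_pseries (derive1n n f) a (fun k => c (k + n)%N *+ ((k + n) ^_ n)).
Proof.
move=> fc; elim: n => [|n IH].
  by rewrite (_ : (fun _ => _) = c) //; apply/funext => k; rewrite addn0 mulr1n.
rewrite derive1nS; have := has_pseries_derive1 IH.
set d := (X in has_pseries _ _ X); set d' := (X in _ -> has_pseries _ _ X).
suff -> : d = d' by []; apply/funext => k.
by rewrite /d /d' -mulrnA addSnnS ffactnSr -{5}addSnnS addnK.
Qed.

(** Orders of contact, defined by iterated derivatives, can thus be read off Taylor coefficients. *)
Lemma derive1n_pseries f a c n : has_pseries f a c ->
  derive1n n f a = c n *+ n`!.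
Proof.
by move=> /(has_pseries_derive1n n)/pseries_at_center ->; rewrite add0n ffactnn.
Qed.

End PowerSeries.

(** * Vanishing of low order coefficients from smallness near 0 *)

Section Jets.
Variable R : realType.
Local Notation C := (cplx R).

(* The comparison only needs points accumulating at 0. *)
Lemma small_jet_eq0 (d : nat -> C) (K : nat) (A : R) :
  (forall e : R, 0 < e -> exists u : C, [/\ 0 < nm u, nm u < e &
     nm (\sum_(k < K) d k * u ^+ k) <= A * nm u ^+ K]) ->
  forall j, (j < K)%N -> d j = 0.
Proof.
move=> freq j; elim/ltn_ind: j => j IH jK; apply/eqP; rewrite -nm_eq0 eq_le nm_ge0 andbT.
rewrite leNgt; apply/negP => dj0.
(* All terms beyond order [j], and the given bound, amount to at most [D * nm u ^+ j.+1]; for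
   [nm u < nm (d j) / (D + 1)] this cannot balance [nm (d j) * nm u ^+ j]. *)
pose D := `|A| + \sum_(k < K) nm (d k).
have D0 : 0 <= D by rewrite addr_ge0 // sumr_ge0 // => k _; exact: nm_ge0.
have D1 : 0 < D + 1 by rewrite ltr_wpDl.
have e0 : 0 < Num.min 1 (nm (d j) / (D + 1)) by rewrite lt_min ltr01 divr_gt0.
have [u [u0 ]] := freq _ e0; rewrite lt_min => /andP[u1 ud].
have -> : \sum_(k < K) d k * u ^+ k = d j * u ^+ j +
    \sum_(k < K | (j < k)%N) d k * u ^+ k.
  rewrite (bigD1 (Ordinal jK)) //=; congr (_ + _).
  rewrite (bigID (fun k : 'I_K => (j < k)%N)) /= [X in _ + X]big1 ?addr0.
    apply: eq_bigl => k; apply/andP/idP => [[]//|jk]; split=> //.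
    by apply/eqP => kj; move: jk; rewrite kj ltnn.
  move=> k /andP[kj]; rewrite -leqNgt => jk; rewrite IH ?mul0r //.
  by rewrite ltn_neqAle jk andbT; apply: contra kj => /eqP kj; apply/eqP/val_inj.
move=> h.
have uj k : (j < k)%N -> nm u ^+ k <= nm u ^+ j.+1.
  by move=> jk; apply: ler_wiXn2l; rewrite ?nm_ge0 ?(ltW u1).
have hS : nm (\sum_(k < K | (j < k)%N) d k * u ^+ k) <=
    (\sum_(k < K) nm (d k)) * nm u ^+ j.+1.
  apply: le_trans (nm_sum _ _ _) _; rewrite mulr_suml big_mkcond /=.
  apply: ler_sum => k _; case: ifP => jk.
    by rewrite nmM nmX ler_wpM2l ?nm_ge0 ?uj.
  by rewrite mulr_ge0 ?nm_ge0 ?exprn_ge0 ?nm_ge0.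
have hA : A * nm u ^+ K <= `|A| * nm u ^+ j.+1.
  apply: (@le_trans _ _ (`|A| * nm u ^+ K)).
    by rewrite ler_wpM2r ?exprn_ge0 ?nm_ge0 ?ler_norm.
  by rewrite ler_wpM2l ?uj.
have : nm (d j) * nm u ^+ j <= D * nm u ^+ j.+1.
  rewrite -nmX -nmM /D mulrDl.
  set S := \sum_(_ < _ | _) _ in h hS.
  have -> : d j * u ^+ j = (d j * u ^+ j + S) - S by ring.
  apply: le_trans (nmD _ _) _; rewrite nmN.
  by apply: lerD => //; apply: le_trans h hA.
rewrite exprSr mulrA mulrAC ler_pM2r ?exprn_gt0 //.
move: ud; rewrite ltr_pdivlMr // => h1 h2.
by have := nm_ge0 u; nra.
Qed.

Lemma pseries_small_coef (f : C -> C) a c (K : nat) (A : R) :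
  has_pseries f a c ->
  (forall e : R, 0 < e -> exists z : C, [/\ 0 < nm (z - a), nm (z - a) < e &
     nm (f z) <= A * nm (z - a) ^+ K]) ->
  forall j, (j < K)%N -> c j = 0.
Proof.
move=> /(taylor_expansion K)[B [r [r0 B0 hB]]] freq.
apply: (@small_jet_eq0 c K (A + B)) => e e0.
have er0 : 0 < Num.min e r by rewrite lt_min e0.
have [z [z0 ]] := freq _ er0; rewrite lt_min => /andP[ze zr] h.
exists (z - a); split => //.
rewrite mulrDl; have := hB z zr; set S := \sum_(_ < _) _ => hS.
have -> : S = f z - (f z - S) by ring.
by apply: le_trans (nmD _ _) _; rewrite nmN lerD.
Qed.

End Jets.

(** * Shape of a Puiseux branch with values in the upper half-plane *)

Section PuiseuxBranch.
Variable R : realType.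
Local Notation C := (cplx R).

(** Were [k %% N] positive, the [N] distinct numbers [r j] would be roots of unity of an order below
    [N], too many of them. *)
Lemma unity_root_dvdn (N k : nat) (r : 'I_N -> C) : (0 < N)%N ->
  (forall j, r j ^+ N = 1) -> injective r ->
  (forall w : C, w ^+ N = 1 -> w ^+ k = 1) -> (N %| k)%N.
Proof.
move=> N0 rN rI h.
rewrite /dvdn; apply/eqP; case: (posnP (k %% N)) => // d0.
have rs : all (k %% N).-unity_root (map r (enum 'I_N)).
  apply/allP => _ /mapP[j _ ->]; apply/unity_rootP.
  have := h _ (rN j); rewrite {1}(divn_eq k N) exprD mulnC exprM rN expr1n mul1r.
  by [].
have := max_unity_roots d0 rs; rewrite map_inj_uniq ?enum_uniq // => /(_ isT).
by rewrite size_map size_enum_ord leqNgt ltn_mod N0.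
Qed.

Lemma im0X (z : C) k : im z = 0 -> im (z ^+ k) = 0.
Proof. by move=> /im0_rc ->; rewrite -(rmorphXn (@rc R)). Qed.

Lemma im0M (z w : C) : im z = 0 -> im w = 0 -> im (z * w) = 0.
Proof. by rewrite imM => -> ->; rewrite !mulr0 mul0r addr0. Qed.

Lemma real_unimodular (z : C) : im z = 0 -> nm z = 1 -> z ^+ 2 = 1.
Proof.
move=> /im0_rc -> ; rewrite nm_rc -(rmorphXn (@rc R)) => h.
by rewrite -real_normK ?num_real // h expr1n rmorph1.
Qed.

Lemma unity_nm (z : C) N : (0 < N)%N -> nm (z ^+ N) = 1 -> nm z = 1.
Proof.
move=> N0; rewrite nmX => h; apply/eqP.
by rewrite -(@pexpr_eq1 _ _ N) ?nm_ge0 // h.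
Qed.

(* Averaging over the N-th roots of unity: a power [t ^+ k] with [N] not
   dividing [k] cannot keep [im (a * t ^+ k)] of constant sign. *)
Lemma signed_power_dvdn (N k : nat) (r : 'I_N -> C) (a : C) :
  (0 < N)%N -> (forall j, r j ^+ N = 1) -> injective r -> a != 0 ->
  (forall t : C, im (t ^+ N) = 0 -> 0 <= im (a * t ^+ k)) -> (N %| k)%N.
Proof.
move=> N0 rN rI a0 h; apply: (unity_root_dvdn N0 rN rI) => w wN.
apply/eqP/negP => /negP wk.
have im0 (t : C) : im (t ^+ N) = 0 -> im (a * t ^+ k) = 0.
  move=> tN; apply/eqP; rewrite eq_le h // andbT.
  (* The sum is geometric with ratio [w ^+ k != 1], hence 0. Its terms have nonnegative imaginary
     parts, so the one at [i = 0] is real. *)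
  have : \sum_(i < N) im (a * (t * w ^+ i) ^+ k) = 0.
    rewrite -im_sum (eq_bigr (fun i : 'I_N => (a * t ^+ k) * (w ^+ k) ^+ i)); last first.
      by move=> i _; rewrite exprMn -!exprM mulnC mulrA.
    rewrite -mulr_sumr.
    have /eqP : (w ^+ k - 1) * (\sum_(i < N) (w ^+ k) ^+ i) = 0.
      by rewrite -subrX1 -exprM mulnC exprM wN expr1n subrr.
    rewrite mulf_eq0 subr_eq0 (negbTE wk) /= => /eqP ->.
    by rewrite mulr0.
  rewrite (bigD1 (Ordinal N0)) //= expr0 mulr1 => /eqP; rewrite addr_eq0 => /eqP ->.
  rewrite oppr_le0 sumr_ge0 // => i _; apply: h.
  by rewrite exprMn -exprM mulnC exprM wN expr1n mulr1.
have ia : im a = 0 by have := im0 1; rewrite !expr1n mulr1; apply.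
(* [eta ^+ N] is [1] or [-1], hence real, so [a * eta ^+ k] is real, and [eta ^+ k] too since [a]
   is. A real number of modulus 1 has square 1, against [w ^+ k != 1]. *)
pose eta := sqrtC w.
have eta2 : eta ^+ 2 = w by exact: sqrtCK.
have etaN2 : (eta ^+ N) ^+ 2 = 1 by rewrite -exprM mulnC exprM eta2.
have etaN : im (eta ^+ N) = 0.
  by move/eqP: etaN2; rewrite sqrf_eq1 => /orP[]/eqP ->; rewrite ?imN /= ?oppr0.
have := im0 _ etaN.
rewrite imM ia mul0r addr0 => /eqP; rewrite mulf_eq0 => /orP[/eqP ra|/eqP ek].
  by move: a0; rewrite (im0_rc ia) ra rmorph0 eqxx.
have ne : nm (eta ^+ k) = 1.
  rewrite nmX (@unity_nm eta (2 * N)) ?expr1n ?muln_gt0 //.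
  by rewrite exprM eta2 wN nm1.
by move: wk; rewrite -eta2 -exprM mulnC exprM (real_unimodular ek ne) eqxx.
Qed.

Lemma sum_multiples (N K : nat) (b : nat -> C) : (0 < N)%N ->
  (forall j, (j < N * K)%N -> ~~ (N %| j)%N -> b j = 0) ->
  \sum_(j < N * K) b j = \sum_(i < K) b (N * i)%N.
Proof.
move=> N0; elim: K => [|K IH] hb; first by rewrite muln0 !big_ord0.
rewrite big_ord_recr /= -IH; last first.
  by move=> j jK; apply: hb; rewrite mulnS (leq_trans jK) ?leq_addl.
rewrite -!(big_mkord xpredT) mulnS addnC (big_cat_nat (n := (N * K)%N)) //=; last first.
  by rewrite leq_addr.
congr (_ + _); rewrite big_ltn; last by rewrite -[ltnLHS]addn0 ltn_add2l.
rewrite big_nat big1 ?addr0 // => j /andP[j1 j2]; apply: hb.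
  by rewrite mulnS addnC.
apply/negP => /dvdnP[q qE]; move: j1 j2; rewrite qE (mulnC q N) (addnC _ N) -mulnS.
by rewrite ltn_pmul2l // ltn_pmul2l // ltnS => h1; rewrite leqNgt h1.
Qed.

(** As long as the nonzero coefficients are real and sit at multiples of [N], the series is a real
    polynomial in [x = t ^+ N]. The first coefficient breaking this rule, at index [k], governs
    [im (Psi t)]. Positivity for all [N]-th roots of all small real [x != 0] forces [N %| k] and
    [0 < im (a k)], and negative [x] force [K = k / N] to be even. *)
Lemma puiseux_branch (N : nat) (r : 'I_N -> C) (Psi : C -> C) (a : nat -> C) (d : R) :
  (0 < N)%N -> (forall j, r j ^+ N = 1) -> injective r ->
  has_pseries Psi 0 a -> 0 < d ->
  (forall t : C, 0 < nm t -> nm t < d -> im (t ^+ N) = 0 -> 0 < im (Psi t)) ->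
  exists (K : nat) (g : nat -> R) (A c d' : R),
    [/\ ~~ odd K, 0 <= A, 0 < c, 0 < d' &
     forall (x : R) (t : C), `|x| < d' -> t ^+ N = rc x ->
       nm (Psi t - rc (\sum_(i < K) g i * x ^+ i)) <= A * `|x| ^+ K /\
       c * `|x| ^+ K <= im (Psi t)].
Proof.
move=> N0 rN rI ha d0 hpos.
pose good j := a j = 0 \/ (N %| j)%N /\ im (a j) = 0.
have good_im j (t : C) : good j -> im (t ^+ N) = 0 -> im (a j * t ^+ j) = 0.
  move=> [->|[/dvdnP[q ->] iaj]] tN; first by rewrite mul0r.
  by apply: im0M => //; rewrite mulnC exprM; apply: im0X.
have [k /asboolP kbad kmin] : exists2 k, `[< ~ good k >] &
    forall j, (j < k)%N -> good j.
  have [allgood|] := pselect (forall j, good j); last first.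
    move=> /existsNP[k0 k0bad].
    have ex : exists k, `[< ~ good k >] by exists k0; apply/asboolP.
    exists (ex_minn ex); case: ex_minnP => // k _ kmin j jk.
    by apply: contrapT => jbad; move: (kmin j); rewrite leqNgt jk;
      move=> /(_ (asboolT jbad)).
  (* If no coefficient broke the rule, [Psi] would be real at a small positive [t], against
     [hpos]. *)
  exfalso; have [s s0 hs] := ha.
  pose t : C := rc (Num.min s d / 2).
  have m0 : 0 < Num.min s d / 2 by rewrite divr_gt0 // lt_min s0.
  have msd : Num.min s d / 2 < Num.min s d.
    by rewrite ltr_pdivrMr // mulr_natr mulr2n ltrDl lt_min s0.
  have nt : nm t = Num.min s d / 2 by rewrite nm_rc gtr0_norm.
  have tN : im (t ^+ N) = 0 by apply: im0X.
  have ts : nm (t - 0) < s.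
    by rewrite subr0 nt (lt_le_trans msd) // ge_min lexx.
  have := hpos t; rewrite nt m0 => /(_ isT); rewrite tN => hp.
  have {}hp : 0 < im (Psi t).
    by apply: hp => //; rewrite (lt_le_trans msd) // ge_min lexx orbT.
  have /cvg_nm/(_ _ hp)[n /(_ n (leqnn n))] := hs t ts.
  apply/negP; rewrite -leNgt; apply: le_trans (im_le _).
  rewrite imD imN /series /= im_sum big1 ?sub0r ?normrN ?ler_norm // => j _.
  by rewrite subr0; apply: good_im.
have ak0 : a k != 0 by apply/eqP => h; apply: kbad; left.
have [A0 [s [s0 A00 hA0]]] := taylor_expansion k.+1 ha.
have low (t : C) : im (t ^+ N) = 0 -> im (\sum_(j < k) a j * t ^+ j) = 0.
  by move=> tN; rewrite im_sum big1 // => j _; apply: good_im => //; exact: kmin.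
have main (t : C) : nm t < s -> im (t ^+ N) = 0 ->
    `|im (Psi t) - im (a k * t ^+ k)| <= A0 * nm t ^+ k.+1.
  move=> ts tN; have := hA0 t; rewrite subr0 => /(_ ts).
  rewrite big_ord_recr /= => h; apply: le_trans h; apply: le_trans (im_le _).
  by rewrite imD imN imD low // add0r.
(* The sign is tested at [e * t] for a small real [e]: the leading term scales as [e ^+ k], the
   remainder as [e ^+ k.+1]. *)
have sgn1 (t : C) : t != 0 -> im (t ^+ N) = 0 -> 0 <= im (a k * t ^+ k).
  rewrite -nm_gt0 => t0 tN; rewrite leNgt; apply/negP => neg.
  pose B := A0 * nm t ^+ k.+1.
  have B0 : 0 <= B by rewrite mulr_ge0 ?exprn_ge0 ?nm_ge0.
  pose e := Num.min (Num.min s d / (nm t * 2)) (- im (a k * t ^+ k) / (B + 1)).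
  have B1 : 0 < B + 1 by rewrite ltr_wpDl.
  have sd0 : 0 < Num.min s d by rewrite lt_min s0.
  have e0 : 0 < e by rewrite lt_min !divr_gt0 ?mulr_gt0 // oppr_gt0.
  have e1 : e * nm t < Num.min s d.
    have : e <= Num.min s d / (nm t * 2) by rewrite ge_min lexx.
    by rewrite ler_pdivlMr ?mulr_gt0 // mulrA; move: sd0; lra.
  have nu : nm (rc e * t) = e * nm t by rewrite nmM nm_rc gtr0_norm.
  have uN : im ((rc e * t) ^+ N) = 0.
    by rewrite exprMn; apply: im0M => //; apply: im0X.
  move: e1; rewrite lt_min => /andP[es ed].
  have h1 : 0 < im (Psi (rc e * t)).
    by apply: hpos => //; rewrite nu // mulr_gt0.
  have := main (rc e * t); rewrite nu => /(_ es uN).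
  rewrite ler_norml => /andP[_].
  have -> : a k * (rc e * t) ^+ k = rc (e ^+ k) * (a k * t ^+ k).
    by rewrite exprMn (rmorphXn (@rc R)); ring.
  rewrite imM re_rc im_rc mul0r addr0 exprMn (exprSr e) => h2.
  have h3 : e ^+ k * (- im (a k * t ^+ k)) <= e ^+ k * (e * B).
    by rewrite /B; move: h1 h2; lra.
  move: h3; rewrite ler_pM2l ?exprn_gt0 // => h3.
  have : e <= - im (a k * t ^+ k) / (B + 1) by rewrite ge_min lexx orbT.
  by rewrite ler_pdivlMr //; move: h3 e0; lra.
have sgn (t : C) : im (t ^+ N) = 0 -> 0 <= im (a k * t ^+ k).
  have [->|t0] := eqVneq t 0; last exact: sgn1.
  case: (posnP k) => [k0 _|k0 _]; last by rewrite expr0n gtn_eqF // mulr0.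
  have := sgn1 1 (oner_neq0 _); rewrite k0 !expr0 expr1n; exact.
have Nk : (N %| k)%N := signed_power_dvdn N0 rN rI ak0 sgn.
have [K kE] : exists K, k = (N * K)%N by case/dvdnP: Nk => K ->; exists K; rewrite mulnC.
have iak : 0 < im (a k).
  rewrite lt_neqAle; apply/andP; split; last first.
    by have := sgn 1; rewrite !expr1n mulr1; apply.
  by apply/eqP => h; apply: kbad; right; rewrite Nk -h.
have Keven : ~~ odd K.
  (* [eta] lies over [x = -1]; for odd [K] it has [eta ^+ k = -1], so the leading term gets a
     negative imaginary part. *)
  apply/negP => oK; pose eta : C := N.-root (-1).
  have etaN : eta ^+ N = -1 by rewrite rootCK.
  have := sgn eta; rewrite kE exprM etaN imN oppr0 => /(_ erefl).
  by rewrite -signr_odd oK expr1 mulrN1 imN oppr_ge0 leNgt -kE iak.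
pose g i := re (a (N * i)%N).
have sumE (x : R) (t : C) : t ^+ N = rc x ->
    \sum_(j < k) a j * t ^+ j = rc (\sum_(i < K) g i * x ^+ i).
  move=> tN; rewrite kE (@sum_multiples N K (fun j => a j * t ^+ j) N0).
    rewrite rmorph_sum; apply: eq_bigr => i _.
    rewrite exprM tN rmorphM rmorphXn; congr (_ * _).
    have /kmin : (N * i < k)%N by rewrite kE ltn_pmul2l.
    by rewrite /g => -[->//|[_ /im0_rc]].
  move=> j; rewrite -kE => /kmin [-> _|[-> //]]; by rewrite mul0r.
pose c := im (a k) / 2.
(* Below [e] the remainder is at most half of [im (a k) * nm t ^+ k], which explains [c]. Since
   [|x| = nm t ^+ N], the radius in [x] is [e ^+ N]. *)
pose e := Num.min (Num.min 1 s) (im (a k) / (2 * (A0 + 1))).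
have A1 : 0 < A0 + 1 by rewrite ltr_wpDl.
have e0 : 0 < e by rewrite !lt_min ltr01 s0 divr_gt0 // mulr_gt0.
exists K, g, (nm (a k) + A0), c, (e ^+ N); split => //.
- by rewrite addr_ge0 ?nm_ge0.
- by rewrite divr_gt0.
- by rewrite exprn_gt0.
move=> x t xe tN.
have xt : `|x| = nm t ^+ N by rewrite -nmX tN nm_rc.
have te : nm t < e.
  by move: xe; rewrite xt ltr_pXn2r ?nnegrE ?nm_ge0 ?(ltW e0).
move: (te); rewrite !lt_min => /andP[/andP[t1 ts] ta].
have xk : `|x| ^+ K = nm t ^+ k by rewrite xt -exprM kE.
have itN : im (t ^+ N) = 0 by rewrite tN.
have akt : a k * t ^+ k = a k * rc (nm t ^+ k).
  congr (_ * _); rewrite -xk [in LHS]kE exprM tN -(rmorphXn (@rc R)) -normrX ger0_norm //.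
  by rewrite -(even_halfK Keven) -muln2 exprM sqr_ge0.
have tk : nm t ^+ k.+1 <= nm t ^+ k by apply: ler_wiXn2l; rewrite ?nm_ge0 ?(ltW t1).
split.
  have := hA0 t; rewrite subr0 => /(_ ts).
  rewrite big_ord_recr /= (sumE x) // => h.
  set G := rc _ in h *.
  have -> : Psi t - G = (Psi t - (G + a k * t ^+ k)) + a k * t ^+ k by ring.
  apply: le_trans (nmD _ _) _; rewrite nmM nmX xk.
  by have := ler_wpM2l A00 tk; move: h; lra.
have := main t ts itN; rewrite akt imM re_rc im_rc mulr0 add0r xk.
rewrite ler_norml exprSr => /andP[h _].
have tk0 : 0 <= nm t ^+ k by rewrite exprn_ge0 ?nm_ge0.
move: ta; rewrite ltr_pdivlMr ?mulr_gt0 // => ta.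
have : nm t ^+ k * (nm t * (2 * (A0 + 1))) <= nm t ^+ k * im (a k).
  by rewrite ler_wpM2l // ltW.
have := mulr_ge0 tk0 (nm_ge0 t).
by rewrite /c; move: h; lra.
Qed.

End PuiseuxBranch.

(** * Finiteness of the second coordinates of common zeros *)

Section CommonZeros.
Variable F : closedFieldType.
Implicit Types (p q g u : {poly {poly F}}) (c : {poly F}) (r : F).

Definition slice p r : {poly F} := map_poly (horner_eval r) p.

Lemma sliceE p r z : (slice p r).[z] = p.[z, r].
Proof.
rewrite /slice -[z in LHS](hornerC z r) -[_.[r] in LHS]/(horner_eval r z%:P).
by rewrite horner_map.
Qed.

(** The point [z = 0] is left out because the reflection formula excludes it; multiplying by ['X]
    fills the gap. *)
Lemma slice0 p r : (forall z, z != 0 -> p.[z, r] = 0) -> slice p r = 0.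
Proof.
move=> h; suff : 'X * slice p r == 0.
  by rewrite mulf_eq0 polyX_eq0 => /eqP.
apply: contraT => /closed_nonrootP[z]; rewrite rootE hornerM hornerX sliceE.
have [->|/h ->] := eqVneq z 0; first by rewrite mul0r eqxx.
by rewrite mulr0 eqxx.
Qed.

Lemma slice_dvd p r : slice p r = 0 -> exists u, p = ('X - r%:P)%:P * u.
Proof.
move=> h; exists (\poly_(i < size p) (p`_i %/ ('X - r%:P))).
apply/polyP => i; rewrite coefCM coef_poly; case: ltnP => [_|/leq_sizeP ->//]; last first.
  by rewrite mulr0.
rewrite mulrC divpK // dvdp_XsubCl rootE.
by move/polyP/(_ i): h; rewrite coef_map coef0 /= /horner_eval => ->.
Qed.

Lemma slice_mul p q r : slice (p * q) r = slice p r * slice q r.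
Proof. exact: rmorphM. Qed.

Lemma slice_const c r : slice c%:P r = (c.[r])%:P.
Proof. by rewrite /slice map_polyC. Qed.

Definition z2_primitive g := forall r, slice g r != 0.

Lemma z2_primitive_part g : g != 0 ->
  exists e g1, [/\ e != 0, g = e%:P * g1 & z2_primitive g1].
Proof.
have [n] := ubnP (size (lead_coef g)); elim: n g => // n IH g.
rewrite ltnS => gn g0; have [hp|] := pselect (z2_primitive g).
  by exists 1, g; rewrite oner_neq0 polyC1 mul1r.
move=> /existsNP[r /negP]; rewrite negbK => /eqP/slice_dvd[u gu].
have u0 : u != 0 by apply: contra g0 => /eqP u0; rewrite gu u0 mulr0.
have Xr0 : 'X - r%:P != 0 by rewrite polyXsubC_eq0.
have su : (size (lead_coef u) < n)%N.
  move: gn; rewrite gu lead_coefM lead_coefC mulrC size_mul ?lead_coef_eq0 //.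
  by rewrite size_XsubC addn2.
have [e [g1 [e0 ug pg]]] := IH u su u0.
exists (('X - r%:P) * e), g1; split => //; first by rewrite mulf_neq0.
by rewrite gu ug polyCM mulrA.
Qed.

(** Gauss's lemma: at a root of [c] the slice of [g] is nonzero, so that of [u] vanishes and the
    root can be cancelled on both sides. *)
Lemma z2_primitive_dvd g c p u : z2_primitive g -> c != 0 ->
  c%:P * p = u * g -> exists v, p = v * g.
Proof.
move=> hg; have [n] := ubnP (size c); elim: n c u => // n IH c u.
rewrite ltnS => cn c0 cpu; have [/closed_rootP[]|sc] := boolP (size c != 1%N); last first.
  move: sc; rewrite negbK => /size_poly1P[k k0 cE]; exists ((k^-1)%:P%:P * u).
  by rewrite -mulrA -cpu cE mulrA -polyCM -polyCM mulVf // !polyC1 mul1r.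
move=> r rc; have Xr0 : 'X - r%:P != 0 by rewrite polyXsubC_eq0.
have /eqP : slice u r * slice g r = 0.
  by rewrite -slice_mul -cpu slice_mul slice_const (rootP rc) mul0r.
rewrite mulf_eq0 (negbTE (hg r)) orbF => /eqP/slice_dvd[u1 uE].
have [c1 cE] := factor_theorem c r rc.
have c10 : c1 != 0 by apply: contra c0 => /eqP h; rewrite cE h mul0r.
apply: (IH c1 u1) => //.
  by move: cn; rewrite cE size_mul // size_XsubC addn2.
apply: (@mulfI _ ('X - r%:P)%:P); first by rewrite polyC_eq0.
by rewrite mulrA -polyCM mulrC [('X - _) * _]mulrC -cE mulrC cpu uE mulrA.
Qed.

Lemma unit_size_poly (D : idomainType) (q : {poly D}) :
  q \is a GRing.unit -> size q = 1%N.
Proof. by rewrite poly_unitE => /andP[/eqP]. Qed.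

(** The resultant in [z_1] lies in the ideal of [p] and [q], so it vanishes at the second coordinate
    of a common zero. If it were 0, the primitive part of the gcd would be a common factor of
    positive degree in [z_1]. Polynomials free of [z_1] are treated apart. *)
Lemma common_zeros_finite p q : p != 0 ->
  (forall d u v, p = d * u -> q = d * v -> d \is a GRing.unit) ->
  exists2 c : {poly F}, c != 0 &
    forall z r, p.[z, r] = 0 -> q.[z, r] = 0 -> c.[r] = 0.
Proof.
move=> p0 ncf; have [sp|sp] := leqP (size p) 1.
  have pE := size1_polyC sp; exists p`_0.
    by apply: contra p0 => /eqP h; rewrite pE h.
  by move=> z r; rewrite {1}pE hornerC.
have [sq|sq] := leqP (size q) 1.
  have qE := size1_polyC sq; exists q`_0; last first.
    by move=> z r _; rewrite {1}qE hornerC.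
  apply/negP => /eqP h; have q0 : q = 0 by rewrite qE h.
  have /unit_size_poly p1 : p \is a GRing.unit.
    by apply: (ncf p 1 0); rewrite ?mulr1 ?mulr0.
  by rewrite p1 in sp.
have [[u v] /= _ uvE] := resultant_in_ideal sp sq.
have [res0|res0] := eqVneq (resultant p q) 0; last first.
  exists (resultant p q) => // z r pz qz.
  have /(congr1 (fun f : {poly {poly F}} => f.[z, r])) := uvE.
  by rewrite hornerC !(hornerD, hornerM) pz qz !mulr0 addr0.
have sg : (1 < size (gcdp p q))%N by rewrite -resultant_eq0 res0.
have g0 : gcdp p q != 0 by rewrite -size_poly_gt0 ltnW.
have [e [g [e0 gE hg]]] := z2_primitive_part g0.
have dvd (f : {poly {poly F}}) : gcdp p q %| f -> exists v, f = v * g.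
  move=> /Pdiv.Idomain.dvdpP[[c w] /= c0 cf].
  apply: (@z2_primitive_dvd g c f (w * e%:P)) => //.
  by rewrite mul_polyC cf gE mulrA.
have [v1 pE] := dvd p (dvdp_gcdl p q).
have [v2 qE] := dvd q (dvdp_gcdr p q).
have /unit_size_poly g1 : g \is a GRing.unit by apply: (ncf g v1 v2); rewrite mulrC.
by move: sg; rewrite gE mul_polyC size_scale // g1.
Qed.

End CommonZeros.

(** * Roots of the half-plane polynomial lie in the upper half-plane *)

Section Nonvanishing.
Variable R : realType.
Local Notation C := (cplx R).

Lemma poly_bounded (q : {poly C}) (M : R) :
  exists2 B : R, 0 <= B & forall s, nm s <= M -> nm q.[s] <= B.
Proof.
exists (\sum_(i < size q) nm q`_i * `|M| ^+ i).
  by apply: sumr_ge0 => i _; rewrite mulr_ge0 ?nm_ge0 ?exprn_ge0.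
move=> s sM; rewrite horner_coef; apply: le_trans (nm_sum _ _ _) _.
apply: ler_sum => i _; rewrite nmM nmX ler_wpM2l ?nm_ge0 //.
by rewrite lerXn2r ?nnegrE ?nm_ge0 // (le_trans sM) ?ler_norm.
Qed.

Lemma poly_lipschitz (q : {poly C}) (a : C) : exists2 L : R, 0 <= L &
  forall s, nm (s - a) <= 1 -> nm (q.[s] - q.[a]) <= L * nm (s - a).
Proof.
have : root (q - q.[a]%:P) a by rewrite rootE !hornerE subrr.
move=> /factor_theorem[h hE].
have [L L0 hL] := poly_bounded h (nm a + 1).
exists L => // s sa.
have -> : q.[s] - q.[a] = h.[s] * (s - a).
  by have := congr1 (horner^~ s) hE; rewrite !hornerE.
rewrite nmM ler_wpM2r ?nm_ge0 // hL //.
by have := nmBD s a; move: sa; lra.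
Qed.

(** Each root [w] satisfies [|z - w| <= |a - w| (1 + |z - a| / d)]. The product of these bounds
    plays the part of Hurwitz's theorem. *)
Lemma root_free_growth (f : {poly C}) (a z : C) (d : R) : 0 < d ->
  (forall w, f.[w] = 0 -> d <= nm (w - a)) ->
  nm f.[z] <= nm f.[a] * (1 + nm (z - a) / d) ^+ size f.
Proof.
move=> d0 hf; have [->|f0] := eqVneq f 0; first by rewrite !horner0 nm0 mul0r.
have [r fE] := closed_field_poly_normal f.
have lf : lead_coef f != 0 by rewrite lead_coef_eq0.
have sr : (size r <= size f)%N.
  by rewrite fE size_scale // size_prod_XsubC leqnSn.
have b1 : 1 <= 1 + nm (z - a) / d by rewrite lerDl divr_ge0 ?nm_ge0 ?(ltW d0).
apply: (@le_trans _ _ (nm f.[a] * (1 + nm (z - a) / d) ^+ size r)); last first.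
  by rewrite ler_wpM2l ?nm_ge0 // ler_weXn2l.
have hr w : w \in r -> d <= nm (w - a).
  move=> wr; apply: hf; apply/eqP; rewrite fE hornerZ mulf_eq0.
  by rewrite -[_.[w] == 0]/(root _ _) root_prod_XsubC wr orbT.
rewrite fE !hornerZ !nmM -mulrA ler_wpM2l ?nm_ge0 // !horner_prod !nm_prod.
elim: r hr {fE sr} => [|w r IH] hr; first by rewrite !big_nil expr0 mulr1.
rewrite !big_cons /= exprS mulrACA !hornerXsubC.
apply: ler_pM; rewrite ?nm_ge0 //.
- by rewrite -nm_prod nm_ge0.
- have dw := hr w (mem_head _ _).
  have -> : z - w = (a - w) + (z - a) by ring.
  apply: le_trans (nmD _ _) _; rewrite mulrDr mulr1 lerD2l mulrA.
  rewrite ler_pdivlMr // mulrC ler_wpM2r ?nm_ge0 //.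
  by rewrite nmB.
- by apply: IH => v vr; apply: hr; rewrite inE vr orbT.
Qed.

(** At [s = (1 - t) zeta] the slice has no root in the disk, so its value at any [z] is at most a
    multiple, independent of [t], of its value at [a]. The latter tends to [p.[a, zeta] = 0] with
    [t]. *)
Lemma hurwitz_zero (p : {poly {poly C}}) (a zeta : C) : nm a < 1 -> nm zeta = 1 ->
  (forall z1 z2, nm z1 < 1 -> nm z2 < 1 -> p.[z1, z2] != 0) ->
  p.[a, zeta] = 0 -> slice p zeta = 0.
Proof.
move=> a1 z1 hp pa; apply: slice0 => z _; apply/eqP; rewrite -nm_eq0 eq_le nm_ge0 andbT.
pose d := 1 - nm a; have d0 : 0 < d by rewrite subr_gt0.
pose M := (1 + nm (z - a) / d) ^+ size p.
have b1 : 1 <= 1 + nm (z - a) / d by rewrite lerDl divr_ge0 ?nm_ge0 ?(ltW d0).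
have M0 : 0 <= M by rewrite exprn_ge0 // (le_trans _ b1).
have [L1 L10 h1] := poly_lipschitz p.[z%:P] zeta.
have [L2 L20 h2] := poly_lipschitz p.[a%:P] zeta.
apply/ler_addgt0Pr => e e0; rewrite add0r.
pose T := L1 + L2 * M + 1.
have T0 : 0 < T by rewrite ltr_wpDl // addr_ge0 ?mulr_ge0.
pose t := Num.min (2^-1) (e / T).
have t0 : 0 < t by rewrite lt_min invr_gt0 ltr0n divr_gt0.
have t1 : t <= 2^-1 by rewrite ge_min lexx.
have te : t * T <= e by rewrite -ler_pdivlMr // ge_min lexx orbT.
pose s := rc (1 - t) * zeta.
have ns : nm s < 1 by rewrite nmM z1 mulr1 nm_rc ger0_norm; lra.
have sz : nm (s - zeta) = t.
  have -> : s - zeta = - (rc t * zeta) by rewrite /s rmorphB rmorph1; ring.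
  by rewrite nmN nmM z1 mulr1 nm_rc gtr0_norm.
have := h1 s; rewrite sz => /(_ ltac:(lra)) {}h1.
have := h2 s; rewrite sz pa subr0 => /(_ ltac:(lra)) {}h2.
have gr : nm p.[z, s] <= nm p.[a, s] * M.
  have := @root_free_growth (slice p s) a z d d0.
  rewrite !sliceE => /(_ _)/le_trans; apply.
    move=> w /eqP; rewrite sliceE => w0; rewrite leNgt; apply/negP => wd.
    move: w0; apply/negP/hp => //.
    by have := nmBD w a; move: wd; rewrite /d; lra.
  rewrite ler_wpM2l ?nm_ge0 // ler_weXn2l //.
  by rewrite /slice (leq_trans (size_poly _ _)).
have h3 : nm p.[a, s] * M <= L2 * t * M by rewrite ler_wpM2r.
have -> : p.[z, zeta] = p.[z, s] - (p.[z, s] - p.[z, zeta]) by ring.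
apply: le_trans (nmD _ _) _; rewrite nmN.
apply: le_trans te; rewrite /T; move: h1 gr h3 t0; lra.
Qed.

Variables (m n : nat) (p : {poly {poly C}}).
Hypothesis pdeg : has_bidegree m n p.
Hypothesis ncf : no_common_factor p (reflection m n p).
Hypothesis pD : forall z, bidisk z -> eval2 p z != 0.

Lemma bidegree_neq0 : p != 0.
Proof. by case: pdeg => sp _; rewrite -size_poly_gt0 sp. Qed.

(** A zero would spread to its whole line with fixed second coordinate, for [p] and by reflection
    for the reflected polynomial; the equation of the line would be a common factor. *)
Lemma nonzero_disk_circle (z1 z2 : C) : nm z1 < 1 -> nm z2 = 1 -> p.[z1, z2] != 0.
Proof.
move=> h1 h2; apply/negP => /eqP pz.
have sp : slice p z2 = 0.
  apply: (hurwitz_zero h1 h2 _ pz) => w1 w2 nw1 nw2.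
  have := pD (z := (w1, w2)); rewrite /eval2 /=; apply.
  by split; rewrite normE -(rmorph1 (@rc R)) lt_rc.
have z20 : z2 != 0 by rewrite -nm_gt0 h2.
have sq : slice (reflection m n p) z2 = 0.
  apply: slice0 => z z0; have := reflectionE pdeg z0 z20; rewrite /eval2 /= => ->.
  by rewrite (nm_eq1J h2) !div1r invrK -(sliceE p z2) sp horner0 conjC0 mulr0.
have [u uE] := slice_dvd sp; have [v vE] := slice_dvd sq.
have := ncf uE vE; rewrite poly_unitE coefC /= => /andP[_ h].
by have := unit_size_poly h; rewrite size_XsubC.
Qed.

(* [halfplane_poly x] is [upper_half_plane_form m n pt (_, x)] as a polynomial;
   it also gives the right value at the pole [-i] of [beta]. *)
Definition halfplane_poly (x : R) : {poly C} :=
  (1 - 'i * rc x) ^+ n *: \sum_(i < m.+1)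
    ((reflection m n p)`_i).[beta (rc x)] *:
      ((1 + 'i *: 'X) ^+ i * (1 - 'i *: 'X) ^+ (m - i)).

Lemma halfplane_polyE (x : R) (w : C) : 1 - 'i * w != 0 ->
  (halfplane_poly x).[w] = upper_half_plane_form m n (reflection m n p) (w, rc x).
Proof.
move=> w0; rewrite /halfplane_poly /upper_half_plane_form /eval2 /= hornerZ.
rewrite [_ ^+ m * _]mulrC -mulrA; congr (_ * _).
rewrite horner_sum.
have sz : (size (reflection m n p) <= m.+1)%N by exact: size_poly.
rewrite (horner_coef_wide _ sz) -horner_evalE rmorph_sum mulr_sumr /=.
apply: eq_bigr => i _; have im : (i <= m)%N by rewrite -ltnS.
rewrite !(hornerZ, hornerM, horner_exp, hornerD, hornerN, hornerX, hornerC).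
rewrite /horner_eval hornerM horner_exp hornerC [RHS]mulrCA; congr (_ * _).
rewrite /beta expr_div_n.
have -> : (1 - 'i * w) ^+ m = (1 - 'i * w) ^+ (m - i) * (1 - 'i * w) ^+ i.
  by rewrite -exprD subnK.
by rewrite [RHS]mulrACA divff ?expf_neq0 // mulr1 mulrC.
Qed.

Lemma beta_real_neq0 (x : R) : 1 - 'i * rc x != 0.
Proof.
rewrite -nm_gt0 -(@ltr_pXn2r _ 2%N) ?nnegrE ?nm_ge0 // expr0n /= nm_sqr.
rewrite !(reD, imD, reN, imN, reM, imM, re_i, im_i, re_rc, im_rc, re1, im1).
by have := sqr_ge0 x; nra.
Qed.

Lemma nm_beta_diff (w : C) : nm (1 - 'i * w) ^+ 2 - nm (1 + 'i * w) ^+ 2 = 4 * im w.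
Proof.
rewrite !nm_sqr !(reD, imD, reN, imN, reM, imM, re_i, im_i, re1, im1).
by ring.
Qed.

Lemma nm_beta_lt1 (w : C) : 1 - 'i * w != 0 -> (nm (beta w) < 1) = (0 < im w).
Proof.
move=> w0; rewrite /beta nmM nmV ltr_pdivrMr ?nm_gt0 // mul1r.
rewrite -(@ltr_pXn2r _ 2%N) ?nnegrE ?nm_ge0 //.
have := nm_beta_diff w; set u := _ ^+ 2; set v := _ ^+ 2 => h.
by apply/idP/idP; lra.
Qed.

Lemma nm_beta_real (x : R) : nm (beta (rc x)) = 1.
Proof.
have := nm_beta_diff (rc x); rewrite im_rc mulr0 => /eqP; rewrite subr_eq0 eqrXn2 ?nm_ge0 //.
move=> /eqP h; rewrite /beta nmM nmV -h divff // gt_eqF // nm_gt0.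
exact: beta_real_neq0.
Qed.

Lemma beta_neq0_real (x : R) : beta (rc x) != 0.
Proof. by rewrite -nm_gt0 nm_beta_real. Qed.

(** Three cases oppose the claim. At the pole [w = -i], a root would kill the leading coefficient of
    the reflection, whose conjugate is [p (0, zeta) != 0] up to a unimodular factor. If
    [|beta w| > 1], reflecting gives a zero of [p] on disk times circle. If [|beta w| = 1], it gives
    a common zero on the torus, excluded by [c]. *)
Lemma halfplane_poly_roots (x : R) (w : C) (c : {poly C}) :
  (forall z r, p.[z, r] = 0 -> (reflection m n p).[z, r] = 0 -> c.[r] = 0) ->
  c.[beta (rc x)] != 0 ->
  (halfplane_poly x).[w] = 0 -> 0 < im w.
Proof.
move=> hc cx; have [w0|w0] := eqVneq (1 - 'i * w) 0.
  have iw : 'i * w = 1 by apply/eqP; rewrite eq_sym -subr_eq0 w0.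
  rewrite /halfplane_poly hornerZ => /eqP; rewrite mulf_eq0 expf_eq0.
  rewrite (negbTE (beta_real_neq0 x)) andbF /= horner_sum big_ord_recr /= big1 ?add0r; last first.
    move=> i _; rewrite !(hornerZ, hornerM, horner_exp, hornerD, hornerN, hornerX, hornerC).
    by rewrite w0 expr0n subn_eq0 leqNgt ltn_ord /= !mulr0.
  rewrite !(hornerZ, hornerM, horner_exp, hornerD, hornerN, hornerX, hornerC) subnn expr0 mulr1.
  rewrite iw mulf_eq0 expf_eq0 -mulr2n pnatr_eq0 andbF orbF => h; exfalso.
  have := nonzero_disk_circle (z1 := 0) (z2 := beta (rc x)).
  rewrite nm0 ltr01 nm_beta_real => /(_ isT erefl)/negP; apply.
  have [zeta ze] : exists z, z = beta (rc x) by eexists.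
  rewrite -ze in h *; have z1 : nm zeta = 1 by rewrite ze nm_beta_real.
  have z0 : zeta != 0 by rewrite -nm_gt0 z1.
  rewrite polyC0 horner_coef0.
  suff <- : ((reflection m n p)`_m).[zeta]^* * zeta ^+ n = (p`_0).[zeta].
    by rewrite (eqP h) conjC0 mul0r.
  rewrite /reflection coef_poly ltnSn subnn horner_poly rmorph_sum mulr_suml.
  have sz : (size (p`_0)%R <= n.+1)%N.
    by case: pdeg => _ <-; exact: max_size_coefXY.
  rewrite (horner_coef_wide _ sz) [RHS](reindex_inj rev_ord_inj) /=.
  apply: eq_bigr => j _; have jn : (j <= n)%N by rewrite -ltnS.
  rewrite subSS rmorphM rmorphXn /= conjCK (nm_eq1J z1) -mulrA; congr (_ * _).
  have -> : zeta ^+ n = zeta ^+ (n - j) * zeta ^+ j by rewrite -exprD subnK.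
  by rewrite mulrCA exprVn mulVf ?expf_neq0 // mulr1.
rewrite halfplane_polyE // /upper_half_plane_form /eval2 /= => /eqP.
rewrite !mulf_eq0 !expf_eq0 (negbTE w0) (negbTE (beta_real_neq0 x)) !andbF /= => /eqP qz.
rewrite -nm_beta_lt1 // ltNge; apply/negP => b1.
have b0 : beta w != 0 by rewrite -nm_gt0 (lt_le_trans ltr01).
have := reflectionE pdeg b0 (beta_neq0_real x); rewrite /eval2 /= qz => /esym/eqP.
rewrite !mulf_eq0 !expf_eq0 (negbTE b0) (negbTE (beta_neq0_real x)) !andbF /=.
rewrite conjC_eq0 (nm_eq1J (nm_beta_real x)) div1r invrK => pz.
have [b1'|b1'] := ltP 1 (nm (beta w)).
  have := nonzero_disk_circle (z1 := 1 / (beta w)^* ) (z2 := beta (rc x)).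
  rewrite div1r nmV nmJ invf_lt1 ?(lt_trans ltr01 b1') // => /(_ b1' (nm_beta_real x)).
  by move: pz; rewrite mul1r => ->.
have n1 : nm (beta w) = 1 by apply/eqP; rewrite eq_le b1 b1'.
move: pz; rewrite (nm_eq1J n1) invrK mul1r => /eqP pz.
by move: cx; rewrite (hc _ _ pz qz) eqxx.
Qed.

Lemma halfplane_poly_neq0 (x : R) (c : {poly C}) :
  (forall z r, p.[z, r] = 0 -> (reflection m n p).[z, r] = 0 -> c.[r] = 0) ->
  c.[beta (rc x)] != 0 -> halfplane_poly x != 0.
Proof.
move=> hc cx; apply/eqP => h.
have := halfplane_poly_roots (w := - 'i) hc cx; rewrite h horner0 => /(_ erefl).
by rewrite imN im_i oppr_gt0 ltr10.
Qed.

(** At real points [beta] is unimodular, so the conjugate of the half-plane form of the reflection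
    is the half-plane form of [p]. *)
Lemma halfplane_level (x y : R) (lam : C) :
  (halfplane_poly x).[rc y] = lam * (halfplane_poly x).[rc y]^* ->
  level_set (reflection m n p) p lam (beta (rc y), beta (rc x)).
Proof.
rewrite halfplane_polyE ?beta_real_neq0 // /upper_half_plane_form /level_set /=.
rewrite (reflectionE pdeg) ?beta_neq0_real // !(nm_eq1J (nm_beta_real _)) !div1r !invrK.
rewrite !rmorphM !rmorphXn /= conjCK !(nm_eq1J (nm_beta_real _)).
rewrite !rmorphB !rmorphM !rmorph1 /= conjCi !conj_rc.
have nx := beta_real_neq0 x; have ny := beta_real_neq0 y.
have key (t : R) k : (1 - - 'i * rc t) ^+ k * (beta (rc t))^-1 ^+ k = (1 - 'i * rc t) ^+ k.
  rewrite -exprMn /beta invf_div mulNr opprK mulrC divfK //.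
  by have := beta_neq0_real t; rewrite /beta mulf_eq0 negb_or => /andP[].
rewrite [X in lam * X]mulrA [X in lam * (X * _)]mulrACA !key => h.
apply: (@mulfI _ ((1 - 'i * rc y) ^+ m * (1 - 'i * rc x) ^+ n)).
  by rewrite mulf_neq0 ?expf_neq0.
by rewrite h; ring.
Qed.

End Nonvanishing.

(** * From a bounded quotient to divisibility *)

Section Division.
Variable R : realType.
Local Notation C := (cplx R).

(** Turns a local factorization with a bounded cofactor into exact divisibility, multiplicities
    included; the roots are divided out one at a time. *)
Lemma bounded_quotient_dvd (rs : seq C) (P : {poly C}) (d B : R) :
  (forall w, w \in rs -> nm w < d) ->
  (forall w, nm w < d -> nm P.[w] <= B * nm (\prod_(r <- rs) ('X - r%:P)).[w]) ->
  exists H, P = (\prod_(r <- rs) ('X - r%:P)) * H.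
Proof.
elim: rs P => [|r rs IH] P hrs hP; first by exists P; rewrite big_nil mul1r.
have rd : nm r < d by apply: hrs; rewrite mem_head.
have Pr : root P r.
  rewrite rootE -nm_eq0 eq_le nm_ge0 andbT; apply: le_trans (hP r rd) _.
  by rewrite big_cons hornerM hornerXsubC subrr mul0r nm0 mulr0.
have [Q PQ] := factor_theorem P r Pr.
set D := \prod_(r <- rs) ('X - r%:P).
have hQ w : nm w < d -> w != r -> nm Q.[w] <= B * nm D.[w].
  move=> wd wr; have wr0 : 0 < nm (w - r) by rewrite nm_gt0 subr_eq0.
  have := hP w wd; rewrite PQ big_cons !hornerM !hornerXsubC !nmM mulrCA mulrC.
  by rewrite ler_pM2l.
have [w|H HE] := IH Q (fun w h => hrs w (mem_behead (s := r :: rs) h)).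
  (* At the root just removed the bound follows by continuity, comparing [r] with [r + t] through
     Lipschitz constants. *)
  move=> wd; have [->|] := eqVneq w r; last exact: hQ.
  have [L1 L10 h1] := poly_lipschitz Q r; have [L2 L20 h2] := poly_lipschitz D r.
  apply/ler_addgt0Pr => e e0.
  pose T := L1 + `|B| * L2 + 1.
  have T0 : 0 < T by rewrite ltr_wpDl // addr_ge0 ?mulr_ge0.
  pose t := Num.min (Num.min 1 ((d - nm r) / 2)) (e / T).
  have t0 : 0 < t by rewrite !lt_min ltr01 !divr_gt0 // subr_gt0.
  have t1 : t <= 1 by rewrite !ge_min lexx.
  have t2 : t <= (d - nm r) / 2 by rewrite !ge_min lexx orbT.
  have t3 : t * T <= e by rewrite -ler_pdivlMr // !ge_min lexx orbT.
  have nt : nm (r + rc t - r) = t by rewrite addrC addKr nm_rc gtr0_norm.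
  have := hQ (r + rc t); rewrite -subr_eq0 -nm_gt0 nt => /(_ _ t0) h3.
  have {}h3 : nm Q.[r + rc t] <= B * nm D.[r + rc t].
    by apply: h3; have := nmD r (rc t); rewrite nm_rc gtr0_norm //; move: t2 rd; lra.
  have := h1 (r + rc t); rewrite nt => /(_ t1) {}h1.
  have := h2 (r + rc t); rewrite nt => /(_ t1) {}h2.
  have k1 := nmBD Q.[r] Q.[r + rc t]; rewrite nmB in k1.
  have k2 : `|nm D.[r + rc t] - nm D.[r]| <= L2 * t.
    have k3 := nmBD D.[r] D.[r + rc t]; rewrite nmB in k3.
    have k4 := nmBD D.[r + rc t] D.[r].
    by rewrite ler_norml; apply/andP; split; move: k3 k4 h2; lra.
  have k3 : B * nm D.[r + rc t] <= B * nm D.[r] + `|B| * (L2 * t).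
    rewrite -lerBlDl -mulrBr; apply: le_trans (ler_norm _) _.
    by rewrite normrM ler_wpM2l.
  by move: t3 h1 h3 k1 k3 t0; rewrite /T; lra.
by exists H; rewrite PQ HE big_cons mulrC mulrA.
Qed.

End Division.

(** * The phase on the real line and its passages *)

Section Phase.
Variable R : realType.
Local Notation C := (cplx R).
Implicit Types (s t y : R).

Lemma re_cis s : re (cis s) = cos s. Proof. by []. Qed.
Lemma im_cis s : im (cis s) = sin s. Proof. by []. Qed.

Lemma cisD s t : cis (s + t) = cis s * cis t :> C.
Proof.
by apply: ceq; rewrite ?reM ?imM !(re_cis, im_cis) ?cosD ?sinD //; ring.
Qed.

Lemma nm_cis s : nm (cis s : C) = 1.
Proof.
apply/eqP; rewrite -(@pexpr_eq1 _ _ 2) ?nm_ge0 // nm_sqr re_cis im_cis.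
by rewrite cos2Dsin2.
Qed.

Lemma cis0 : cis 0 = 1 :> C.
Proof. by apply: ceq; rewrite ?re_cis ?im_cis ?cos0 ?sin0. Qed.

Lemma cis2pi k : cis (pi *+ 2 *+ k) = 1 :> C.
Proof.
elim: k => [|k IH]; first by rewrite mulr0n cis0.
rewrite mulrS cisD IH mulr1.
by apply: ceq; rewrite ?re_cis ?im_cis ?cos2pi ?sin2pi.
Qed.

Lemma cis_surj (z : C) : nm z = 1 -> exists s, cis s = z.
Proof.
move=> z1; have z2 : re z ^+ 2 + im z ^+ 2 = 1 by rewrite -nm_sqr z1 expr1n.
have rz : -1 <= re z <= 1.
  by have := re_le z; rewrite z1 ler_norml.
have [iz|iz] := leP 0 (im z).
  exists (acos (re z)); apply: ceq; rewrite ?re_cis ?im_cis ?acosK //.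
  rewrite sin_acos // (_ : 1 - re z ^+ 2 = im z ^+ 2); last by lra.
  by rewrite sqrtr_sqr ger0_norm.
exists (- acos (re z)); apply: ceq; rewrite ?re_cis ?im_cis ?cosN ?sinN ?acosK //.
rewrite sin_acos // (_ : 1 - re z ^+ 2 = im z ^+ 2); last by lra.
by rewrite sqrtr_sqr ltr0_norm // opprK.
Qed.

Lemma pi2_gt0 : 0 < pi *+ 2 :> R.
Proof. by rewrite pmulrn_rgt0 // pi_gt0. Qed.

Lemma cis_surj_window (z : C) (a : R) : nm z = 1 ->
  exists s, [/\ a <= s, s < a + pi *+ 2 & cis s = z].
Proof.
move=> /cis_surj[s0 <-].
pose k := Num.floor ((s0 - a) / (pi *+ 2)).
exists (s0 - (pi *+ 2) *~ k).
have k1 : k%:~R <= (s0 - a) / (pi *+ 2) by exact: floor_le.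
have k2 : (s0 - a) / (pi *+ 2) < k%:~R + 1.
  by have := floorD1_gt ((s0 - a) / (pi *+ 2)); rewrite intrD.
move: k1 k2; rewrite ler_pdivlMr ?pi2_gt0 // ltr_pdivrMr ?pi2_gt0 // => k1 k2.
rewrite -mulrzr; split; [lra|lra|].
have cz (j : int) : cis (pi *+ 2 *~ j) = 1 :> C.
  case: j => j; first exact: cis2pi.
  rewrite NegzE mulrNz; have := cisD (pi *+ 2 *~ j.+1) (- (pi *+ 2 *~ j.+1)).
  by rewrite subrr cis0 [cis (_ *~ _)]cis2pi mul1r.
by rewrite mulrzr -mulrNz cisD cz mulr1.
Qed.

(** For [t = tan a] the right-hand side is [(cos a + i sin a) / (cos a - i sin a)]. *)
Lemma cis_atan t : cis (2 * atan t) = beta (rc t) :> C.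
Proof.
have ca : cos (atan t) != 0.
  by rewrite gt_eqF // cos_gt0_pihalf // atan_gtNpi2 atan_ltpi2.
have ta : t = sin (atan t) / cos (atan t) by rewrite -[LHS]atanK.
move: ca ta (cos2Dsin2 (atan t)); move: (atan t) => a ca -> {t}.
set c := cos a; set s := sin a => cs.
have -> : cis (2 * a) = (rc c + 'i * rc s) ^+ 2 :> C.
  rewrite mulr_natl mulr2n cisD expr2; congr (_ * _);
  by apply: ceq; rewrite !(reD, imD, reM, imM, re_i, im_i, re_rc, im_rc, re_cis, im_cis); rewrite -/c -/s; ring.
have cs' : (rc c + 'i * rc s) * (rc c - 'i * rc s) = 1 :> C.
  have -> : (rc c + 'i * rc s) * (rc c - 'i * rc s) = rc (c ^+ 2 + s ^+ 2) - ('i ^+ 2 + 1) * rc s ^+ 2.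
    by rewrite rmorphD !rmorphXn; ring.
  by rewrite cs sqrCi addNr mul0r subr0 rmorph1.
have c0 : rc c != 0 by rewrite fmorph_eq0.
have d0 : rc c - 'i * rc s != 0.
  by apply/eqP => h; move/eqP: cs'; rewrite h mulr0 eq_sym oner_eq0.
have sc : rc (s / c) = rc s / rc c by rewrite fmorph_div.
rewrite /beta sc.
have -> : 1 + 'i * (rc s / rc c) = (rc c + 'i * rc s) / rc c.
  by field.
have -> : 1 - 'i * (rc s / rc c) = (rc c - 'i * rc s) / rc c.
  by field.
rewrite invf_div mulrA divfK // expr2 -[X in _ = X / _]mulr1 -cs' mulrA.
by rewrite mulfK.
Qed.

(** Up to a constant, a continuous argument of the product of the [(y - r) / (y - r)^*]; a root in
    the upper half-plane contributes an increasing term with values in [(- pi, pi)]. *)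
Definition phase (rs : seq C) (y : R) : R :=
  \sum_(r <- rs) 2 * atan ((y - re r) / im r).

(** With [t = (y - re r) / im r], the quotient [(y - r) / (y - r)^*] is
    [(t - i) / (t + i) = - beta t]. *)
Lemma phase_factor (r : C) y : 0 < im r ->
  rc y - r = - cis (2 * atan ((y - re r) / im r)) * (rc y - r)^*.
Proof.
move=> ir; have ir0 : rc (im r) != 0 by rewrite fmorph_eq0 gt_eqF.
rewrite cis_atan; set t := _ / im r.
have d0 : 1 - 'i * rc t != 0 by exact: beta_real_neq0.
have tE : rc t * rc (im r) = rc y - rc (re r).
  by rewrite -rmorphM /t divfK ?gt_eqF // rmorphB.
have -> : (rc y - r)^* = (rc t + 'i) * rc (im r).
  by rewrite rmorphB /= conj_rc conjE mulrDl tE; ring.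
have -> : rc y - r = (rc t - 'i) * rc (im r).
  by rewrite {1}(cE r) mulrBl tE; ring.
rewrite mulrA; congr (_ * _).
have i2 : 'i * 'i = -1 :> C by rewrite -expr2 sqrCi.
have -> : rc t + 'i = 'i * (1 - 'i * rc t) by rewrite mulrBr mulrA i2; ring.
rewrite mulNr mulrCA /beta divfK // mulrDr mulrA i2; ring.
Qed.

Lemma phaseE (rs : seq C) (c : C) : c != 0 -> (forall r, r \in rs -> 0 < im r) ->
  exists th0 : R, forall y, let v := (c *: \prod_(r <- rs) ('X - r%:P)).[rc y] in
    v = cis (th0 + phase rs y) * v^*.
Proof.
move=> c0 hrs.
have [th0 th0E] : exists th0, cis th0 = (-1) ^+ size rs * c / c^*.
  by apply: cis_surj; rewrite !nmM nmX nmN nm1 expr1n mul1r nmV nmJ divff // nm_eq0.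
exists th0 => y /=; rewrite cisD th0E !hornerZ rmorphM /=.
have c0' : c^* != 0 by rewrite conjC_eq0.
suff hp : (\prod_(r <- rs) ('X - r%:P)).[rc y] =
    (-1) ^+ size rs * cis (phase rs y) * ((\prod_(r <- rs) ('X - r%:P)).[rc y])^*.
  rewrite {1}hp; move: (_.[_]^*) (cis _) ((-1) ^+ _) => z w u.
  transitivity (u * c * w * z * (c^*^-1 * c^*)); last by ring.
  by rewrite mulVf // mulr1; ring.
elim: rs hrs {th0E} => [|r rs IH] hrs.
  by rewrite /phase !big_nil hornerC conjC1 expr0 cis0 !mulr1.
rewrite /phase !big_cons !hornerM !hornerXsubC rmorphM /= cisD -/(phase rs y).
rewrite {1}IH; last by move=> w wr; apply: hrs; rewrite inE wr orbT.
rewrite {1}(phase_factor y (hrs r (mem_head _ _))) exprS; ring.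
Qed.

Lemma phase_continuous rs : continuous (phase rs).
Proof.
move=> y; rewrite /phase; elim: rs => [|r rs IH].
  rewrite (_ : (fun _ => _) = fun=> 0); first exact: cvg_cst.
  by apply/funext => z; rewrite big_nil.
rewrite (_ : (fun _ => _) = (fun y => 2 * atan ((y - re r) / im r) +
   \sum_(r <- rs) 2 * atan ((y - re r) / im r))); last first.
  by apply/funext => z; rewrite big_cons.
apply: cvgD => //; apply: cvgM; first exact: cvg_cst.
apply: (@continuous_comp _ _ _ (fun y => (y - re r) / im r) atan); last exact: continuous_atan.
apply: cvgM; last exact: cvg_cst.
by apply: cvgB; [exact: cvg_id|exact: cvg_cst].
Qed.

Lemma phase_le rs y y' : (forall r, r \in rs -> 0 < im r) -> y <= y' ->
  phase rs y <= phase rs y'.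
Proof.
move=> hrs yy; rewrite /phase !big_seq; apply: ler_sum => r /hrs ir.
by rewrite ler_wpM2l // le_atan // ler_wpM2r ?invr_ge0 ?(ltW ir) // lerB.
Qed.

Lemma phase_cat rs1 rs2 y : phase (rs1 ++ rs2) y = phase rs1 y + phase rs2 y.
Proof. by rewrite /phase big_cat. Qed.

Lemma atan_near_pihalf (e : R) : 0 < e -> exists2 T : R, 0 < T &
  forall t, T <= t -> pi / 2 - e <= atan t.
Proof.
move=> e0; have /cvgrPdist_lt/(_ e e0)[M [_ hM]] := @cvgy_atan R.
exists (`|M| + 1); first by rewrite ltr_wpDl.
move=> t tM; have /hM : M < t by apply: lt_le_trans tM; have := ler_norm M; lra.
by rewrite /= ltr_norml => /andP[_]; lra.
Qed.

(* Zeros within [A * X] of [G] pick up almost their full phase [2 pi] across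
   [G - M X, G + M X] once [M] is large compared to [A]. *)
Lemma phase_increment (A e : R) (k : nat) : 0 <= A -> 0 < e ->
  exists2 M : R, 0 < M & forall (rs : seq C) (G X : R), size rs = k -> 0 < X ->
    (forall r, r \in rs -> [/\ 0 < im r, im r <= A * X & `|re r - G| <= A * X]) ->
    (pi *+ 2) *+ k - e <= phase rs (G + M * X) - phase rs (G - M * X).
Proof.
move=> A0 e0; pose e' := e / (4 * k.+1%:R).
have k0 : 0 < k.+1%:R :> R by rewrite ltr0n.
have e'0 : 0 < e' by rewrite divr_gt0 // mulr_gt0.
have [T T0 hT] := atan_near_pihalf e'0.
(* Both ends are then at distance at least [T A X >= T im r] from each [re r], so every arctangent
   is within [e'] of its limit. A root contributes at least [2 pi - 4 e'], and the [k] losses add up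
   to at most [e]. *)
exists (A * (T + 1) + 1); first by rewrite ltr_wpDl // mulr_ge0 // addr_ge0 // ltW.
set M := _ + 1 => rs G X sk X0 hrs.
have -> : phase rs (G + M * X) - phase rs (G - M * X) =
  \sum_(r <- rs) 2 * (atan ((G + M * X - re r) / im r) - atan ((G - M * X - re r) / im r)).
  by rewrite /phase -sumrB; apply: eq_bigr => r _; rewrite mulrBr.
apply: (@le_trans _ _ (\sum_(r <- rs) (pi *+ 2 - 4 * e'))).
  rewrite big_const_seq count_predT sk iter_addr_0 mulrnBl lerB //.
  rewrite -mulrnAr /e' -[_ *+ k]mulr_natr.
  have k1 : k%:R <= k.+1%:R :> R by rewrite ler_nat.
  rewrite (_ : 4 * (e / (4 * k.+1%:R) * k%:R) = e * (k%:R / k.+1%:R)); last first.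
    by field; rewrite gt_eqF.
  by rewrite ler_piMr ?(ltW e0) // ler_pdivrMr // mul1r.
rewrite big_seq [leRHS]big_seq; apply: ler_sum => r /hrs[ir irA].
rewrite ler_norml => /andP[r1 r2].
have MX : A * X * (T + 1) <= M * X by rewrite /M; have := X0; nra.
have Tir : T * im r <= T * (A * X) by rewrite ler_wpM2l // ltW.
have h1 : pi / 2 - e' <= atan ((G + M * X - re r) / im r).
  by apply: hT; rewrite ler_pdivlMr //; lra.
have h2 : pi / 2 - e' <= atan (- ((G - M * X - re r) / im r)).
  by apply: hT; rewrite -mulNr ler_pdivlMr //; lra.
move: h1 h2; rewrite atanN; set u := atan _; set v := atan ((G - _ - _) / _).
by rewrite -(mulr_natr pi); lra.
Qed.

Lemma cis_near1 (e : R) : 0 < e -> exists2 d : R, 0 < d &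
  forall h, `|h| < d -> nm (cis h - 1 : C) < e.
Proof.
move=> e0; have e2 : 0 < e / 2 by rewrite divr_gt0.
have /cvgrPdist_lt/(_ _ e2)/nbhs_ballP[d1 /= d10 h1] := @continuous_cos R 0.
have /cvgrPdist_lt/(_ _ e2)/nbhs_ballP[d2 /= d20 h2] := @continuous_sin R 0.
exists (Num.min d1 d2); first by rewrite lt_min d10.
move=> h; rewrite lt_min => /andP[hd1 hd2].
apply: le_lt_trans (nm_le _) _; rewrite reD imD reN imN re1 im1 re_cis im_cis.
have := h1 h; rewrite -ball_normE /= sub0r normrN cos0 => /(_ hd1) {}h1.
have := h2 h; rewrite -ball_normE /= sub0r normrN sin0 => /(_ hd2) {}h2.
by move: h1 h2; rewrite distrC sub0r normrN oppr0 addr0; lra.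
Qed.

(* A phase growing by almost [2 pi k] may miss its k-th passage only through
   values of one short arc, and two given points do not share a short arc. *)
Lemma phase_passages (lam mu : C) : nm lam = 1 -> nm mu = 1 -> lam != mu ->
  exists2 e : R, 0 < e & forall (th : R -> R) (a b : R) (k : nat),
    (0 < k)%N -> a <= b -> continuous th -> (pi *+ 2) *+ k - e <= th b - th a ->
    (exists2 y : 'I_k -> R, injective y &
       forall j, a <= y j <= b /\ cis (th (y j)) = lam) \/
    (exists2 y : 'I_k -> R, injective y &
       forall j, a <= y j <= b /\ cis (th (y j)) = mu).
Proof.
move=> l1 m1 lm; have d0 : 0 < nm (lam - mu) by rewrite nm_gt0 subr_eq0.
have [e e0 he] := cis_near1 d0.
exists e => // th a b k k0 ab cth inc.
(* By the intermediate value theorem [th] reaches [s], [s + 2 pi], up to [s + 2 pi (k - 1)]. *)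
have passages (z : C) s : cis s = z -> th a <= s ->
    s + (pi *+ 2) *+ k.-1 <= th b -> exists2 y : 'I_k -> R, injective y &
    forall j, a <= y j <= b /\ cis (th (y j)) = z.
  move=> sz sa sb.
  have ivt (j : 'I_k) : exists y, a <= y <= b /\ th y = s + (pi *+ 2) *+ j.
    have p0 := ltW pi2_gt0.
    have jk : (pi *+ 2) *+ j <= (pi *+ 2) *+ k.-1 :> R.
      by rewrite -!(mulr_natr (pi *+ 2)) ler_wpM2l // ler_nat -ltnS prednK.
    have [||y] := @IVT R th a b (s + (pi *+ 2) *+ j) ab.
    - exact: continuous_subspaceT.
    - have j0 : 0 <= (pi *+ 2) *+ j :> R by rewrite mulrn_wge0.
      rewrite ge_min le_max; apply/andP; split; apply/orP; [left|right].
        by move: sa j0; lra.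
      by apply: le_trans sb; rewrite lerD2l.
    by rewrite in_itv /= => yab yE; exists y.
  have [y hy] := choice ivt.
  exists y.
    move=> i j yij; have := (hy i).2; rewrite yij (hy j).2 => /addrI.
    rewrite -!(mulr_natr (pi *+ 2)) => /(mulfI (lt0r_neq0 pi2_gt0))/eqP.
    by rewrite eqr_nat => /eqP/val_inj.
  by move=> j; split; [exact: (hy j).1|rewrite (hy j).2 cisD cis2pi mulr1].
have [s [s1 s2 sl]] := cis_surj_window (th a) l1.
have [t [t1 t2 tm]] := cis_surj_window (th a) m1.
have [sb|sb] := leP (s + (pi *+ 2) *+ k.-1) (th b); first by left; exact: passages sl _ sb.
have [tb|tb] := leP (t + (pi *+ 2) *+ k.-1) (th b); first by right; exact: passages tm _ tb.
(* If both values miss a passage, [s] and [t] lie between [th a + 2 pi - e] and [th a + 2 pi]. Then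
   [|cis (s - t) - 1| < |lam - mu|] by the choice of [e], whereas the two are equal. *)
exfalso; have kE : (pi *+ 2) *+ k = pi *+ 2 + (pi *+ 2) *+ k.-1 :> R.
  by rewrite -mulrS prednK.
have := he (s - t); rewrite ltr_norml => /(_ _).
have -> : cis (s - t) - 1 = (lam - mu) / mu :> C.
  have m0 : mu != 0 by rewrite -nm_gt0 m1.
  rewrite mulrBl divff //; congr (_ - 1); apply: (mulIf m0).
  by rewrite divfK // -tm -cisD subrK.
rewrite nmM nmV m1 invr1 mulr1 ltxx => h; have : false by apply: h; lra.
by [].
Qed.

End Phase.

(** * Combinatorics of the matching *)

Section Matching.

(** When [l] is treated, a used element of [A l] belongs to some earlier [l'], with [K l <= K l'],
    so [l'] is in [E l] and differs from [l]. Fewer than [#|E l| <= #|A l|] elements are thus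
    taken. *)
Lemma greedy_matching (T S : finType) (K : T -> nat) (A : T -> {set S})
    (E : T -> {set T}) :
  (forall l, l \in E l) -> (forall l, (#|E l| <= #|A l|)%N) ->
  (forall l l' s, (K l <= K l')%N -> s \in A l -> s \in A l' -> l' \in E l) ->
  exists2 f : T -> S, injective f & forall l, f l \in A l.
Proof.
move=> Eref EA AE.
have [l0|T0] := pickP (@predT T); last first.
  have f : T -> S by move=> l; have := T0 l.
  by exists f => l; have := T0 l.
have [s0 _] : exists s0, s0 \in A l0.
  by apply/card_gt0P/(leq_trans _ (EA l0))/card_gt0P; exists l0.
have main (xs : seq T) : uniq xs -> pairwise (fun a b => (K b <= K a)%N) xs ->
    exists2 f : T -> S, {in xs &, injective f} & forall l, l \in xs -> f l \in A l.
  elim/last_ind: xs => [|xs l IH]; first by exists (fun=> s0).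
  rewrite rcons_uniq -cats1 pairwise_cat allrel1r => /andP[lxs uxs] /and3P[/allP Kl pxs _].
  have [f finj fA] := IH uxs pxs.
  pose used : {set T} := [set x in xs | f x \in A l]%SET.
  have used_lt : (#|(f @: used)%SET| < #|A l|)%N.
    apply: leq_ltn_trans (leq_imset_card _ _) _.
    apply: leq_trans (EA l); rewrite (cardsD1 l (E l)) Eref add1n ltnS.
    apply/subset_leq_card/fintype.subsetP => x; rewrite !inE => /andP[xxs fx].
    apply/andP; split; first by apply: contraNneq lxs => <-.
    exact: (AE l x (f x) (Kl x xxs) fx (fA x xxs)).
  have [s sA sused] : exists2 s, s \in A l & s \notin (f @: used)%SET.
    apply/fintype.subsetPn/negP => /subset_leq_card; by rewrite leqNgt used_lt.
  have fresh x : x \in xs -> f x != s.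
    move=> xxs; apply: contraNneq sused => fxs; apply/imsetP; exists x => //.
    by rewrite inE xxs fxs.
  exists (fun x => if x == l then s else f x).
    move=> x y; rewrite !mem_cat !inE.
    case: (eqVneq x l) => [->|xl]; case: (eqVneq y l) => [->|yl] //=; rewrite ?orbF ?orbT.
    - by move=> _ /fresh fy /esym/eqP; rewrite (negbTE fy).
    - by move=> /fresh fx _ /eqP; rewrite (negbTE fx).
    - exact: finj.
  move=> x; rewrite mem_cat inE; case: (eqVneq x l) => [->//|xl] /=.
  by rewrite orbF; exact: fA.
pose xs := sort (fun a b => (K b <= K a)%N) (enum T).
have [|| f finj fA] := main xs.
- by rewrite sort_uniq enum_uniq.
- rewrite -sorted_pairwise; last by move=> b a c h1 h2; exact: leq_trans h2 h1.
  by apply: sort_sorted => a b; exact: leq_total.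
have mx x : x \in xs by rewrite mem_sort mem_enum.
by exists f => [x y|l]; [exact: finj|exact: fA].
Qed.

(** Listing the image of [f] first and the other indices after it gives the reordering. *)
Lemma injection_perm (a b : nat) (f : 'I_a -> 'I_b) : injective f ->
  exists (h : (a <= b)%N) (s : {perm 'I_b}), forall l, s (widen_ord h l) = f l.
Proof.
move=> finj; have h : (a <= b)%N by have := leq_card f finj; rewrite !card_ord.
exists h; pose xs := map f (enum 'I_a) ++ [seq x <- enum 'I_b | x \notin codom f].
have uxs : uniq xs.
  rewrite cat_uniq map_inj_uniq // enum_uniq filter_uniq ?enum_uniq //= andbT.
  apply/hasPn => x; rewrite mem_filter => /andP[+ _].
  by apply: contra => /mapP[l _ ->]; exact: codom_f.
have sxs : size xs = b.
  rewrite -[RHS]size_enum_ord; apply: perm_size; apply: uniq_perm; rewrite ?enum_uniq // => x.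
  rewrite mem_enum inE mem_cat mem_filter mem_enum andbT.
  by case: (boolP (x \in codom f)).
have ginj : injective (fun i : 'I_b => nth i xs i).
  move=> i j /eqP; rewrite (set_nth_default i) ?sxs // nth_uniq ?sxs //.
  by move=> /eqP/val_inj.
exists (perm ginj) => l; rewrite permE /= nth_cat size_map size_enum_ord ltn_ord.
by rewrite (nth_map l) ?size_enum_ord // nth_ord_enum.
Qed.

(** Identifies the number of branches in a class with the sum of degrees that the phase counts. *)
Lemma card_tagged_class (L L0 : nat) (N : 'I_L -> nat) (P : pred 'I_L)
    (e : 'I_L0 -> {k : 'I_L & 'I_(N k)}) : bijective e ->
  #|[set l | P (tag (e l))]%SET| = (\sum_(k | P k) N k)%N.
Proof.
move=> ebij; rewrite -sum1dep_card.
rewrite -(reindex e (P := fun u => P (tag u)) (F := fun=> 1%N)) /=; last first.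
  by apply: onW_bij.
rewrite (eq_bigr (fun k => \sum_(j < N k) 1)%N); last first.
  by move=> k _; rewrite sum1_card card_ord.
by rewrite sig_big_dep /=; apply: eq_bigl => -[k j]; rewrite /= andbT.
Qed.

End Matching.

(** * Distortion of [beta] near 0 *)

Section BetaEstimates.
Variable R : realType.
Local Notation C := (cplx R).
Implicit Types (w v z : C) (x y : R).

Lemma beta0 : beta (0 : C) = 1.
Proof. by rewrite /beta mulr0 addr0 subr0 divr1. Qed.

Lemma nm_pole w : nm w <= 2^-1 -> 2^-1 <= nm (1 - 'i * w) <= 3 / 2.
Proof.
move=> hw; apply/andP; split.
  by have := nmBD 1 ('i * w); rewrite nmM nmi mul1r nm1; lra.
by have := nmD 1 (- ('i * w)); rewrite nmN nmM nmi mul1r nm1; lra.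
Qed.

Lemma pole_neq0 w : nm w <= 2^-1 -> 1 - 'i * w != 0.
Proof. by move=> /nm_pole/andP[h _]; rewrite -nm_gt0; apply: lt_le_trans h; rewrite invr_gt0. Qed.

Lemma betaB w v : 1 - 'i * w != 0 -> 1 - 'i * v != 0 ->
  beta w - beta v = 2 * 'i * (w - v) / ((1 - 'i * w) * (1 - 'i * v)).
Proof. by move=> w0 v0; rewrite /beta; field; rewrite w0 v0. Qed.

(** In [betaB] the modulus of the denominator lies between [1 / 4] and [9 / 4]. *)
Lemma beta_bilipschitz w v : nm w <= 2^-1 -> nm v <= 2^-1 ->
  2^-1 * nm (w - v) <= nm (beta w - beta v) <= 8 * nm (w - v).
Proof.
move=> hw hv; rewrite betaB ?pole_neq0 // nmM nmV !nmM nm_nat nmi mulr1.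
have /andP[a1 a2] := nm_pole hw; have /andP[b1 b2] := nm_pole hv.
have d0 := nm_ge0 (w - v).
set a := nm (1 - 'i * w) in a1 a2 *; set b := nm (1 - 'i * v) in b1 b2 *.
have ab0 : 0 < a * b by rewrite mulr_gt0 //; lra.
have ab1 : 4^-1 <= a * b by nra.
have ab2 : a * b <= 9 / 4 by nra.
by rewrite ler_pdivlMr // ler_pdivrMr //; apply/andP; split; nra.
Qed.

Lemma nm_beta_sub1 w : nm w <= 2^-1 -> 2^-1 * nm w <= nm (beta w - 1) <= 8 * nm w.
Proof.
move=> hw; have := @beta_bilipschitz w 0 hw.
by rewrite beta0 subr0 nm0 invr_ge0 ler0n; apply.
Qed.

Lemma beta_inj w v : nm w <= 2^-1 -> nm v <= 2^-1 -> beta w = beta v -> w = v.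
Proof.
move=> hw hv h; have /andP[] := beta_bilipschitz hw hv.
rewrite h subrr nm0 pmulr_rle0 ?invr_gt0 // => h1 _.
by apply/eqP; rewrite -subr_eq0 -nm_eq0 eq_le h1 nm_ge0.
Qed.

Lemma nm_pole_real x : 1 <= nm (1 - 'i * rc x : C) <= 1 + `|x|.
Proof.
apply/andP; split.
  rewrite -(@ler_pXn2r _ 2%N) ?nnegrE ?nm_ge0 // expr1n nm_sqr.
  rewrite !(reD, imD, reN, imN, reM, imM, re_i, im_i, re_rc, im_rc, re1, im1).
  by have := sqr_ge0 x; nra.
by have := nmD 1 (- ('i * rc x)); rewrite nmN nmM nmi mul1r nm1 nm_rc.
Qed.

(** With [b = |beta w|] and [a = |1 - i w|], one has [(1 - b) (1 + b) a ^ 2 = 4 im w] and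
    [1 / 4 <= (1 + b) a ^ 2 <= 9 / 2]. *)
Lemma one_sub_nm_beta w : nm w <= 2^-1 -> 0 < im w ->
  2^-1 * im w <= 1 - nm (beta w) <= 16 * im w.
Proof.
move=> hw iw; have w0 := pole_neq0 hw.
have /andP[a1 a2] := nm_pole hw.
have b1 : nm (beta w) < 1 by rewrite nm_beta_lt1.
have b0 := nm_ge0 (beta w).
have := nm_beta_diff w.
have -> : nm (1 + 'i * w) = nm (beta w) * nm (1 - 'i * w).
  by rewrite -nmM /beta divfK.
set a := nm (1 - _) in a1 a2 *; set b := nm (beta w) in b0 b1 * => h.
have {}h : (1 - b) * ((1 + b) * a ^+ 2) = 4 * im w by rewrite -h; ring.
have u1 : 4^-1 <= (1 + b) * a ^+ 2 by rewrite expr2; nra.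
have u2 : (1 + b) * a ^+ 2 <= 9 / 2 by rewrite expr2; nra.
by move: h u1 u2; set u := _ * _ ^+ 2 => h u1 u2; apply/andP; split; nra.
Qed.

Lemma beta_invK z : 1 + z != 0 -> beta (beta_inv z) = z.
Proof.
move=> z1; rewrite /beta /beta_inv !mulrA.
have i2 : 'i * 'i = -1 :> C by rewrite -expr2 sqrCi.
rewrite i2 !mulN1r mulNr opprK.
have -> : 1 - (1 - z) / (1 + z) = 2 * z / (1 + z) by field.
have -> : 1 + (1 - z) / (1 + z) = 2 / (1 + z) by field.
by rewrite invf_div mulrA divfK // mulrC mulKf // pnatr_eq0.
Qed.

Lemma nm_beta_inv z : nm (z - 1) <= 1 -> nm (beta_inv z) <= nm (z - 1).
Proof.
move=> hz; have h1 : 1 <= nm (1 + z).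
  have -> : 1 + z = 2 - (1 - z) by ring.
  by have := nmBD 2 (1 - z); rewrite nm_nat [nm (1 - z)]nmB; lra.
rewrite /beta_inv !nmM nmi mul1r nmV nmB ler_pdivrMr; last by lra.
by rewrite ler_peMr ?nm_ge0.
Qed.

Lemma beta_inv_real z : nm z = 1 -> 1 + z != 0 -> beta_inv z = rc (re (beta_inv z)).
Proof.
move=> z1 z10; have z0 : z != 0 by rewrite -nm_gt0 z1.
have : (beta_inv z)^* = beta_inv z.
  rewrite /beta_inv !rmorphM /= conjCi fmorphV rmorphB rmorphD rmorph1 /= (nm_eq1J z1).
  by field; rewrite z10 z0.
by rewrite {1}conjE => h; apply: im0_rc; have := congr1 (@im R) h;
  rewrite !(imD, imN, imM, im_rc, re_rc, im_i, re_i); lra.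
Qed.

Lemma poly_nonzero_near (c : {poly C}) (a : C) : c != 0 ->
  exists2 d : R, 0 < d & forall z, 0 < nm (z - a) -> nm (z - a) < d -> c.[z] != 0.
Proof.
move=> c0; have [k [c1 + cE]] := multiplicity_XsubC c a.
rewrite c0 /= => c1a; have [L L0 hL] := poly_lipschitz c1 a.
have ca : 0 < nm c1.[a] by rewrite nm_gt0.
exists (Num.min 1 (nm c1.[a] / (L + 1))).
  by rewrite lt_min ltr01 divr_gt0 // ltr_wpDl.
move=> z z0; rewrite lt_min => /andP[z1 z2].
rewrite cE hornerM horner_exp hornerXsubC mulf_neq0 //; last first.
  by rewrite expf_neq0 // -nm_gt0.
rewrite -nm_gt0; have := hL z (ltW z1); have := nmBD c1.[a] c1.[z].
rewrite nmB; move: z2; rewrite ltr_pdivlMr ?ltr_wpDl // => z2 h1 h2.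
by have := nm_ge0 (z - a); nra.
Qed.

End BetaEstimates.

(** * Roots of Weierstrass polynomials *)

Section LocalRoots.
Variable R : realType.
Local Notation C := (cplx R).

Definition weierstrass_poly (N : nat) (a : 'I_N -> C -> C) (z : C) : {poly C} :=
  'X^N + \sum_(j < N) a j z *: 'X^j.

Lemma horner_weierstrass_poly N (a : 'I_N -> C -> C) z w :
  (weierstrass_poly a z).[w] = w ^+ N + \sum_(j < N) a j z * w ^+ j.
Proof.
rewrite /weierstrass_poly hornerD hornerXn horner_sum; congr (_ + _).
by apply: eq_bigr => j _; rewrite hornerZ hornerXn.
Qed.

Lemma weierstrass_poly_split N (a : 'I_N -> C -> C) z :
  exists2 rs : seq C, size rs = N & weierstrass_poly a z = \prod_(r <- rs) ('X - r%:P).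
Proof.
have sS : (size (\sum_(j < N) a j z *: 'X^j : {poly C})%R < size ('X^N : {poly C})%R)%N.
  rewrite size_polyXn ltnS; apply: (leq_trans (size_sum _ _ _)); apply/bigmax_leqP => j _.
  by rewrite (leq_trans (size_scale_leq _ _)) // size_polyXn.
have sp : size (weierstrass_poly a z) = N.+1.
  by rewrite /weierstrass_poly size_polyDl // size_polyXn.
have lp : lead_coef (weierstrass_poly a z) = 1.
  by rewrite /weierstrass_poly lead_coefDl // lead_coefXn.
have [rs rsE] := closed_field_poly_normal (weierstrass_poly a z).
rewrite lp scale1r in rsE; exists rs => //.
by apply/eqP; rewrite -eqSS -sp rsE size_prod_XsubC.
Qed.

Lemma pseries_small (f : C -> C) (a : nat -> C) (e : R) : has_pseries f 0 a -> f 0 = 0 ->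
  0 < e -> exists2 d : R, 0 < d & forall z, nm z < d -> nm (f z) < e.
Proof.
move=> fa f0 e0; have [A [r [r0 A0 h]]] := taylor_expansion 1 fa.
have a0 : a 0%N = 0 by rewrite -(pseries_at_center fa).
exists (Num.min r (e / (A + 1))); first by rewrite lt_min r0 divr_gt0 // ltr_wpDl.
move=> z; rewrite lt_min ltr_pdivlMr ?ltr_wpDl // => /andP[zr ze].
have := h z; rewrite subr0 => /(_ zr); rewrite big_ord1 a0 mul0r subr0 expr1.
by move: ze; have := nm_ge0 z; lra.
Qed.

Lemma common_radius (I : finType) (P : I -> R -> Prop) :
  (forall i d d', 0 < d' -> d' <= d -> P i d -> P i d') ->
  (forall i, exists2 d, 0 < d & P i d) -> exists2 d, 0 < d & forall i, P i d.
Proof.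
move=> mono h.
have h' i : exists d, 0 < d /\ P i d by have [d] := h i; exists d.
have [d hd] := choice h'.
exists (\big[Num.min/1]_(i : I) d i).
  by elim/big_ind: _ => [|x y x0 y0|i _]; [exact: ltr01|rewrite lt_min x0|exact: (hd i).1].
move=> i; apply: (mono i (d i)); last exact: (hd i).2.
  by elim/big_ind: _ => [|x y x0 y0|j _]; [exact: ltr01|rewrite lt_min x0|exact: (hd j).1].
by rewrite (bigD1 i) //= ge_min lexx.
Qed.

Lemma weierstrass_roots_small N (a : 'I_N -> C -> C) (e : R) : 0 < e ->
  (forall j, analytic_near (a j) 0 /\ a j 0 = 0) ->
  exists2 d : R, 0 < d & forall z w, nm z < d -> (weierstrass_poly a z).[w] = 0 -> nm w < e.
Proof.
(* As [N.+1 * eta = min (1, e) ^ N], the [N] lower terms cannot balance [nm w ^+ N] when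
   [nm w >= e]. For [nm w <= 1] their powers are bounded by 1, otherwise by [nm w ^+ N.-1]. *)
move=> e0 ha; pose eta := Num.min 1 e ^+ N / (N.+1%:R).
have m0 : 0 < Num.min 1 e by rewrite lt_min ltr01.
have eta0 : 0 < eta by rewrite divr_gt0 ?exprn_gt0 // ltr0n.
have [d d0 hd] : exists2 d : R, 0 < d & forall j z, nm z < d -> nm (a j z) < eta.
  apply: (common_radius (P := fun j d => forall z, nm z < d -> nm (a j z) < eta)).
    by move=> j d d' _ dd' h z zd; apply: h; exact: lt_le_trans dd'.
  move=> j; have [/analytic_nearE[c hc] aj0] := ha j.
  exact: pseries_small hc aj0 eta0.
exists d => // z w zd; rewrite horner_weierstrass_poly => /eqP; rewrite addr_eq0 => /eqP wN.
rewrite ltNge; apply/negP => ew.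
have mw : Num.min 1 e <= nm w by rewrite ge_min ew orbT.
have bound (T : R) : (forall j : 'I_N, nm w ^+ j <= T) -> 0 <= T ->
    nm w ^+ N <= N%:R * (eta * T).
  move=> hT T0; rewrite -nmX wN nmN; apply: le_trans (nm_sum _ _ _) _.
  rewrite -[X in X%:R * _]card_ord -sum1_card natr_sum mulr_suml; apply: ler_sum => j _.
  by rewrite mul1r nmM nmX ler_pM ?nm_ge0 ?exprn_ge0 ?nm_ge0 // ltW // hd.
have etaE : N.+1%:R * eta = Num.min 1 e ^+ N.
  by rewrite /eta mulrC divfK // pnatr_eq0.
have N1 : N.+1%:R = N%:R + 1 :> R by rewrite -natr1.
have Ne0 : 0 <= N%:R * eta by rewrite mulr_ge0 // ltW.
have [w1|w1] := leP (nm w) 1.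
  have := bound 1 _ ler01; rewrite mulr1 => /(_ _)/le_lt_trans.
  have wm : Num.min 1 e ^+ N <= nm w ^+ N by rewrite lerXn2r ?nnegrE ?nm_ge0 ?(ltW m0).
  move=> /(_ (nm w ^+ N)); rewrite ltxx => h; suff : false by [].
  apply: h => [j|]; first by rewrite exprn_ile1 ?nm_ge0.
  by apply: lt_le_trans wm; rewrite -etaE N1; lra.
have [N0|N0] := posnP N.
  have : nm w ^+ N <= N%:R * (eta * 1).
    by apply: bound => // -[j /= jN]; move: jN; rewrite N0.
  by rewrite N0 expr0 mul0r ler10.
have := bound (nm w ^+ N.-1) _ (exprn_ge0 _ (nm_ge0 _)).
have -> : nm w ^+ N = nm w * nm w ^+ N.-1 by rewrite -exprS prednK.
rewrite mulrA ler_pM2r ?exprn_gt0 ?(lt_trans ltr01 w1) // => h.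
have : nm w <= N%:R * eta.
  by apply: h => j; rewrite ler_weXn2l ?(ltW w1) // -ltnS prednK.
have : Num.min 1 e ^+ N <= 1 by rewrite exprn_ile1 ?(ltW m0) // ge_min lexx.
by rewrite -etaE N1; move: w1 eta0; lra.
Qed.

End LocalRoots.

(** * Local zeros as roots of the half-plane polynomial *)

Section LocalFactorization.
Variable R : realType.
Local Notation C := (cplx R).

Lemma prod_roots (I : eqType) (Q : I -> {poly C}) (N : I -> nat) :
  (forall k, exists2 rs : seq C, size rs = N k & Q k = \prod_(r <- rs) ('X - r%:P)) ->
  forall s : seq I, exists rs : seq C, [/\ size rs = (\sum_(k <- s) N k)%N,
    \prod_(k <- s) Q k = \prod_(r <- rs) ('X - r%:P) &
    forall r, r \in rs -> exists2 k, k \in s & root (Q k) r].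
Proof.
move=> hQ; elim=> [|k s [rs [rsN rsE hrs]]]; first by exists [::]; rewrite !big_nil.
have [rs' rs'N rs'E] := hQ k; exists (rs' ++ rs); split.
- by rewrite size_cat big_cons rs'N rsN.
- by rewrite big_cons big_cat rs'E rsE.
- move=> r; rewrite mem_cat => /orP[rr|/hrs[k' k's k'r]]; last first.
    by exists k' => //; rewrite inE k's orbT.
  by exists k; rewrite ?mem_head // rs'E root_prod_XsubC.
Qed.

Variables (m n : nat) (p : {poly {poly C}}).
Hypothesis pdeg : has_bidegree m n p.
Hypothesis ncf : no_common_factor p (reflection m n p).
Hypothesis pD : forall z, bidisk z -> eval2 p z != 0.

Variables (L : nat) (N : 'I_L -> nat) (alpha : C * C -> C)
  (q : 'I_L -> C * C -> C) (Psi : 'I_L -> C -> C)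
  (r : forall k, 'I_(N k) -> C -> C).
Hypothesis alpha_hol : holomorphic2_near alpha (0, 0).
Hypothesis factorization : \forall w \near ((0, 0) : C * C),
  upper_half_plane_form m n (reflection m n p) w = alpha w * \prod_(k < L) q k w.
Hypothesis N_gt0 : forall k, (0 < N k)%N.
Hypothesis q_weierstrass : forall k, weierstrass (N k) (q k).
Hypothesis Psi_analytic : forall k, analytic_near (Psi k) 0.
Hypothesis Psi0 : forall k, Psi k 0 = 0.
Hypothesis r_branches : forall k, root_branches (r (k := k)).
Hypothesis q_zeros : forall k, \forall w \near ((0, 0) : C * C),
  q k w = 0 <-> exists t, t ^+ N k = w.2 /\ w.1 = Psi k t.

Lemma alpha_bounded : exists2 d : R, 0 < d & exists B : R, forall z w : C,
  nm z < d -> nm w < d -> nm (alpha (z, w)) <= B.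
Proof.
have /differentiable_continuous ac := nbhs_singleton alpha_hol.
have : \forall w \near ((0, 0) : C * C), nm (alpha w - alpha (0, 0)) < 1.
  by apply: (ac [set v | nm (v - alpha (0, 0)) < 1]); apply/near_nm; exists 1.
move=> /near2_nm[d d0 hd]; exists d => //; exists (1 + nm (alpha (0, 0))) => z w zd wd.
have := hd z w; rewrite !subr0 => /(_ zd wd).
by have := nmBD (alpha (z, w)) (alpha (0, 0)); lra.
Qed.

Lemma near2_0 (P : C * C -> Prop) : (\forall z \near ((0, 0) : C * C), P z) ->
  exists2 d : R, 0 < d & forall z w, nm z < d -> nm w < d -> P (z, w).
Proof.
move=> /near2_nm[d d0 hd]; exists d => // z w zd wd.
by apply: hd; rewrite subr0.
Qed.

(** Under [A1] the point [(1, 1)], at [x = 0], is itself a common zero. Near [beta 0 = 1] the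
    polynomial [c] has no root other than possibly 1. *)
Lemma common_zero_poly : exists2 d : R, 0 < d & forall x : R, 0 < `|x| -> `|x| < d ->
  halfplane_poly m n p x != 0 /\
  forall w, (halfplane_poly m n p x).[w] = 0 -> 0 < im w.
Proof.
have [c c0 hc] := common_zeros_finite (bidegree_neq0 pdeg) ncf.
have [d d0 hd] := poly_nonzero_near 1 c0.
exists (Num.min (2^-1) (d / 8)); first by rewrite lt_min invr_gt0 ltr0n divr_gt0.
move=> x x0; rewrite lt_min => /andP[x2 xd].
have hx : nm (rc x : C) <= 2^-1 by rewrite nm_rc ltW.
have /andP[b1 b2] := nm_beta_sub1 hx.
have cx : c.[beta (rc x)] != 0.
  apply: hd; first by apply: lt_le_trans b1; rewrite mulr_gt0 ?invr_gt0 // nm_rc.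
  by apply: le_lt_trans b2 _; rewrite nm_rc; move: xd; lra.
split; first exact: (halfplane_poly_neq0 pdeg ncf pD hc cx).
by move=> w; exact: (halfplane_poly_roots pdeg ncf pD hc cx).
Qed.

(** [Psi k t] is a zero of [q k] over [x = t ^+ N k], hence a root of [halfplane_poly] at [x]. *)
Lemma Psi_positive : exists2 d : R, 0 < d & forall k t, 0 < nm t -> nm t < d ->
  im (t ^+ N k) = 0 -> 0 < im (Psi k t).
Proof.
have [d1 d10 h1] := common_zero_poly.
have [d2 d20 h2] := near2_0 factorization.
have [d3 d30 h3] : exists2 d : R, 0 < d & forall k z w, nm z < d -> nm w < d ->
    q k (z, w) = 0 <-> exists t, t ^+ N k = w /\ z = Psi k t.
  apply: (common_radius (P := fun k d => forall z w, nm z < d -> nm w < d ->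
    q k (z, w) = 0 <-> exists t, t ^+ N k = w /\ z = Psi k t)).
    by move=> k d d' _ dd' h z w zd wd; apply: h; exact: lt_le_trans dd'.
  by move=> k; exact: near2_0 (q_zeros k).
pose e := Num.min (Num.min 2^-1 d1) (Num.min d2 d3).
have e0 : 0 < e by rewrite !lt_min invr_gt0 ltr0n d10 d20.
have [d4 d40 h4] : exists2 d : R, 0 < d & forall k z, nm z < d -> nm (Psi k z) < e.
  apply: (common_radius (P := fun k d => forall z, nm z < d -> nm (Psi k z) < e)).
    by move=> k d d' _ dd' h z zd; apply: h; exact: lt_le_trans dd'.
  move=> k; have /analytic_nearE[c hc] := Psi_analytic k.
  exact: pseries_small hc (Psi0 k) e0.
exists (Num.min e d4); first by rewrite lt_min e0.
move=> k t t0; rewrite lt_min => /andP[te t4] /im0_rc tN; set x := re _ in tN.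
have xE : `|x| = nm t ^+ N k by rewrite -nm_rc -tN nmX.
have x0 : 0 < `|x| by rewrite xE exprn_gt0.
have e1 : e <= 2^-1 by rewrite !ge_min lexx.
have xe : `|x| < e.
  rewrite xE; apply: (le_lt_trans _ te); rewrite -[leRHS]expr1.
  by rewrite ler_wiXn2l ?nm_ge0 // ltW // (lt_le_trans te) // (le_trans e1) // invf_le1 // ler1n.
have ed1 : e <= d1 by rewrite !ge_min lexx orbT.
have ed2 : e <= d2 by rewrite !ge_min lexx orbT.
have ed3 : e <= d3 by rewrite !ge_min lexx !orbT.
have Pe := h4 k t t4.
have nx : nm (rc x : C) < e by rewrite nm_rc.
apply: (h1 x x0 (lt_le_trans xe ed1)).2.
rewrite halfplane_polyE; last by rewrite pole_neq0 // (le_trans (ltW Pe)).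
rewrite h2; [|exact: lt_le_trans ed2|exact: lt_le_trans ed2].
rewrite (bigD1 k) //= (_ : q k _ = 0) ?mul0r ?mulr0 //.
apply/(h3 k); [exact: lt_le_trans ed3|exact: lt_le_trans ed3|].
by exists t.
Qed.

(** Asking for the bounds at every [N k]-th root [t] of [x] serves all branches of a factor at once,
    on both sides of 0 and whatever the choice of roots on the slit. *)
Definition branch_expansion (K : 'I_L -> nat) (g : 'I_L -> nat -> R) (A c : 'I_L -> R) (d : R) :=
  forall k, [/\ ~~ odd (K k), 0 <= A k, 0 < c k &
    forall (x : R) (t : C), `|x| < d -> t ^+ N k = rc x ->
       nm (Psi k t - rc (\sum_(i < K k) g k i * x ^+ i)) <= A k * `|x| ^+ K k /\
       c k * `|x| ^+ K k <= im (Psi k t)].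

Lemma branch_expansion_exists : exists K g A c d, 0 < d /\ branch_expansion K g A c d.
Proof.
have [d d0 hd] := Psi_positive.
have ex k : exists D : nat * (nat -> R) * R * R * R, let: (K, g, A, c, d') := D in
    [/\ ~~ odd K, 0 <= A, 0 < c, 0 < d' &
     forall (x : R) (t : C), `|x| < d' -> t ^+ N k = rc x ->
       nm (Psi k t - rc (\sum_(i < K) g i * x ^+ i)) <= A * `|x| ^+ K /\
       c * `|x| ^+ K <= im (Psi k t)].
  have /analytic_nearE[a ha] := Psi_analytic k.
  have [rN _ rI] := r_branches k.
  have [||K [g [A [c [d' h]]]]] := @puiseux_branch R (N k) (fun j => r j 1) (Psi k) a d (N_gt0 k) _ _ ha d0 (hd k).
  - by move=> j; exact: rN.
  - exact: rI (oner_neq0 _).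
  by exists (K, g, A, c, d').
have [D hD] := choice ex.
have [d' d'0 hd'] : exists2 d' : R, 0 < d' & forall k, d' <= (D k).2.
  apply: (common_radius (P := fun k d' => d' <= (D k).2)).
    by move=> k e e' _ ee' h; exact: le_trans ee' h.
  move=> k; exists (D k).2 => //; have := hD k.
  by case: (D k) => [[[[K g] A] c] e] [].
exists (fun k => (D k).1.1.1.1), (fun k => (D k).1.1.1.2), (fun k => (D k).1.1.2),
  (fun k => (D k).1.2), d'; split=> // k.
have := hD k; have := hd' k; case: (D k) => [[[[K g] A] c] e] /= d'e [h1 h2 h3 h4 h5].
by split => // x t xd; apply: h5; exact: lt_le_trans d'e.
Qed.

(** [rs1] collects the roots of the Weierstrass polynomials in the class [cl], with multiplicity;
    [rs2] collects the other local roots and those far from 0. *)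
Lemma local_roots : exists2 d : R, 0 < d & forall x : R, 0 < `|x| -> `|x| < d ->
  forall cl : pred 'I_L, exists (rs1 rs2 : seq C) (c : C),
  [/\ c != 0, halfplane_poly m n p x = c *: \prod_(r <- rs1 ++ rs2) ('X - r%:P),
      forall r, r \in rs1 ++ rs2 -> 0 < im r,
      size rs1 = (\sum_(k | cl k) N k)%N &
      forall r, r \in rs1 -> exists k t, [/\ cl k, t ^+ N k = rc x & r = Psi k t]].
Proof.
have [a ha] : exists a : forall k, 'I_(N k) -> C -> C, forall k,
    (forall j, analytic_near (a k j) 0 /\ a k j 0 = 0) /\
    \forall w \near ((0, 0) : C * C),
      q k w = w.1 ^+ N k + \sum_(j < N k) a k j w.2 * w.1 ^+ j.
  exists (fun k => projT1 (cid (q_weierstrass k))) => k.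
  exact: projT2 (cid (q_weierstrass k)).
have [d1 d10 h1] := common_zero_poly.
have [d2 d20 h2] := near2_0 factorization.
have [d3 d30 h3] : exists2 d : R, 0 < d & forall k z w, nm z < d -> nm w < d ->
    q k (z, w) = 0 <-> exists t, t ^+ N k = w /\ z = Psi k t.
  apply: (common_radius (P := fun k d => forall z w, nm z < d -> nm w < d ->
    q k (z, w) = 0 <-> exists t, t ^+ N k = w /\ z = Psi k t)).
    by move=> k d d' _ dd' h z w zd wd; apply: h; exact: lt_le_trans dd'.
  by move=> k; exact: near2_0 (q_zeros k).
have [d4 d40 h4] : exists2 d : R, 0 < d & forall k z w, nm z < d -> nm w < d ->
    q k (z, w) = (weierstrass_poly (a k) w).[z].
  apply: (common_radius (P := fun k d => forall z w, nm z < d -> nm w < d ->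
    q k (z, w) = (weierstrass_poly (a k) w).[z])).
    by move=> k d d' _ dd' h z w zd wd; apply: h; exact: lt_le_trans dd'.
  move=> k; have [_ /near2_0[d d0 hd]] := ha k; exists d => // z w zd wd.
  by rewrite horner_weierstrass_poly hd.
have [d5 d50 [B hB]] := alpha_bounded.
pose e := Num.min (Num.min 2^-1 d5) (Num.min (Num.min d2 d3) d4).
have e0 : 0 < e by rewrite !lt_min invr_gt0 ltr0n d50 d20 d30.
have e1 : e <= 2^-1 by rewrite !ge_min lexx.
have ed5 : e <= d5 by rewrite !ge_min lexx orbT.
have ed2 : e <= d2 by rewrite !ge_min lexx !orbT.
have ed3 : e <= d3 by rewrite !ge_min lexx !orbT.
have ed4 : e <= d4 by rewrite !ge_min lexx !orbT.
have [d6 d60 h6] : exists2 d : R, 0 < d & forall k z w, nm z < d ->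
    (weierstrass_poly (a k) z).[w] = 0 -> nm w < e.
  apply: (common_radius (P := fun k d => forall z w, nm z < d ->
    (weierstrass_poly (a k) z).[w] = 0 -> nm w < e)).
    by move=> k d d' _ dd' h z w zd; apply: h; exact: lt_le_trans dd'.
  by move=> k; exact: weierstrass_roots_small e0 (ha k).1.
exists (Num.min (Num.min e d6) d1); first by rewrite lt_min d10 andbT lt_min e0.
move=> x x0; rewrite lt_min => /andP[+ x1]; rewrite lt_min => /andP[xe x6] cl.
have [P0 Ppos] := h1 x x0 x1.
have nx : nm (rc x : C) < e by rewrite nm_rc.
have nx6 : nm (rc x : C) < d6 by rewrite nm_rc.
pose Q k := weierstrass_poly (a k) (rc x).
have hQ k : exists2 rs : seq C, size rs = N k & Q k = \prod_(r <- rs) ('X - r%:P).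
  exact: weierstrass_poly_split.
have [rs1 [s1 E1 m1]] := prod_roots hQ [seq k <- enum 'I_L | cl k].
have [rs2 [s2 E2 m2]] := prod_roots hQ [seq k <- enum 'I_L | ~~ cl k].
have QE : \prod_(k < L) Q k = \prod_(r <- rs1 ++ rs2) ('X - r%:P).
  rewrite big_cat /= -E1 -E2 !big_filter !big_enum_cond /=.
  by rewrite [LHS](bigID cl) /=.
have rse w : w \in rs1 ++ rs2 -> nm w < e.
  by rewrite mem_cat => /orP[/m1|/m2] [k _ /rootP hk]; exact: h6 nx6 hk.
(* Near 0 the polynomial is [alpha] times the product of the [Q k], and [B] bounds [alpha]. The
   roots of the quotient [H] are the distant ones. *)
have [w we|H HE] := @bounded_quotient_dvd R (rs1 ++ rs2) (halfplane_poly m n p x) e B rse.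
  rewrite -QE halfplane_polyE; last by rewrite pole_neq0 // (le_trans (ltW we)).
  rewrite h2; [|exact: lt_le_trans ed2|exact: lt_le_trans ed2].
  rewrite nmM ler_pM ?nm_ge0 ?hB //; [exact: lt_le_trans ed5|exact: lt_le_trans ed5|].
  rewrite horner_prod !nm_prod ler_prod // => k _; rewrite nm_ge0 /=.
  by rewrite h4 //; exact: lt_le_trans ed4.
have H0 : H != 0 by apply: contra P0 => /eqP h; rewrite HE h mulr0.
have [rsH rsHE] := closed_field_poly_normal H.
exists rs1, (rs2 ++ rsH), (lead_coef H).
have PE : halfplane_poly m n p x =
    lead_coef H *: \prod_(r <- rs1 ++ rs2 ++ rsH) ('X - r%:P).
  by rewrite HE {1}rsHE catA [in RHS]big_cat -scalerAr.
split => //; first by rewrite lead_coef_eq0.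
- move=> w wr; apply: Ppos; apply/rootP; rewrite PE rootZ ?lead_coef_eq0 //.
  by rewrite root_prod_XsubC.
- by rewrite s1 big_filter big_enum_cond.
- move=> w wr; have [k] := m1 w wr; rewrite mem_filter => /andP[clk _] /rootP kw.
  have we : nm w < e by apply: rse; rewrite mem_cat wr.
  have [|||t [tN wE]] := (h3 k w (rc x) _ _).1.
  - exact: lt_le_trans ed3.
  - exact: lt_le_trans ed3.
  - by rewrite h4 //; exact: lt_le_trans ed4.
  by exists k, t.
Qed.

End LocalFactorization.

(** * Counting the real solutions near a centre *)

Section Counting.
Variable R : realType.
Local Notation C := (cplx R).
Variables (m n : nat) (p : {poly {poly C}}).
Hypothesis pdeg : has_bidegree m n p.

Variables (L : nat) (N : 'I_L -> nat) (Psi : 'I_L -> C -> C).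
Hypothesis N_gt0 : forall k, (0 < N k)%N.
Hypothesis Psi0 : forall k, Psi k 0 = 0.
Variables (K : 'I_L -> nat) (g : 'I_L -> nat -> R) (A c : 'I_L -> R) (d : R).
Hypothesis d_gt0 : 0 < d.
Hypothesis expansion : branch_expansion N Psi K g A c d.

Definition center (k : 'I_L) (x : R) : R := \sum_(i < K k) g k i * x ^+ i.

(* The branches that follow branch [k] up to the scale [x ^+ K k]. *)
Definition cluster (k : 'I_L) : pred 'I_L :=
  fun k' => (K k <= K k')%N && [forall i : 'I_(K k), g k' i == g k i].

Lemma cluster_refl k : cluster k k.
Proof. by rewrite /cluster leqnn; apply/forallP => i. Qed.

Lemma contact_gt0 k : (0 < K k)%N.
Proof.
rewrite lt0n; apply/negP => /eqP K0.
have [_ _ c0 h] := expansion k.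
have h0 : `|0 : R| < d by rewrite normr0.
have hN : (0 : C) ^+ N k = rc 0 by rewrite expr0n gtn_eqF // rmorph0.
have [_] := h 0 0 h0 hN.
by rewrite K0 expr0 mulr1 Psi0 leNgt -[im 0]/(0 : R) c0.
Qed.

Lemma center0 k : g k 0%N = 0.
Proof.
have [_ _ c0 h] := expansion k.
have h0 : `|0 : R| < d by rewrite normr0.
have hN : (0 : C) ^+ N k = rc 0 by rewrite expr0n gtn_eqF // rmorph0.
have [+ _] := h 0 0 h0 hN.
have K0 := contact_gt0 k; rewrite normr0 expr0n gtn_eqF // mulr0 Psi0 sub0r nmN nm_rc.
rewrite -(big_mkord xpredT (fun i => g k i * 0 ^+ i)) big_ltn // big_nat big1 => [|i /andP[i0 _]].
  by rewrite addr0 expr0 mulr1 normr_le0 => /eqP.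
by rewrite expr0n gtn_eqF // mulr0.
Qed.

Lemma center_small k : exists2 B : R, 0 <= B & forall x : R, 0 < x -> x < 1 ->
  `|center k x| <= B * x.
Proof.
exists (\sum_(i < K k) `|g k i|); first by apply: sumr_ge0 => i _.
move=> x x0 x1; rewrite /center; apply: le_trans (ler_norm_sum _ _ _) _.
rewrite mulr_suml; apply: ler_sum => i _; rewrite normrM normrX (gtr0_norm x0).
case: (i : nat) => [|j]; first by rewrite center0 normr0 !mul0r.
rewrite ler_wpM2l // exprS ler_piMr ?(ltW x0) //.
by rewrite exprn_ile1 ?(ltW x0) // ltW.
Qed.

(** Inside a cluster the centres share all exponents below [K k0]; the remaining ones are
    [O (x ^ K k0)]. *)
Lemma cluster_expansion k0 : exists2 B : R, 0 <= B & forall k (t : C) (x : R),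
  cluster k0 k -> 0 < x -> x < d -> x < 1 -> t ^+ N k = rc x ->
  nm (Psi k t - rc (center k0 x)) <= B * x ^+ K k0.
Proof.
have A0 k : 0 <= A k by case: (expansion k).
pose b k := A k + \sum_(i < K k) `|g k i|.
have b0 k : 0 <= b k by rewrite addr_ge0 // sumr_ge0.
exists (\sum_k b k); first exact: sumr_ge0.
move=> k t x /andP[KK /forallP gE] x0 xd x1 tN.
have [_ _ _ h] := expansion k.
have [|h1 _] := h x t _ tN; first by rewrite gtr0_norm.
rewrite gtr0_norm // in h1.
have xK i : (K k0 <= i)%N -> x ^+ i <= x ^+ K k0.
  by move=> ki; apply: ler_wiXn2l => //; exact: ltW.
have xK0 : 0 <= x ^+ K k0 by rewrite exprn_ge0 // ltW.
apply: (@le_trans _ _ (b k * x ^+ K k0)); last first.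
  rewrite ler_wpM2r // (bigD1 k) //= lerDl; exact: sumr_ge0.
set G := \sum_(i < K k) _ in h1.
have GE : `|G - center k0 x| <= (\sum_(i < K k) `|g k i|) * x ^+ K k0.
  rewrite /G /center -(big_mkord xpredT (fun i => g k i * x ^+ i)).
  rewrite -(big_mkord xpredT (fun i => `|g k i|)) (big_cat_nat (n := K k0)) //= addrAC.
  rewrite (_ : \sum_(0 <= i < K k0) g k i * x ^+ i - _ = 0) ?add0r; last first.
    rewrite big_mkord -sumrB big1 // => i _.
    by rewrite (eqP (gE i)) subrr.
  apply: le_trans (ler_norm_sum _ _ _) _; rewrite mulr_suml.
  rewrite [leRHS](big_cat_nat (n := K k0)) //=; apply: (@le_trans _ _ (
    \sum_(K k0 <= i < K k) `|g k i| * x ^+ K k0)); last first.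
    by rewrite lerDr; apply: sumr_ge0 => i _; rewrite mulr_ge0.
  rewrite big_nat [leRHS]big_nat; apply: ler_sum => i /andP[ki _].
  by rewrite normrM normrX (gtr0_norm x0) ler_wpM2l // xK.
have -> : Psi k t - rc (center k0 x) = (Psi k t - rc G) + rc (G - center k0 x).
  by rewrite rmorphB; ring.
apply: le_trans (nmD _ _) _; rewrite nm_rc mulrDl lerD //.
by apply: le_trans h1 _; rewrite ler_wpM2l // xK.
Qed.

Hypothesis roots : exists2 d : R, 0 < d & forall x : R, 0 < `|x| -> `|x| < d ->
  forall cl : pred 'I_L, exists (rs1 rs2 : seq C) (c : C),
  [/\ c != 0, halfplane_poly m n p x = c *: \prod_(r <- rs1 ++ rs2) ('X - r%:P),
      forall r, r \in rs1 ++ rs2 -> 0 < im r,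
      size rs1 = (\sum_(k | cl k) N k)%N &
      forall r, r \in rs1 -> exists k t, [/\ cl k, t ^+ N k = rc x & r = Psi k t]].

Definition many_solutions (k0 : 'I_L) (M x : R) (lam : C) : Prop :=
  exists2 y : 'I_(\sum_(k | cluster k0 k) N k)%N -> R, injective y &
    forall j, `|y j - center k0 x| <= M * x ^+ K k0 /\
      level_set (reflection m n p) p lam (beta (rc (y j)), beta (rc x)).

(** The phase tolerance depends on the pair [lam], [mu] alone, and [M] on it and the cluster.
    Neither depends on [x], although the value that obtains the solutions may. *)
Lemma solutions_near_center (k0 : 'I_L) (lam mu : C) :
  nm lam = 1 -> nm mu = 1 -> lam != mu ->
  exists2 M : R, 0 < M & exists2 e : R, 0 < e & forall x : R, 0 < x -> x < e ->
    many_solutions k0 M x lam \/ many_solutions k0 M x mu.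
Proof.
move=> l1 m1 lm; have [B B0 hB] := cluster_expansion k0.
have [e e0 he] := phase_passages l1 m1 lm.
pose n0 := (\sum_(k | cluster k0 k) N k)%N.
have n00 : (0 < n0)%N.
  by rewrite /n0 (bigD1 k0) ?cluster_refl //= addn_gt0 N_gt0.
have [M M0 hM] := phase_increment n0 B0 e0.
have [d1 d10 hd1] := roots.
exists M => //; exists (Num.min (Num.min d 1) d1).
  by rewrite !lt_min d_gt0 ltr01.
move=> x x0; rewrite !lt_min => /andP[/andP[xd x1] xd1].
have [|| rs1 [rs2 [cc [cc0 PE im0 srs1 hrs1]]]] := hd1 x _ _ (cluster k0).
- by rewrite gtr0_norm.
- by rewrite gtr0_norm.
have [th0 th0E] := phaseE cc0 im0.
set X := x ^+ K k0; have X0 : 0 < X by rewrite exprn_gt0.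
set G := center k0 x; set a := G - M * X; set b := G + M * X.
have MX : 0 < M * X by rewrite mulr_gt0.
have ab : a <= b by rewrite /a /b; lra.
pose th y := th0 + phase (rs1 ++ rs2) y.
have cth : continuous th.
  by move=> y; apply: cvgD; [exact: cvg_cst|exact: phase_continuous].
have inc : (pi *+ 2) *+ n0 - e <= th b - th a.
  have i1 : (pi *+ 2) *+ n0 - e <= phase rs1 b - phase rs1 a.
    apply: hM => // r rr; have ir : 0 < im r by apply: im0; rewrite mem_cat rr.
    have [k [t [clk tN rE]]] := hrs1 r rr.
    have := hB k t x clk x0 xd x1 tN; rewrite -rE -/G -/X => nB.
    split => //.
      apply: le_trans nB; apply: le_trans (im_le _).
      by rewrite imD imN im_rc oppr0 addr0 ler_norm.
    by apply: le_trans nB; apply: le_trans (re_le _); rewrite reD reN re_rc.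
  (* The roots outside the cluster cannot undo the gain: they also lie in the upper half-plane. *)
  have i2 : phase rs2 a <= phase rs2 b.
    by apply: phase_le => // r rr; apply: im0; rewrite mem_cat rr orbT.
  by rewrite /th !phase_cat; move: i1 i2; lra.
have conv (z : C) (y : 'I_n0 -> R) : injective y ->
    (forall j, a <= y j <= b /\ cis (th (y j)) = z) -> many_solutions k0 M x z.
  move=> yinj hy; exists y => // j; have [/andP[ya yb] yz] := hy j.
  split; first by rewrite ler_norml -/G -/X; apply/andP; split; move: ya yb; rewrite /a /b; lra.
  by apply: halfplane_level => //; rewrite -yz {1}PE th0E -PE.
have [[y yi hy]|[y yi hy]] := he th a b n0 n00 ab cth inc.
- by left; exact: conv yi hy.
- by right; exact: conv yi hy.
Qed.

End Counting.

(** * Level branches that follow a centre *)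

Section LevelBranches.
Variable R : realType.
Local Notation C := (cplx R).

Lemma poly_jet (P : {poly C}) (K : nat) (M : R) :
  (forall e : R, 0 < e -> exists x : R, [/\ 0 < x, x < e & nm P.[rc x] <= M * x ^+ K]) ->
  exists B : R, forall x : R, 0 < x -> x < 1 -> nm P.[rc x] <= B * x ^+ K.
Proof.
move=> freq; have [B B0 hB] := poly_bounded (drop_poly K P) 1.
have PE (z : C) : P.[z] = \sum_(i < K) P`_i * z ^+ i + (drop_poly K P).[z] * z ^+ K.
  rewrite -[in LHS](poly_take_drop K P) hornerD hornerM hornerXn; congr (_ + _).
  by rewrite /take_poly horner_poly.
have dropB (x : R) : 0 < x -> x < 1 -> nm ((drop_poly K P).[rc x] * rc x ^+ K) <= B * x ^+ K.
  move=> x0 x1; have nx : nm (rc x : C) = x by rewrite nm_rc gtr0_norm.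
  rewrite nmM nmX nx ler_wpM2r ?exprn_ge0 ?(ltW x0) // hB // nx ltW //.
have c0 : forall j, (j < K)%N -> P`_j = 0.
  apply: (@small_jet_eq0 R (fun j => P`_j) K (M + B)) => e e0.
  have e1 : 0 < Num.min e 1 by rewrite lt_min e0 ltr01.
  have [x [x0 ]] := freq _ e1; rewrite lt_min => /andP[xe x1] hx.
  have nx : nm (rc x : C) = x by rewrite nm_rc gtr0_norm.
  exists (rc x); rewrite nx; split=> //.
  have := dropB x x0 x1; rewrite mulrDl => hd.
  have -> : \sum_(i < K) P`_i * rc x ^+ i =
    P.[rc x] - (drop_poly K P).[rc x] * rc x ^+ K by rewrite PE; ring.
  by apply: le_trans (nmD _ _) _; rewrite nmN lerD.
exists B => x x0 x1; rewrite PE big1 ?add0r; first exact: dropB.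
by move=> i _; rewrite c0 ?ltn_ord // mul0r.
Qed.

Definition follows (K : nat) (G : R -> R) (psi : C -> C) : Prop :=
  exists B d : R, 0 < d /\ forall x : R, 0 < x -> x < d ->
    nm (psi (beta (rc x)) - beta (rc (G x))) <= B * x ^+ K.

(** Closeness at points accumulating at 0 implies closeness at every small [x > 0], with another
    constant: modulo [O (x ^ K)] the difference is a polynomial in [x], to which [poly_jet]
    applies. *)
Lemma not_follows (psi : C -> C) (c : nat -> C) (g : nat -> R) (K : nat) (M : R) :
  let G x := \sum_(i < K) g i * x ^+ i in
  has_pseries psi 1 c -> ~ follows K G psi ->
  exists2 e : R, 0 < e & forall x : R, 0 < x -> x < e ->
    M * x ^+ K < nm (psi (beta (rc x)) - beta (rc (G x))).
Proof.
move=> G psic nf; apply: contrapT => neg; apply: nf.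
have freq (e : R) : 0 < e -> exists x : R, [/\ 0 < x, x < e &
    nm (psi (beta (rc x)) - beta (rc (G x))) <= M * x ^+ K].
  move=> e0; apply: contrapT => h; apply: neg; exists e => // x x0 xe.
  by rewrite ltNge; apply/negP => hx; apply: h; exists x.
have [A [rr [rr0 A0 hA]]] := taylor_expansion K psic.
have [Gp GpE] : exists Gp : {poly C}, forall x : R, Gp.[rc x] = rc (G x).
  exists (\poly_(i < K) rc (g i)) => x.
  by rewrite horner_poly /G rmorph_sum; apply: eq_bigr => i _; rewrite rmorphM rmorphXn.
(* The equation cleared of the poles of [beta]. *)
pose P : {poly C} := (1 - 'i *: Gp) *
    (\sum_(k < K) c k *: ((2 * 'i) *: 'X) ^+ k * (1 - 'i *: 'X) ^+ (K - k)) -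
  (1 + 'i *: Gp) * (1 - 'i *: 'X) ^+ K.
(* The Taylor polynomial of [psi] along the arc; as [beta x - 1 = 2 i x / (1 - i x)], the factor
   [(1 - i x) ^+ K] clears its denominators. *)
pose S (x : R) : C := \sum_(k < K) c k * (beta (rc x) - 1) ^+ k.
have PE (x : R) : P.[rc x] =
    (1 - 'i * rc x) ^+ K * (1 - 'i * rc (G x)) * (S x - beta (rc (G x))).
  have px := beta_real_neq0 x; have pg := beta_real_neq0 (G x).
  rewrite /P !(hornerD, hornerN, hornerM, hornerZ, hornerX, hornerC, horner_exp, GpE).
  rewrite mulrBr; congr (_ - _); last first.
    have bE : (1 - 'i * rc (G x)) * beta (rc (G x)) = 1 + 'i * rc (G x).
      by rewrite /beta mulrC divfK.
    by rewrite -[RHS]mulrA bE mulrC.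
  rewrite [in RHS]mulrAC mulrC; congr (_ * _).
  rewrite horner_sum /S mulr_sumr; apply: eq_bigr => k _.
  rewrite !(hornerD, hornerN, hornerM, hornerZ, hornerX, hornerC, horner_exp).
  have kK : (k <= K)%N by exact: ltnW.
  have -> : beta (rc x) - 1 = 2 * 'i * rc x / (1 - 'i * rc x).
    by rewrite /beta; field.
  have -> : (1 - 'i * rc x) ^+ K = (1 - 'i * rc x) ^+ (K - k) * (1 - 'i * rc x) ^+ k.
    by rewrite -exprD subnK.
  rewrite expr_div_n; field; exact: expf_neq0.
have psiS (x : R) : 0 < x -> x < Num.min 2^-1 (rr / 8) ->
    nm (psi (beta (rc x)) - S x) <= A * 8 ^+ K * x ^+ K.
  move=> x0; rewrite lt_min => /andP[x2 xr].
  have nx : nm (rc x : C) = x by rewrite nm_rc gtr0_norm.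
  have /andP[_ b2] := @nm_beta_sub1 R (rc x) ltac:(by rewrite nx ltW).
  rewrite nx in b2.
  apply: le_trans (hA _ _) _; first by apply: le_lt_trans b2 _; lra.
  rewrite -mulrA ler_wpM2l // -exprMn lerXn2r ?nnegrE ?nm_ge0 // mulr_ge0 //; exact: ltW.
(* The clearing factor lies between 1 and a constant, so bounds pass between [P] and the
   difference. *)
have poles (x : R) : 0 < x -> x < 1 ->
    1 <= nm ((1 - 'i * rc x) ^+ K * (1 - 'i * rc (G x)) : C)
      <= 2 ^+ K * (1 + \sum_(i < K) `|g i|).
  move=> x0 x1; rewrite nmM nmX.
  have /andP[a1 a2] := nm_pole_real x; have /andP[b1 b2] := nm_pole_real (G x).
  rewrite gtr0_norm // in a2.
  have GG : `|G x| <= \sum_(i < K) `|g i|.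
    rewrite /G; apply: le_trans (ler_norm_sum _ _ _) _; apply: ler_sum => i _.
    by rewrite normrM normrX (gtr0_norm x0) ler_piMr // exprn_ile1 // ltW.
  apply/andP; split; first by rewrite -[1]mulr1 ler_pM // exprn_ege1.
  apply: ler_pM; rewrite ?exprn_ge0 ?nm_ge0 //; last by lra.
  rewrite lerXn2r ?nnegrE ?nm_ge0 //; lra.
pose T := 2 ^+ K * (1 + \sum_(i < K) `|g i|).
have T0 : 0 <= T.
  by rewrite mulr_ge0 ?exprn_ge0 // addr_ge0 ?sumr_ge0.
have r0 : 0 < Num.min 2^-1 (rr / 8) by rewrite lt_min invr_gt0 ltr0n divr_gt0.
have m21 (x : R) : x < Num.min 2^-1 (rr / 8) -> x < 1.
  by rewrite lt_min => /andP[x2 _]; lra.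
have [|B hB] := @poly_jet P K (T * (A * 8 ^+ K + M)).
  move=> e e0; have er : 0 < Num.min e (Num.min 2^-1 (rr / 8)) by rewrite lt_min e0.
  have [x [x0 + hx]] := freq _ er; rewrite lt_min => /andP[xe xr].
  exists x; split => //; rewrite PE nmM -mulrA.
  have /andP[_ hp] := poles x x0 (m21 x xr).
  apply: ler_pM; rewrite ?nm_ge0 // mulrDl.
  have -> : S x - beta (rc (G x)) = (psi (beta (rc x)) - beta (rc (G x))) -
     (psi (beta (rc x)) - S x) by ring.
  apply: le_trans (nmD _ _) _; rewrite nmN addrC lerD //; exact: psiS.
exists (A * 8 ^+ K + B), (Num.min 2^-1 (rr / 8)); split => // x x0 xr.
have x1 := m21 x xr; have /andP[hp _] := poles x x0 x1.
have := hB x x0 x1; rewrite PE nmM => hb.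
have hb' : nm (S x - beta (rc (G x))) <= B * x ^+ K.
  by apply: le_trans hb; rewrite ler_peMl ?nm_ge0.
have -> : psi (beta (rc x)) - beta (rc (G x)) = (psi (beta (rc x)) - S x) +
   (S x - beta (rc (G x))) by ring.
by rewrite mulrDl; apply: le_trans (nmD _ _) _; rewrite lerD // psiS.
Qed.

Variables (m n : nat) (p : {poly {poly C}}).
Variables (L : nat) (N : 'I_L -> nat) (K : 'I_L -> nat) (g : 'I_L -> nat -> R).
Hypothesis K_gt0 : forall k, (0 < K k)%N.
Hypothesis center_bound : forall k, exists2 B : R, 0 <= B & forall x : R, 0 < x -> x < 1 ->
  `|center K g k x| <= B * x.

Definition followers (k : 'I_L) (L' : nat) (psi : 'I_L' -> C -> C) : {set 'I_L'} :=
  [set i | `[< follows (K k) (center K g k) (psi i) >]]%SET.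

(** Distinct [y j] lie on distinct branches, since a branch takes one value over [beta x]. A branch
    through [y j] is within [8 M x ^ K] of the centre, [8] being the Lipschitz constant of [beta];
    branches that do not follow are farther away for small [x]. *)
Lemma solutions_followers (k : 'I_L) (lam : C) (L' : nat) (psi : 'I_L' -> C -> C) (M : R) :
  0 < M -> level_set_branches (reflection m n p) p lam psi ->
  exists2 e : R, 0 < e & forall x : R, 0 < x -> x < e ->
    many_solutions m n p N K g k M x lam ->
    (\sum_(k' | cluster K g k k') N k' <= #|followers k psi|)%N.
Proof.
move=> M0 [psi_an _ [line /near2_nm[d d0 hd]]].
have [B B0 hB] := center_bound k.
have [d1 d10 h1] : exists2 d1 : R, 0 < d1 & forall i, i \notin followers k psi ->
    forall x, 0 < x -> x < d1 ->
      8 * M * x ^+ K k < nm (psi i (beta (rc x)) - beta (rc (center K g k x))).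
  apply: (common_radius (P := fun i d1 => i \notin followers k psi ->
    forall x, 0 < x -> x < d1 ->
      8 * M * x ^+ K k < nm (psi i (beta (rc x)) - beta (rc (center K g k x))))).
    by move=> i e e' _ ee' h inf x x0 xe; apply: h => //; exact: lt_le_trans ee'.
  move=> i; have [/analytic_nearE[c hc] _] := psi_an i.
  have [inf|inf] := boolP (i \in followers k psi); first by exists 1.
  have [|e e0 he] := @not_follows (psi i) c (g k) (K k) (8 * M) hc.
    by move=> h; move: inf; rewrite inE => /asboolP.
  by exists e.
(* Since [|y j| <= (B + M) x <= T x], the conditions on [e] keep [y j] where [beta] is bilipschitz
   and its image where the level set is given by the branches. *)
pose T := B + M + 1; have T0 : 0 < T by rewrite /T; lra.
pose e := Num.min (Num.min d1 1) (Num.min (2 * T)^-1 (d / (8 * T))).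
have T1 : 1 <= T by rewrite /T; lra.
exists e; first by rewrite !lt_min d10 ltr01 invr_gt0 divr_gt0 ?mulr_gt0.
move=> x x0; rewrite !lt_min => /andP[/andP[xd1 x1] /andP[xT xd]] [y yinj hy].
have xT' : x * T <= 2^-1.
  by have := ltW xT; rewrite invfM -ler_pdivlMr.
have xd' : 8 * (x * T) < d.
  by move: xd; rewrite ltr_pdivlMr ?mulr_gt0 //; lra.
have xK : x ^+ K k <= x.
  by rewrite -[leRHS]expr1 ler_wiXn2l ?(ltW x0) ?(ltW x1).
have xK0 : 0 <= x ^+ K k by rewrite exprn_ge0 // ltW.
have xxT : x <= x * T by rewrite ler_peMr // ltW.
have yx j : `|y j| <= x * T.
  have [hj _] := hy j; have := hB x x0 x1.
  have := ler_normD (y j - center K g k x) (center K g k x); rewrite subrK => h2 h3.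
  have : M * x ^+ K k <= M * x by rewrite ler_wpM2l // ltW.
  by rewrite /T; move: h2 h3 hj x0; lra.
have Gx : `|center K g k x| <= 2^-1.
  apply: le_trans (hB x x0 x1) _; apply: le_trans xT'.
  by rewrite mulrC ler_wpM2l ?(ltW x0) // /T; lra.
have nx : nm (rc x : C) <= 2^-1 by rewrite nm_rc gtr0_norm //; lra.
have ny j : nm (rc (y j) : C) <= 2^-1 by rewrite nm_rc (le_trans (yx j)).
have near1 (z : R) : `|z| <= x * T -> nm (beta (rc z) - 1 : C) < d.
  move=> zx; have /andP[_ h] := @nm_beta_sub1 R (rc z) ltac:(by rewrite nm_rc (le_trans zx)).
  by apply: le_lt_trans h _; rewrite nm_rc; apply: le_lt_trans xd'; rewrite ler_wpM2l.
have ex j : exists i, beta (rc (y j)) = psi i (beta (rc x)).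
  have [_ hl] := hy j.
  (* The component [z_2 = 1] would mean [x = 0]. *)
  have := (hd _ _ (near1 _ (yx j)) (near1 x _)).1 hl; rewrite gtr0_norm // => /(_ xxT) [//|[_ /= b1]].
  have : rc x = 0 :> C by apply: beta_inj; rewrite ?nm0 ?invr_ge0 // beta0.
  by move/eqP; rewrite fmorph_eq0 gt_eqF.
have [f hf] := choice ex.
have finj : injective f.
  by move=> i j fij; apply: yinj; apply: (@rc_inj R); apply: beta_inj => //; rewrite !hf fij.
rewrite -[leqLHS]card_ord -(card_imset _ finj); apply: subset_leq_card.
apply/fintype.subsetP => _ /imsetP[j _ ->]; apply: contraT => /h1/(_ x x0 xd1).
rewrite -hf ltNge => /negP nle; case: nle.
have [hj _] := hy j.
have /andP[_ h] := @beta_bilipschitz R (rc (y j)) (rc (center K g k x)) (ny j) ltac:(by rewrite nm_rc).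
apply: le_trans h _; rewrite -rmorphB nm_rc -mulrA ler_wpM2l //.
Qed.

End LevelBranches.

(** * Null sets of pairs *)

Section AlmostEveryPair.
Variable R : realType.
Local Notation C := (cplx R).

Lemma cis_eq1 (d : R) : cis d = 1 :> C -> `|d| < pi *+ 2 -> d = 0.
Proof.
move=> /(congr1 (@re R)); rewrite re_cis re1 => cd dpi.
pose h := d / 2; have dh : d = h *+ 2 by rewrite -mulr_natr divfK.
have sh : sin h = 0.
  apply/eqP; rewrite -sqrf_eq0 sin2cos2; move: cd; rewrite dh cos_mulr2n -[X in X - 1]mulr_natr.
  by move=> cd; apply/eqP; lra.
have hpi : `|h| < pi.
  move: dpi; rewrite dh normrMn -[X in X < _]mulr_natr -[X in _ < X]mulr_natr ltr_pM2r //.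
rewrite dh; have [h0|h0|->] := ltgtP h 0; last by rewrite mul0rn.
  have := @sin_gt0_pi R (- h); rewrite sinN sh oppr0 ltxx => /(_ _) hh.
  by suff : false by []; apply: hh; rewrite oppr_gt0 h0 -(ltr0_norm h0).
have := @sin_gt0_pi R h; rewrite sh ltxx => /(_ _) hh.
by suff : false by []; apply: hh; rewrite h0 -(gtr0_norm h0).
Qed.

(** The integer part of [s / (2 pi)] separates the points of a fibre. *)
Lemma countable_cis (z : C) : countable [set s : R | cis s = z].
Proof.
apply/countable_injP; exists (fun s => pickle (Num.floor (s / (pi *+ 2)))).
move=> s t; rewrite !inE /= => hs ht /(pcan_inj pickleK) fst.
apply/eqP; rewrite -subr_eq0; apply/eqP/cis_eq1.
  have z0 : z != 0 by rewrite -hs -nm_gt0 nm_cis.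
  by apply: (mulIf z0); rewrite mul1r -{1}ht -cisD subrK hs.
have /andP[s1 s2] := floor_itv (s / (pi *+ 2)).
have /andP[t1 t2] := floor_itv (t / (pi *+ 2)).
move: s1 s2 t1 t2; rewrite fst !intrD; set k := _%:~R.
have p0 := pi2_gt0 R.
rewrite !ler_pdivlMr // !ltr_pdivrMr // => s1 s2 t1 t2.
by rewrite ltr_norml; apply/andP; split; lra.
Qed.

Lemma countable_at_most_one (P : C -> Prop) : (forall z w, P z -> P w -> z = w) ->
  countable [set s : R | P (cis s)].
Proof.
move=> P1; have [[z Pz]|nP] := pselect (exists z, P z).
  apply: (@sub_countable _ _ _ [set s : R | cis s = z]); last exact: countable_cis.
  by apply: subset_card_le => s /= /P1; exact.
rewrite (_ : [set s | _] = set0) //.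
by apply/seteqP; split => // s /= Ps; apply: nP; exists (cis s).
Qed.

(** The strips are null by the product formula, and [D] because the product measure integrates the
    measures of its sections. *)
Lemma negligible_cross d (T : measurableType d) (mu : {sigma_finite_measure set T -> \bar R})
    (B : set T) (D : set (T * T)) : measurable B -> mu B = 0%E -> measurable D ->
  (forall s, mu (xsection D s) = 0%E) ->
  (mu \x mu)%E.-negligible ((B `*` setT) `|` (setT `*` B) `|` D).
Proof.
move=> mB B0 mD D0; apply: negligibleU; first apply: negligibleU.
- apply/negligibleP; first exact: measurableX.
  apply: (eq_trans (product_measure1E mu mu mB measurableT)).
  by apply: (eq_trans (congr1 (fun z => z * _)%E B0)); exact: mul0e.
- apply/negligibleP; first exact: measurableX.
  apply: (eq_trans (product_measure1E mu mu measurableT mB)).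
  by apply: (eq_trans (congr1 (fun z => _ * z)%E B0)); exact: mule0.
apply/negligibleP => //; rewrite /product_measure1 /=.
by apply: integral0_eq => s _ /=; exact: D0.
Qed.

(** The diagonal is discarded with the bad values: for [lam = mu] matched branches may coincide and
    then have no order of contact. *)
Lemma ae_torus_pairs (bad : C -> Prop) (P : C -> C -> Prop) :
  countable [set s : R | bad (cis s)] ->
  (forall lam mu : C, nm lam = 1 -> nm mu = 1 -> lam != mu ->
     ~ bad lam -> ~ bad mu -> P lam mu) ->
  ae_torus P.
Proof.
move=> cB hP; set B := [set s : R | bad (cis s)] in cB.
pose D : set (R * R) := [set st | cis st.1 = cis st.2 :> C].
have mB : measurable B by exact: countable_measurable.
have B0 : lebesgue_measure B = 0%E by exact: countable_lebesgue_measure0.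
have DE : D = [set st | cos st.1 - cos st.2 = 0] `&` [set st | sin st.1 - sin st.2 = 0].
  apply/seteqP; split => -[s t]; rewrite /D /=.
    by move=> st; have := congr1 (@re R) st; have := congr1 (@im R) st;
      rewrite !re_cis !im_cis => -> ->; rewrite !subrr.
  move=> [/eqP + /eqP]; rewrite !subr_eq0 => /eqP hc /eqP hs.
  by apply: ceq; rewrite ?re_cis ?im_cis.
have mD : measurable D.
  rewrite DE; apply: measurableI.
    have mf : measurable_fun setT (fun st : R * R => cos st.1 - cos st.2).
      apply: measurable_funB.
        by apply: measurableT_comp => //; apply: continuous_measurable_fun; exact: continuous_cos.
      by apply: measurableT_comp => //; apply: continuous_measurable_fun; exact: continuous_cos.
    by have := mf measurableT [set 0] (measurable_set1 _); rewrite setTI.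
  have mf : measurable_fun setT (fun st : R * R => sin st.1 - sin st.2).
    apply: measurable_funB.
      by apply: measurableT_comp => //; apply: continuous_measurable_fun; exact: continuous_sin.
    by apply: measurableT_comp => //; apply: continuous_measurable_fun; exact: continuous_sin.
  by have := mf measurableT [set 0] (measurable_set1 _); rewrite setTI.
have sD t : xsection D t = [set u | cis u = cis t :> C].
  by apply/seteqP; split => u; rewrite /xsection /= inE /D /= => ->.
have sD0 (t : measurableTypeR R) : lebesgue_measure (xsection D t) = 0%E.
  by rewrite sD; apply: countable_lebesgue_measure0; exact: countable_cis.
have [A [mA A0 sA]] := @negligible_cross _ (measurableTypeR R) lebesgue_measure B D mB B0 mD sD0.
exists A; split => //; apply: subset_trans sA.
move=> [s t] /= nP; apply: contrapT => h; apply: nP.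
apply: hP; rewrite ?nm_cis //.
- by apply/negP => /eqP st; apply: h; right.
- by move=> b; apply: h; left; left.
- by move=> b; apply: h; left; right.
Qed.

End AlmostEveryPair.

(** * Orders of contact *)

Section Contact.
Variable R : realType.
Local Notation C := (cplx R).

Lemma pseries_continuous (f : C -> C) (a : C) (c : nat -> C) (e : R) :
  has_pseries f a c -> 0 < e ->
  exists2 d : R, 0 < d & forall z, nm (z - a) < d -> nm (f z - f a) < e.
Proof.
move=> fc e0; have [A [r [r0 A0 h]]] := taylor_expansion 1 fc.
exists (Num.min r (e / (A + 1))); first by rewrite lt_min r0 divr_gt0 // ltr_wpDl.
move=> z; rewrite lt_min ltr_pdivlMr ?ltr_wpDl // => /andP[zr ze].
have := h z zr; rewrite big_ord1 expr0 mulr1 -(pseries_at_center fc) expr1.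
by move: ze; have := nm_ge0 (z - a); lra.
Qed.

(** On a shared germ [q = lam p = mu p], so [p] and [q] would vanish together over every [z_2] near
    1, against [common_zeros_finite]. *)
Lemma germ_neq (p q : {poly {poly C}}) (lam mu : C) (L1 L2 : nat)
    (psi1 : 'I_L1 -> C -> C) (psi2 : 'I_L2 -> C -> C) i j :
  p != 0 -> no_common_factor p q -> lam != mu ->
  level_set_branches q p lam psi1 -> level_set_branches q p mu psi2 ->
  ~ (\forall z \near (1 : C), psi1 i z = psi2 j z).
Proof.
move=> p0 ncf lm [an1 _ [l1 /near2_nm[d1 d10 h1]]] [an2 _ [l2 /near2_nm[d2 d20 h2]]].
move=> /near_nm[d3 d30 h3].
have [c c0 hc] := common_zeros_finite p0 ncf.
have [d4 d40 h4] := poly_nonzero_near 1 c0.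
have [/analytic_nearE[a ha] psi11] := an1 i.
have m0 : 0 < Num.min d1 d2 by rewrite lt_min d10.
have [d5 d50 h5] := pseries_continuous ha m0.
pose d := Num.min (Num.min d1 d2) (Num.min d3 (Num.min d4 d5)) / 2.
have dd : 0 < Num.min (Num.min d1 d2) (Num.min d3 (Num.min d4 d5)).
  by rewrite !lt_min d10 d20 d30 d40.
have d0 : 0 < d by rewrite divr_gt0.
have [z nz] : exists z : C, nm (z - 1) = d.
  by exists (1 + rc d); rewrite addrC addKr nm_rc gtr0_norm.
have : d < Num.min (Num.min d1 d2) (Num.min d3 (Num.min d4 d5)).
  by rewrite /d ltr_pdivrMr //; lra.
rewrite !lt_min -nz => /andP[/andP[z1 z2] /and3P[z3 z4 z5]].
have := h5 z z5; rewrite psi11 lt_min => /andP[p1 p2].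
have lev1 : level_set q p lam (psi1 i z, z).
  by apply/(h1 _ _ p1 z1); left; exists i.
have lev2 : level_set q p mu (psi1 i z, z).
  by apply/(h2 _ _ p2 z2); left; exists j; rewrite /= h3.
move: lev1 lev2; rewrite /level_set /eval2 /= => e1 e2.
have pz : p.[psi1 i z, z] = 0.
  have /eqP : (lam - mu) * p.[psi1 i z, z] = 0 by rewrite mulrBl -e1 -e2 subrr.
  by rewrite mulf_eq0 subr_eq0 (negbTE lm) => /eqP.
have := h4 z; rewrite nz d0 -{1}nz => /(_ isT z4)/eqP; apply.
by apply: (hc (psi1 i z)); rewrite // e1 pz mulr0.
Qed.

(** [K'] is the first index where the Taylor coefficients differ. Along [beta x] with [x > 0] the
    difference is [O (x ^ K)], so the coefficients below [K] agree. *)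
Lemma order_of_contact_ge (psi1 psi2 : C -> C) (c1 c2 : nat -> C) (K : nat) (G : R -> R) :
  has_pseries psi1 1 c1 -> has_pseries psi2 1 c2 -> psi1 1 = psi2 1 ->
  ~ (\forall z \near (1 : C), psi1 z = psi2 z) ->
  follows K G psi1 -> follows K G psi2 ->
  exists K', is_order_of_contact psi1 psi2 K' /\ (K <= K')%N.
Proof.
move=> h1 h2 e12 ne [B1 [d1 [d10 f1]]] [B2 [d2 [d20 f2]]].
have hd := has_pseriesB h1 h2.
have ex : exists k, c1 k != c2 k.
  apply: contrapT => h; apply: ne.
  have c0 k : c1 k - c2 k = 0.
    by apply/eqP; rewrite subr_eq0; apply: contraT => ck; case: h; exists k.
  apply: filterS (pseries0_near hd c0) => z /eqP.
  by rewrite subr_eq0 => /eqP.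
have [K' cK' minK'] := ex_minnP ex.
exists K'; split; last first.
  rewrite leqNgt; apply/negP => KK.
  have := @pseries_small_coef _ _ _ _ K ((B1 + B2) * 2 ^+ K) hd _ K' KK.
  move=> hc; move: cK'; rewrite -subr_eq0 hc ?eqxx // => e e0.
  (* This puts [8 x], a bound for [|beta x - 1|], below every radius; the factor [2 ^+ K] comes from
     [x <= 2 |beta x - 1|]. *)
  pose x := Num.min (Num.min d1 d2) (Num.min 1 e) / 16.
  have m0 : 0 < Num.min (Num.min d1 d2) (Num.min 1 e).
    by rewrite !lt_min d10 d20 ltr01.
  have x0 : 0 < x by rewrite divr_gt0.
  have : 8 * x < Num.min (Num.min d1 d2) (Num.min 1 e) by rewrite /x; lra.
  rewrite !lt_min => /andP[/andP[x1 x2] /andP[x3 x4]].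
  have nx : nm (rc x : C) = x by rewrite nm_rc gtr0_norm.
  have /andP[b1 b2] := @nm_beta_sub1 R (rc x) ltac:(by rewrite nx; lra).
  rewrite nx in b1 b2.
  exists (beta (rc x)); split.
  - by apply: lt_le_trans b1; rewrite mulr_gt0 ?invr_gt0.
  - by apply: le_lt_trans b2 _.
  have g1 := f1 x x0 ltac:(lra); have g2 := f2 x x0 ltac:(lra).
  have -> : psi1 (beta (rc x)) - psi2 (beta (rc x)) =
    (psi1 (beta (rc x)) - beta (rc (G x))) - (psi2 (beta (rc x)) - beta (rc (G x))) by ring.
  apply: le_trans (nmD _ _) _; rewrite nmN.
  have xK0 : 0 < x ^+ K by rewrite exprn_gt0.
  apply: (@le_trans _ _ ((B1 + B2) * x ^+ K)); first by rewrite mulrDl lerD.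
  rewrite -mulrA -exprMn ler_wpM2l //.
    have : 0 <= (B1 + B2) * x ^+ K.
      have g1' := le_trans (nm_ge0 _) g1; have g2' := le_trans (nm_ge0 _) g2.
      by rewrite mulrDl addr_ge0.
    by rewrite pmulr_lge0.
  by rewrite lerXn2r ?nnegrE ?mulr_ge0 ?nm_ge0 ?(ltW x0) //; lra.
split.
- rewrite lt0n; apply: contra cK' => /eqP ->; apply/eqP.
  by rewrite -(pseries_at_center h1) -(pseries_at_center h2).
- rewrite (derive1n_pseries K' h1) (derive1n_pseries K' h2) -subr_eq0 -mulrnBl mulrn_eq0.
  by rewrite negb_or -lt0n fact_gt0 /= subr_eq0.
- move=> k /andP[_ kK]; rewrite (derive1n_pseries k h1) (derive1n_pseries k h2).
  suff -> : c1 k = c2 k by [].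
  by apply/eqP; apply: contraT => /minK'; rewrite leqNgt kK.
Qed.

Variables (L : nat) (N : 'I_L -> nat) (Psi : 'I_L -> C -> C).
Hypothesis N_gt0 : forall k, (0 < N k)%N.
Hypothesis Psi_analytic : forall k, analytic_near (Psi k) 0.
Hypothesis Psi0 : forall k, Psi k 0 = 0.
Variables (K : 'I_L -> nat) (g : 'I_L -> nat -> R) (A c : 'I_L -> R) (d : R).
Hypothesis d_gt0 : 0 < d.
Hypothesis expansion : branch_expansion N Psi K g A c d.

(** Both centres are [O (x ^ K k)] close to the same branch, hence to each other, and their
    coefficients below [K k] agree. This is the compatibility that the greedy matching asks for. *)
Lemma followers_cluster (k k' : 'I_L) (psi : C -> C) : (K k <= K k')%N ->
  follows (K k) (center K g k) psi -> follows (K k') (center K g k') psi ->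
  cluster K g k k'.
Proof.
move=> KK [B1 [d1 [d10 f1]]] [B2 [d2 [d20 f2]]].
have [a1 a10 s1] := center_small N_gt0 Psi0 d_gt0 expansion k.
have [a2 a20 s2] := center_small N_gt0 Psi0 d_gt0 expansion k'.
rewrite /cluster KK /=; apply/forallP => i; rewrite eq_sym -subr_eq0; apply/eqP.
pose S := \sum_(i < K k') `|g k' i|.
apply: (@rc_inj R); rewrite rmorph0.
apply: (@small_jet_eq0 R (fun j => rc (g k j - g k' j)) (K k)
  (2 * (B1 + `|B2|) + S) _ i (ltn_ord i)) => e e0.
pose D := Num.min (Num.min d1 d2) (Num.min (Num.min 1 e) (2 * (a1 + a2 + 1))^-1).
have T0 : 0 < 2 * (a1 + a2 + 1) by lra.
have D0 : 0 < D by rewrite !lt_min d10 d20 ltr01 e0 invr_gt0.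
have [x x0] : exists2 x : R, 0 < x & x < D.
  by exists (D / 2); rewrite ?divr_gt0 // ltr_pdivrMr //; lra.
rewrite !lt_min => /andP[/andP[x1 x2] /andP[/andP[x3 x4] x5]].
have xT : x * (2 * (a1 + a2 + 1)) <= 1 by rewrite -ler_pdivlMr // mul1r ltW.
have nx : nm (rc x : C) = x by rewrite nm_rc gtr0_norm.
exists (rc x); rewrite nx; split=> //.
have c1 := s1 x x0 x3; have c2 := s2 x x0 x3.
have hg1 : nm (rc (center K g k x) : C) <= 2^-1 by rewrite nm_rc; apply: le_trans c1 _; nra.
have hg2 : nm (rc (center K g k' x) : C) <= 2^-1 by rewrite nm_rc; apply: le_trans c2 _; nra.
have /andP[bl _] := beta_bilipschitz hg1 hg2.
have xK (i0 : nat) : (K k <= i0)%N -> x ^+ i0 <= x ^+ K k.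
  by move=> ki; apply: ler_wiXn2l => //; exact: ltW.
have xK0 : 0 <= x ^+ K k by rewrite exprn_ge0 // ltW.
have dist : `|center K g k x - center K g k' x| <= 2 * (B1 + `|B2|) * x ^+ K k.
  move: bl; rewrite -rmorphB nm_rc.
  have g1 := f1 x x0 x1; have g2 := f2 x x0 x2.
  have -> : beta (rc (center K g k x)) - beta (rc (center K g k' x)) =
    (psi (beta (rc x)) - beta (rc (center K g k' x))) -
    (psi (beta (rc x)) - beta (rc (center K g k x))) by ring.
  have g3 : B2 * x ^+ K k' <= `|B2| * x ^+ K k.
    apply: (@le_trans _ _ (`|B2| * x ^+ K k')).
      by rewrite ler_wpM2r ?ler_norm // exprn_ge0 // ltW.
    by rewrite ler_wpM2l // xK.
  have := nmD (psi (beta (rc x)) - beta (rc (center K g k' x)))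
    (- (psi (beta (rc x)) - beta (rc (center K g k x)))).
  by rewrite nmN; move: g1 g2 g3; lra.
have tail : center K g k' x = \sum_(j < K k) g k' j * x ^+ j +
    \sum_(K k <= j < K k') g k' j * x ^+ j.
  rewrite /center -(big_mkord xpredT (fun j => g k' j * x ^+ j)).
  by rewrite (big_cat_nat (n := K k)) //= big_mkord.
have tail_le : `|\sum_(K k <= j < K k') g k' j * x ^+ j| <= S * x ^+ K k.
  apply: le_trans (ler_norm_sum _ _ _) _; rewrite /S mulr_suml.
  rewrite -(big_mkord xpredT (fun j => `|g k' j| * x ^+ K k)).
  rewrite [leRHS](big_cat_nat (n := K k)) //=.
  apply: (@le_trans _ _ (\sum_(K k <= j < K k') `|g k' j| * x ^+ K k)); last first.
    by rewrite lerDr; apply: sumr_ge0 => j _; rewrite mulr_ge0.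
  rewrite big_nat [leRHS]big_nat; apply: ler_sum => j /andP[kj _].
  by rewrite normrM normrX (gtr0_norm x0) ler_wpM2l // xK.
have -> : \sum_(j < K k) rc (g k j - g k' j) * rc x ^+ j =
    rc (center K g k x - center K g k' x + \sum_(K k <= j < K k') g k' j * x ^+ j) :> C.
  rewrite tail opprD addrA subrK /center -sumrB rmorph_sum; apply: eq_bigr => j _.
  by rewrite -mulrBl rmorphM rmorphXn.
rewrite nm_rc; apply: le_trans (ler_normD _ _) _; rewrite mulrDl.
exact: lerD.
Qed.

(** As the centre is real, [im (Psi k t)] is comparable to [|x| ^ K]; [beta] turns it into
    [1 - |psi z|], and [|x|] into [|1 - z|]. *)
Lemma branch_contact_order (k : 'I_L) (rt : C -> C) (psi : C -> C) :
  (forall w, rt w ^+ N k = w) ->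
  (\forall z \near (1 : C), psi z = beta (Psi k (rt (beta_inv z)))) ->
  is_contact_order psi (K k).
Proof.
move=> hrt /near_nm[d1 d10 h1].
have [Keven A0 c0 hexp] := expansion k.
have K0 := contact_gt0 N_gt0 Psi0 d_gt0 expansion k.
split => //.
have /analytic_nearE[a ha] := Psi_analytic k.
have [d2 d20 h2] := @pseries_small R (Psi k) a (2^-1) ha (Psi0 k) ltac:(by rewrite invr_gt0).
(* [1 / 2] and [16] compare [1 - |beta w|] with [im w], while [8] and [2] compare [|z - 1|] with
   [|x|]; [A k + 1] is positive even if [A k = 0]. *)
pose c1 := c k / 2 / 8 ^+ K k; pose c2 := 16 * (A k + 1) * 2 ^+ K k.
exists (rc c1), (rc c2); split.
- by rewrite -(rmorph0 (@rc R)) lt_rc !divr_gt0 ?exprn_gt0.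
- by rewrite -(rmorph0 (@rc R)) lt_rc !mulr_gt0 ?exprn_gt0 ?ltr_wpDl.
pose D := Num.min (Num.min d1 d) (Num.min 4^-1 (d2 ^+ N k)).
have D0 : 0 < D by rewrite !lt_min d10 d_gt0 invr_gt0 exprn_gt0 // ltr0n.
apply/near_nm; exists D => // z; rewrite !lt_min => /andP[/andP[zd1 zd] /andP[z4 zd2]].
move=> /(congr1 (@re R)); rewrite -[re `|z|]/(nm z) => nz.
have z10 : 1 + z != 0.
  rewrite -nm_gt0; have -> : 1 + z = 2 + (z - 1) by ring.
  have := nmBD 2 (- (z - 1)); rewrite nmN opprK nm_nat; lra.
have zx := beta_inv_real nz z10; set x := re _ in zx.
have zE : z = beta (rc x) by rewrite -zx beta_invK.
have xz : `|x| <= nm (z - 1).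
  by rewrite -nm_rc -zx nm_beta_inv //; lra.
have xd : `|x| < d by exact: le_lt_trans zd.
have hx : nm (rc x : C) <= 2^-1 by rewrite nm_rc; lra.
have /andP[b1 b2] := nm_beta_sub1 hx; rewrite -zE nm_rc in b1 b2.
set t := rt (rc x); have tN : t ^+ N k = rc x by exact: hrt.
have t2 : nm t < d2.
  rewrite -(@ltr_pXn2r _ (N k)) ?nnegrE ?nm_ge0 ?(ltW d20) // -nmX tN nm_rc.
  exact: le_lt_trans zd2.
have [e1 e2] := hexp x t xd tN.
have wsmall := ltW (h2 t t2).
have iw : im (Psi k t) <= A k * `|x| ^+ K k.
  apply: le_trans e1; apply: le_trans (im_le _).
  by rewrite imD imN im_rc oppr0 addr0 ler_norm.
have psiE : psi z = beta (Psi k t) by rewrite h1 // zx.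
have xK : 0 <= `|x| ^+ K k by rewrite exprn_ge0.
have key : 2^-1 * im (Psi k t) <= 1 - nm (psi z) <= 16 * im (Psi k t).
  have [x0|x0] := eqVneq x 0.
    have /eqP : nm t ^+ N k = 0 by rewrite -nmX tN x0 rmorph0 nm0.
    rewrite expf_eq0 N_gt0 /= nm_eq0 => /eqP t0.
    by rewrite psiE t0 Psi0 beta0 nm1 subrr; rewrite (_ : im 0 = 0) // !mulr0 lexx.
  rewrite psiE; apply: one_sub_nm_beta => //.
  by apply: lt_le_trans e2; rewrite mulr_gt0 // exprn_gt0 // normr_gt0.
have -> : `|1 - z| = rc (nm (z - 1)) by rewrite normE nmB.
have -> : 1 - `|psi z| = rc (1 - nm (psi z)) by rewrite normE rmorphB rmorph1.
rewrite -(rmorphXn (@rc R)) -!(rmorphM (@rc R)) !le_rc.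
move: key => /andP[k1 k2].
have x8 : nm (z - 1) ^+ K k <= 8 ^+ K k * `|x| ^+ K k.
  by rewrite -exprMn lerXn2r ?nnegrE ?nm_ge0 ?mulr_ge0.
have x2 : `|x| ^+ K k <= 2 ^+ K k * nm (z - 1) ^+ K k.
  rewrite -exprMn lerXn2r ?nnegrE ?nm_ge0 ?mulr_ge0 ?nm_ge0 //; lra.
apply/andP; split.
  apply: (@le_trans _ _ (c1 * (8 ^+ K k * `|x| ^+ K k))).
    by rewrite ler_wpM2l // !divr_ge0 ?exprn_ge0 // ltW.
  have -> : c1 * (8 ^+ K k * `|x| ^+ K k) = c k / 2 * `|x| ^+ K k.
    by rewrite /c1; field; rewrite expf_neq0.
  by move: k1 e2; lra.
apply: (@le_trans _ _ (16 * (A k * `|x| ^+ K k))); first by move: k2 iw; lra.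
rewrite /c2 -!mulrA ler_wpM2l // mulrDl mul1r.
have := ler_wpM2l A0 x2.
have : 0 <= 2 ^+ K k * nm (z - 1) ^+ K k by rewrite mulr_ge0 ?exprn_ge0 ?nm_ge0.
lra.
Qed.

End Contact.

(** Each value is matched with the zero branches on its own; the two values meet only at the end,
    where [lambda != mu] makes the matched germs different. *)
Theorem theorem5p1 (R : realType) (m n : nat) (p : {poly {poly cplx R}})
    (L0 : nat) (psi0 : 'I_L0 -> cplx R -> cplx R) :
  A1 m n p ->
  zero_set_branches m n (reflection m n p) psi0 ->
  ae_torus (fun lambda mu : cplx R =>
    forall (Ll Lm : nat) (psil : 'I_Ll -> cplx R -> cplx R)
      (psim : 'I_Lm -> cplx R -> cplx R),
    level_set_branches (reflection m n p) p lambda psil ->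
    level_set_branches (reflection m n p) p mu psim ->
    exists (hl : (L0 <= Ll)%N) (hm : (L0 <= Lm)%N)
      (s : {perm 'I_Ll}) (t : {perm 'I_Lm}),
    forall l : 'I_L0, exists K K' : nat,
      [/\ is_contact_order (psi0 l) K,
          is_order_of_contact (psim (t (widen_ord hm l)))
                              (psil (s (widen_ord hl l))) K' &
          (K <= K')%N]).
Proof.
move=> [pdeg pD ncf _ _].
move=> [L [N [alpha [q [Psi [r [e [[ahol _] fact hW hPsi [ebij epsi]]]]]]]]].
have N0 k : (0 < N k)%N by case: (hW k).
have qW k : weierstrass (N k) (q k) by case: (hW k).
have Pan k : analytic_near (Psi k) 0 by case: (hPsi k).
have P0 k : Psi k 0 = 0 by case: (hPsi k).
have rbr k : root_branches (r k) by case: (hPsi k).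
have qz k : \forall w \near ((0, 0) : cplx R * cplx R), q k w = 0 <->
    exists t, t ^+ N k = w.2 /\ w.1 = Psi k t by case: (hPsi k).
have [K [g [A [c [d [d0 expn]]]]]] :=
  branch_expansion_exists pdeg ncf pD fact N0 Pan P0 rbr qz.
have roots := local_roots pdeg ncf pD ahol fact qW qz.
pose mult k := (\sum_(k' | cluster K g k k') N k')%N.
(* Badness ranges over all systems of level branches, because the exceptional set is fixed before
   any system is given. *)
pose bad_at (l : 'I_L0) (lam : cplx R) := nm lam = 1 /\
  exists (L' : nat) (psi : 'I_L' -> cplx R -> cplx R),
    level_set_branches (reflection m n p) p lam psi /\
    (#|followers K g (tag (e l)) psi| < mult (tag (e l)))%N.
have csmall := center_small N0 P0 d0 expn.
have K_gt0 := contact_gt0 N0 P0 d0 expn.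
have bad_unique l lam mu : bad_at l lam -> bad_at l mu -> lam = mu.
  move=> [l1 [L1 [psi1 [b1 c1]]]] [m1 [L2 [psi2 [b2 c2]]]].
  apply/eqP; apply: contraT => lm.
  have [M M0 [e0 e00 h0]] := solutions_near_center pdeg N0 d0 expn roots (tag (e l)) l1 m1 lm.
  have [e1 e10 h1] := solutions_followers N K_gt0 csmall (tag (e l)) M0 b1.
  have [e2 e20 h2] := solutions_followers N K_gt0 csmall (tag (e l)) M0 b2.
  (* A single [x] suffices: one of the two values has enough solutions there, hence enough
     followers, and is not bad. *)
  pose x := Num.min e0 (Num.min e1 e2) / 2.
  have x0 : 0 < x by rewrite divr_gt0 // !lt_min e00 e10.
  have : x < Num.min e0 (Num.min e1 e2).
    by rewrite ltr_pdivrMr // mulr_natr mulr2n ltrDl !lt_min e00 e10.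
  rewrite !lt_min => /and3P[xe0 xe1 xe2].
  have [s|s] := h0 x x0 xe0.
    by have := h1 x x0 xe1 s; rewrite leqNgt c1.
  by have := h2 x x0 xe2 s; rewrite leqNgt c2.
apply: (@ae_torus_pairs R (fun lam => exists l, bad_at l lam)).
  rewrite (_ : [set s | _] = \bigcup_(l in [set: 'I_L0]) [set s | bad_at l (cis s)]).
    apply: bigcup_countable => // l _; apply: countable_at_most_one; exact: bad_unique.
  by apply/seteqP; split => s /= [l]; [exists l|move=> _; exists l].
move=> lam mu l1 m1 lm nbl nbm Ll Lm psil psim bl bm.
have matching (z : cplx R) (L' : nat) (psi : 'I_L' -> cplx R -> cplx R) : nm z = 1 ->
    ~ (exists l, bad_at l z) -> level_set_branches (reflection m n p) p z psi ->
    exists (h : (L0 <= L')%N) (s : {perm 'I_L'}), forall l,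
      follows (K (tag (e l))) (center K g (tag (e l))) (psi (s (widen_ord h l))).
  move=> z1 nb bz.
  (* The cardinality condition is exactly the failure of badness: the class of [l] has [mult]
     elements. *)
  have [|||f finj fA] := @greedy_matching 'I_L0 'I_L' (fun l => K (tag (e l)))
    (fun l => followers K g (tag (e l)) psi)
    (fun l => [set l' | cluster K g (tag (e l)) (tag (e l'))]%SET).
  - by move=> l; rewrite inE cluster_refl.
  - move=> l; rewrite (card_tagged_class (fun k => cluster K g (tag (e l)) k) ebij).
    by rewrite leqNgt; apply/negP => h; apply: nb; exists l; split => //; exists L', psi.
  - move=> l l' i KK; rewrite !inE => f1 f2.
    exact: (followers_cluster N0 P0 d0 expn KK f1 f2).
  have [h [s hs]] := injection_perm finj; exists h, s => l.
  by rewrite hs; have := fA l; rewrite inE => /asboolP.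
have [hl [s hs]] := matching lam Ll psil l1 nbl bl.
have [hm [t ht]] := matching mu Lm psim m1 nbm bm.
exists hl, hm, s, t => l.
have [anl _ _] := bl; have [anm _ _] := bm.
have [/analytic_nearE[cl hcl] vl] := anl (s (widen_ord hl l)).
have [/analytic_nearE[cm hcm] vm] := anm (t (widen_ord hm l)).
have ml : mu != lam by rewrite eq_sym.
have ne := germ_neq (i := t (widen_ord hm l)) (j := s (widen_ord hl l))
  (bidegree_neq0 pdeg) ncf ml bm bl.
have [K' [oK' KK']] := order_of_contact_ge hcm hcl (etrans vm (esym vl)) ne (ht l) (hs l).
exists (K (tag (e l))), K'; split => //.
apply: (branch_contact_order N0 Pan P0 d0 expn (rt := r (tag (e l)) (tagged (e l)))) => //.
by move=> w; have [h _ _] := rbr (tag (e l)).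
Qed.
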